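(* Let $\lambda>0$, $\alpha\in(0,1)$, and let $p,q\ge 0$ with $p+q=1$. For $\gamma>0$ let $$A(t)=A_\gamma(t)=\sum_{j=0}^{N(t)}\epsilon_j\,\gamma\,e^{X_j},\qquad t>0,$$ where $N(t)$, $t>0$, is a Poisson process with rate $\lambda$, the $X_j$ ($j=0,1,2,\dots$) are exponential random variables with parameter $\alpha$ (density $\alpha e^{-\alpha x}$, $x>0$), the $\epsilon_j$ satisfy $P\{\epsilon_j=+1\}=p$ and $P\{\epsilon_j=-1\}=q$, and $N$, $(X_j)_{j\ge0}$, $(\epsilon_j)_{j\ge0}$ are all mutually independent. Let $\mathfrak{H}^\alpha_1(t)$ and $\mathfrak{H}^\alpha_2(t)$ be two independent $\alpha$-stable subordinators, with $\mathbb{E}\exp(-\mu\,\mathfrak{H}^\alpha_j(t))=\exp(-t\mu^\alpha)$ for $\mu\ge 0$, $t\ge 0$, $j=1,2$. Put $t^*=\lambda\,\Gamma(1-\alpha)\,t$. Then, for every $t>0$, $$A_\gamma(t/\gamma^\alpha)\ \longrightarrow\ \mathfrak{H}^\alpha_1(p\,t^* )-\mathfrak{H}^\alpha_2(q\,t^* )\qquad\text{in distribution as }\gamma\to 0,$$ and the limit process $t\mapsto \mathfrak{H}^\alpha_1(p\,t^* )-\mathfrak{H}^\alpha_2(q\,t^* )$ has generator (in the Fourier-symbol convention stated in the context) $$\mathcal{A}f(x)=-\lambda\,\Gamma(1-\alpha)\left(p\,\frac{d^\alpha}{dx^\alpha}+q\,\frac{d^\alpha}{d(-x)^\alpha}\right)f(x),\qquad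 f\in\mathscr{S}(\mathbb{R}),$$ where $\frac{d^\alpha}{dx^\alpha}$ and $\frac{d^\alpha}{d(-x)^\alpha}$ are the Weyl fractional derivatives.
   Context: Weyl fractional derivatives, for $\alpha\in(0,1)$: $$\frac{d^\alpha f}{dx^\alpha}(x)=\frac{1}{\Gamma(1-\alpha)}\frac{d}{dx}\int_0^\infty f(x-y)\frac{dy}{y^\alpha}=\frac{\alpha}{\Gamma(1-\alpha)}\int_0^\infty\big(f(x)-f(x-y)\big)\frac{dy}{y^{\alpha+1}},$$ $$\frac{d^\alpha f}{d(-x)^\alpha}(x)=\frac{-1}{\Gamma(1-\alpha)}\frac{d}{dx}\int_0^\infty f(x+y)\frac{dy}{y^\alpha}=\frac{\alpha}{\Gamma(1-\alpha)}\int_0^\infty\big(f(x)-f(x+y)\big)\frac{dy}{y^{\alpha+1}}.$$ Fourier transform: $\widehat f(\xi)=\int_{\mathbb{R}}e^{i\xi x}f(x)\,dx$. Generator convention: for a Lévy process $F_t$ on $\mathbb{R}$ started at $0$, its Fourier symbol is $\Phi(\xi)=-\partial_t\,\mathbb{E}e^{i\xi F_t}\big|_{t=0}$ (so $\mathbb{E}e^{i\xi F_t}=e^{-t\Phi(\xi)}$), and its generator $\mathcal{A}$ is the operator $$(\mathcal{A}f)(x)=-\frac{1}{2\pi}\int_{\mathbb{R}}e^{-i\xi x}\,\Phi(\xi)\,\widehat f(\xi)\,d\xi,$$ i.e. $\widehat{\mathcal{A}f}(\xi)=-\Phi(\xi)\widehat f(\xi)$. $\mathscr{S}(\mathbb{R})$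 is the space of rapidly decaying $C^\infty$ functions. *)

(* Defs.v *)
From HB Require Import structures.
From mathcomp Require Import all_boot all_order all_algebra.
From mathcomp Require Import complex.
From mathcomp Require Import all_classical all_reals all_analysis.
From mathcomp Require Import measurable_realfun.

Set Implicit Arguments.
Unset Strict Implicit.
Unset Printing Implicit Defensive.

Import Order.TTheory GRing.Theory Num.Theory.
Import numFieldNormedType.Exports.

Local Open Scope classical_set_scope.
Local Open Scope ring_scope.
Local Open Scope complex_scope.

Definition mutually_independent {d} {T : measurableType d} {R : realType}
    (P : probability T R) (I : eqType) (G : I -> set_system T) : Prop :=
  forall (J : seq I) (B : I -> set T), uniq J ->
    (forall i, i \in J -> G i (B i)) ->
    P (\bigcap_(i in [set` J]) B i) = (\prod_(i <- J) P (B i))%E.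

(** The sigma-algebra of a process, restricted to times [t >= 0]: all processes
    below are indexed by [R], but their values at negative times are
    irrelevant. *)
Definition process_sigma {d d'} {T : measurableType d}
    {T' : measurableType d'} {R : realType} (X : R -> T -> T') : set_system T :=
  <<s \bigcup_(t in [set t : R | 0 <= t]) g_sigma_algebra_preimage (X t) >>.

Definition cvg_in_distribution {d d'} {T : measurableType d}
    {T' : measurableType d'} {R : realType} {P : probability T R}
    {P' : probability T' R} {I : Type} (F : set_system I)
    (X : I -> {RV P >-> R}) (Y : {RV P' >-> R}) : Prop :=
  forall h : R -> R, continuous h -> (exists C, forall x, `|h x| <= C) ->
    ('E_P[h \o X i] @[i --> F] --> 'E_P'[h \o Y])%E.

Section processes.
Context {d} {T : measurableType d} {R : realType} (P : probability T R).

Definition cadlag (x : R -> R) : Prop :=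
  (forall t, 0 <= t -> x s @[s --> t^'+] --> x t) /\
  (forall t, 0 < t -> cvg (x s @[s --> t^'-])).

Definition nondecreasing_path (x : R -> R) : Prop :=
  forall s t, 0 <= s -> s <= t -> x s <= x t.

Definition independent_increments (X : R -> T -> R) : Prop :=
  forall t : nat -> R, 0 <= t 0%N -> nondecreasing_seq t ->
    mutually_independent P
      (fun i => g_sigma_algebra_preimage (X (t i.+1) \- X (t i))).

Definition stationary_increments (X : R -> T -> R) : Prop :=
  forall s t, 0 <= s -> s <= t -> forall B : set R, measurable B ->
    P ((X t \- X s) @^-1` B) = P (X (t - s) @^-1` B).

Record levy_process (X : R -> {RV P >-> R}) : Prop := LevyProcess {
  levy_start : {ae P, forall w, X 0 w = 0} ;
  levy_indep : independent_increments X ;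
  levy_stat : stationary_increments X ;
  levy_path : {ae P, forall w, cadlag (X ^~ w)} }.

(** The (unused) second argument of [poisson_prob] is an artefact of the
    library. The truncated subtraction is a true difference by
    [poisson_path]. *)
Record poisson_process (rate : R) (N : R -> {RV P >-> nat}) : Prop :=
  PoissonProcess {
  poisson_start : {ae P, forall w, N 0 w = 0%N} ;
  poisson_path : {ae P, forall w, cadlag (fun t => (N t w)%:R) /\
                                  nondecreasing_path (fun t => (N t w)%:R)} ;
  poisson_indep : independent_increments (fun t w => (N t w)%:R) ;
  poisson_incr : forall s t, 0 <= s -> s < t -> forall B : set nat,
    P [set w | B (N t w - N s w)%N] = poisson_prob (rate * (t - s)) 0 B }.

Record stable_subordinator (alpha : R) (H : R -> {RV P >-> R}) : Prop :=
  StableSubordinator {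
  stable_levy : levy_process H ;
  stable_path : {ae P, forall w, nondecreasing_path (H ^~ w)} ;
  stable_laplace : forall t u, 0 <= t -> 0 <= u ->
    ('E_P[fun w => expR (- u * H t w)])%E = (expR (- t * u `^ alpha))%:E }.

(** The sigma-algebras generated by the process [N] as a whole, by each [X j]
    and by each [eps j]. *)
Definition driving_sigma (N : R -> {RV P >-> nat}) (X eps : nat -> {RV P >-> R})
    (i : unit + nat + nat) : set_system T :=
  match i with
  | inl (inl _) => process_sigma N
  | inl (inr j) => g_sigma_algebra_preimage (X j)
  | inr j => g_sigma_algebra_preimage (eps j)
  end.

End processes.

Section random_sum.
Context {d} {T : measurableType d} {R : realType} (P : probability T R).
Variables (N : R -> {RV P >-> nat}) (X eps : nat -> {RV P >-> R}) (gamma t : R).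

Definition random_sum (w : T) : R :=
  \sum_(0 <= j < (N t w).+1) eps j w * gamma * expR (X j w).

Let measurable_random_sum : measurable_fun [set: T] random_sum.
Proof.
move=> _ B mB; rewrite setTI.
pose S n w := \sum_(0 <= j < n.+1) eps j w * gamma * expR (X j w).
rewrite (_ : _ @^-1` _ = \bigcup_n (N t @^-1` [set n] `&` S n @^-1` B)).
  apply: bigcup_measurable => n _; apply: measurableI.
    exact: measurable_funPTI.
  rewrite -[X in measurable X]setTI.
  suff : measurable_fun [set: T] (S n) by apply.
  rewrite /S; apply: measurable_sum => j.
  apply: measurable_funM; first exact: measurable_funM.
  exact: measurableT_comp.
apply/seteqP; split => [w Bw|w [n _ [/= <-]] //].
by exists (N t w).
Qed.

HB.instance Definition _ :=
  isMeasurableFun.Build _ _ _ _ random_sum measurable_random_sum.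

Definition random_sumRV : {RV P >-> R} := random_sum.

End random_sum.

Section analysis.
Context {R : realType}.
Notation mu := (@lebesgue_measure R).

Definition Gamma (s : R) : R :=
  \int[mu]_(x in `]0, +oo[) (x `^ (s - 1) * expR (- x)).

Definition cis (x : R) : R[i] := cos x +i* sin x.

Definition Cintegral {d} {T : measurableType d} (m : {measure set T -> \bar R})
    (D : set T) (f : T -> R[i]) : R[i] :=
  (\int[m]_(x in D) complex.Re (f x)) +i* (\int[m]_(x in D) complex.Im (f x)).

Definition Cderive1 (f : R -> R[i]) (x : R) : R[i] :=
  derive1 (@complex.Re R \o f) x +i* derive1 (@complex.Im R \o f) x.

Definition real_schwartz (f : R -> R) : Prop :=
  (forall n x, derivable (derive1n n f) x 1) /\
  (forall m n, exists C, forall x, `|x| ^+ m * `|derive1n n f x| <= C).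

Definition schwartz (f : R -> R[i]) : Prop :=
  real_schwartz (@complex.Re R \o f) /\ real_schwartz (@complex.Im R \o f).

Definition fourier (f : R -> R[i]) (xi : R) : R[i] :=
  Cintegral mu setT (fun x => cis (xi * x) * f x).

(** [d^alpha / dx^alpha] and [d^alpha / d(-x)^alpha]. *)
Definition weyl (alpha : R) (f : R -> R[i]) (x : R) : R[i] :=
  ((Gamma (1 - alpha))^-1)%:C *
  Cderive1 (fun z => Cintegral mu `]0, +oo[
                       (fun y => f (z - y) * (y `^ (- alpha))%:C)) x.

Definition weyl_neg (alpha : R) (f : R -> R[i]) (x : R) : R[i] :=
  (- (Gamma (1 - alpha))^-1)%:C *
  Cderive1 (fun z => Cintegral mu `]0, +oo[
                       (fun y => f (z + y) * (y `^ (- alpha))%:C)) x.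

Context {d} {T : measurableType d} (P : probability T R).

Definition char_fun (F : R -> {RV P >-> R}) (t xi : R) : R[i] :=
  Cintegral P setT (fun w => cis (xi * F t w)).

(** [Phi xi] is minus the derivative of [t |-> E exp(i xi F_t)] at [0], which
    is one-sided since [F] is indexed by [t >= 0]. *)
Definition fourier_symbol (F : R -> {RV P >-> R}) (Phi : R -> R[i]) : Prop :=
  forall xi,
  let q t := t^-1%:C * (char_fun F t xi - char_fun F 0 xi) in
  complex.Re (q t) @[t --> 0^'+] --> complex.Re (- Phi xi) /\
  complex.Im (q t) @[t --> 0^'+] --> complex.Im (- Phi xi).

Definition has_generator (F : R -> {RV P >-> R})
    (A : (R -> R[i]) -> R -> R[i]) : Prop :=
  levy_process F /\
  exists2 Phi, fourier_symbol F Phi &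
    forall f, schwartz f -> forall x,
      A f x = - ((2 * pi)^-1)%:C *
        Cintegral mu setT (fun xi => cis (- (xi * x)) * Phi xi * fourier f xi).

End analysis.

(* Main.v *)
Require Import Defs.
From HB Require Import structures.
From mathcomp Require Import all_boot all_order all_algebra.
From mathcomp Require Import complex.
From mathcomp Require Import all_classical all_reals all_analysis.
From mathcomp Require Import measurable_realfun.
From mathcomp Require Import ring lra.

Set Implicit Arguments.
Unset Strict Implicit.
Unset Printing Implicit Defensive.

Import Order.TTheory GRing.Theory Num.Theory.
Import numFieldNormedType.Exports.

Local Open Scope classical_set_scope.
Local Open Scope ring_scope.
Local Open Scope complex_scope.

(** The jumps of [A_gamma] are sorted by sign: [A_gamma = A_+ - A_-] with
    nonnegative compound sums [A_+] and [A_-]. Conditionally on [N], the [N + 1]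
    terms are independent and identically distributed, so that
    [E exp(- m A_+ - k A_-) = M exp(- lambda s (1 - M))] at time [s], where
    [M = p E exp(- m gamma e^X) + q E exp(- k gamma e^X)] ([random_sum_moment]).
    As [gamma e^X] has the tail [gamma^alpha z^(-alpha)] on [z > gamma],
    [1 - M] is equivalent to
    [gamma^alpha Gamma(1 - alpha) (p m^alpha + q k^alpha)] ([pareto_limit]);
    at time [t / gamma^alpha] the limit is the joint Laplace transform of the two
    subordinators. For integers [m] and [k] these are the moments of the pair
    [(exp(- A_+), exp(- A_-))] in the unit square, and moments determine weak
    limits there, by approximation with Bernstein polynomials
    ([moment_method]). A test function [h] of [A_+ - A_-] becomes
    [h (ln V - ln U)], singular only on the sides [U = 0] and [V = 0], which the
    limit does not charge ([random_sum_cvg]).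

    Increments of the limit process are differences of increments of two
    independent Levy processes run at constant speeds ([difference_levy]). For
    its symbol one needs [(1 - E exp(i xi H_s)) / s] as [s] tends to [0], while
    only Laplace transforms are given. The finite measures
    [s^-1 (1 - e^(-y)) P(H_s in dy)] live on the unit interval in the variable
    [e^(-y)], and their moments are differences of Laplace transforms: the same
    moment method shows that they converge to
    [alpha / Gamma(1 - alpha) (1 - e^(-y)) y^(-alpha-1) dy]
    ([subordinator_small_time]). Hence the symbol is
    [lambda alpha] times the integral of
    [1 - p e^(i xi y) - q e^(-i xi y)] against [y^(-alpha-1) dy] on [y > 0]
    ([difference_symbol]).

    It remains to multiply by the Fourier transform of a Schwartz function [f]
    and to invert. The transform decays fast, by integration by parts
    ([trig_decay]), so the integral over the jumps [y] can be taken last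
    ([multiplier_fubini]); for fixed [y] the factors [e^(i xi y)] and
    [e^(-i xi y)] translate [f], and Fourier inversion ([cosine_inversion]) gives
    [A f(x) = - lambda alpha int (f(x) - p f(x - y) - q f(x + y)) y^(-alpha-1) dy]
    ([multiplier_inversion]). On the other side, differentiation under the
    integral sign and an integration by parts give the Weyl derivatives the
    same form ([weylE], [weyl_negE]), and the factors [Gamma(1 - alpha)] cancel.

    Complex integrals are handled through their real and imaginary parts:
    cosines and sines replace exponentials, and the parity of the integrands
    in [xi] disposes of the mixed terms. *)

(** * Dominated integrals *)

Section toolbox.
Context {d} {T : measurableType d} {R : realType}.
Variable m : {measure set T -> \bar R}.

Lemma integrable_dominated (D : set T) (f g : T -> R) :
  measurable D -> measurable_fun D f -> m.-integrable D (EFin \o g) ->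
  (forall x, D x -> `|f x| <= g x) -> m.-integrable D (EFin \o f).
Proof.
move=> mD mf ig fg; apply: le_integrable ig => //.
  exact/measurable_EFinP.
move=> x Dx /=; rewrite lee_fin [leRHS]ger0_norm ?fg//.
exact: le_trans (normr_ge0 _) (fg _ Dx).
Qed.

Lemma cvg_Rintegral_dominated (D : set T) (f_ : nat -> T -> R) (f g : T -> R) :
  measurable D -> (forall n, measurable_fun D (f_ n)) ->
  measurable_fun D f ->
  (forall x, D x -> f_ n x @[n --> \oo] --> f x) ->
  m.-integrable D (EFin \o g) ->
  (forall n x, D x -> `|f_ n x| <= g x) ->
  \int[m]_(x in D) f_ n x @[n --> \oo] --> \int[m]_(x in D) f x.
Proof.
move=> mD mf_ mf cf ig fg.
have cf' x : D x -> (EFin \o f_ n) x @[n --> \oo] --> (EFin \o f) x.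
  by move=> Dx; apply/cvg_EFin; [exact: nearW|exact: cf].
have mf_' n : measurable_fun D (EFin \o f_ n) by exact/measurable_EFinP.
have mf' : measurable_fun D (EFin \o f) by exact/measurable_EFinP.
have [if_ _ cvgI] := @dominated_convergence _ _ _ m D mD (fun n => EFin \o f_ n)
  (EFin \o f) (EFin \o g) mf_' mf' (aeW _ cf') ig
  (aeW _ (fun x n Dx => fg n x Dx)).
apply: fine_cvg; rewrite fineK; last exact: integrable_fin_num.
exact: cvgI.
Qed.

End toolbox.

(** * Moments determine weak limits on the unit square *)

Section moment_method.
Context {R : realType}.
Implicit Types (L : (R * R -> R) -> R) (h : R * R -> R).

(** The mean of [phi j] when [j] is binomial of parameters [n] and [a],
    presented by the recursion on [n]: this is the [n]-th Bernstein polynomial,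
    and moments are computed from the recursion alone. *)
Fixpoint bernstein (n : nat) (a : R) (phi : nat -> R) : R :=
  if n is n'.+1 then
    a * bernstein n' a (phi \o S) + (1 - a) * bernstein n' a phi
  else phi 0%N.

Lemma bernsteinD n a (f g : nat -> R) :
  bernstein n a (fun j => f j + g j) = bernstein n a f + bernstein n a g.
Proof.
elim: n f g => //= n IH f g.
rewrite (_ : (fun j => f j + g j) \o S = fun j => (f \o S) j + (g \o S) j)//.
rewrite !IH; ring.
Qed.

Lemma bernsteinZ n a c (f : nat -> R) :
  bernstein n a (fun j => c * f j) = c * bernstein n a f.
Proof.
elim: n f => //= n IH f.
rewrite (_ : (fun j => c * f j) \o S = fun j => c * (f \o S) j)//.
rewrite !IH; ring.
Qed.

Lemma bernstein_cst n a c : bernstein n a (fun=> c) = c.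
Proof.
elim: n => //= n IH; rewrite (_ : (fun=> c) \o S = (fun=> c))// IH; ring.
Qed.

Lemma ler_bernstein n a (f g : nat -> R) : 0 <= a <= 1 ->
  (forall j, (j <= n)%N -> f j <= g j) -> bernstein n a f <= bernstein n a g.
Proof.
move=> /[dup] a01 /andP[a0 a1].
elim: n f g => [|n IH] f g fg /=; first exact: fg.
apply: lerD; apply: ler_wpM2l; rewrite ?subr_ge0//; apply: IH => j jn.
  exact: fg.
exact/fg/leqW.
Qed.

(** The variance and the squared bias of the binomial law. *)
Lemma bernstein_sqr n a c :
  bernstein n a (fun j => (j%:R - c) ^+ 2) =
  n%:R * (a * (1 - a)) + (n%:R * a - c) ^+ 2.
Proof.
elim: n c => [|n IH] c /=; first by ring.
rewrite (_ : _ \o S = fun j => (j%:R - (c - 1)) ^+ 2); last first.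
  by apply/funext => j /=; rewrite -natr1; congr (_ ^+ 2); ring.
rewrite !IH -natr1; ring.
Qed.

Definition bernstein2 n (f : R -> R -> R) (a b : R) :=
  bernstein n a (fun j => bernstein n b (fun k => f (j%:R / n%:R) (k%:R / n%:R))).

Definition unit_square : set (R * R) :=
  [set z | 0 <= z.1 <= 1 /\ 0 <= z.2 <= 1].

(** Chebyshev's inequality turned into a pointwise bound: a modulus of
    continuity is dominated by [e + K |z' - z|^2], whose binomial mean is
    explicit. *)
Lemma bernstein2_bound n (f : R -> R -> R) (a b e K : R) : (0 < n)%N ->
  0 <= a <= 1 -> 0 <= b <= 1 -> 0 <= K ->
  (forall a' b' : R, 0 <= a' <= 1 -> 0 <= b' <= 1 ->
    `|f a' b' - f a b| <= e + K * ((a' - a) ^+ 2 + (b' - b) ^+ 2)) ->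
  `|bernstein2 n f a b - f a b| <= e + K / n%:R.
Proof.
move=> n0 a01 b01 K0 H.
have nP : 0 < n%:R :> R by rewrite ltr0n.
have n_neq0 : n%:R != 0 :> R by rewrite gt_eqF.
have in01 j : (j <= n)%N -> 0 <= (j%:R / n%:R : R) <= 1.
  by move=> jn; rewrite divr_ge0//= ler_pdivrMr// mul1r ler_nat.
pose w j k : R := e + K * ((j%:R / n%:R - a) ^+ 2 + (k%:R / n%:R - b) ^+ 2).
have wE : bernstein n a (fun j => bernstein n b (w j)) =
    e + K / n%:R * (a * (1 - a) + b * (1 - b)).
  have -> : (fun j => bernstein n b (w j)) = (fun j =>
      (e + K * (b * (1 - b)) / n%:R) + K / n%:R ^+ 2 * (j%:R - n%:R * a) ^+ 2).
    apply/funext => j.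
    have -> : w j = (fun k => (e + K * (j%:R / n%:R - a) ^+ 2) +
        K / n%:R ^+ 2 * (k%:R - n%:R * b) ^+ 2).
      by apply/funext => k; rewrite /w; field.
    by rewrite bernsteinD bernstein_cst bernsteinZ bernstein_sqr; field.
  by rewrite bernsteinD bernstein_cst bernsteinZ bernstein_sqr; field.
have wle : bernstein n a (fun j => bernstein n b (w j)) <= e + K / n%:R.
  rewrite wE lerD2l ler_piMr//; first by rewrite divr_ge0.
  move: a01 b01 => /andP[? ?] /andP[? ?]; nra.
apply: le_trans wle.
rewrite ler_norml; apply/andP; split.
- have -> : - bernstein n a (fun j => bernstein n b (w j)) =
      bernstein n a (fun j => bernstein n b (fun k => - 1 * w j k)).
    under [X in _ = bernstein _ _ X]eq_fun do rewrite bernsteinZ.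
    by rewrite bernsteinZ mulN1r.
  rewrite lerBrDr -(bernstein_cst n a (f a b)) -bernsteinD.
  apply: ler_bernstein => // j jn.
  rewrite -(bernstein_cst n b (f a b)) -bernsteinD.
  apply: ler_bernstein => // k kn.
  have := H _ _ (in01 _ jn) (in01 _ kn); rewrite ler_norml => /andP[+ _].
  rewrite -/(w j k); lra.
- rewrite lerBlDr -(bernstein_cst n a (f a b)) -bernsteinD.
  apply: ler_bernstein => // j jn.
  rewrite -(bernstein_cst n b (f a b)) -bernsteinD.
  apply: ler_bernstein => // k kn.
  have := H _ _ (in01 _ jn) (in01 _ kn); rewrite ler_norml => /andP[_].
  rewrite -/(w j k); lra.
Qed.

Lemma compact_unit_square : compact unit_square.
Proof.
have -> : unit_square = `[0, 1]%classic `*` `[0, 1]%classic.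
  by apply/seteqP; split => -[x y] /=; rewrite /unit_square /= !in_itv.
by apply: compact_setX; exact: segment_compact.
Qed.

(** Heine's theorem; continuity is only asked relative to the square, where the
    functionals see the functions. *)
Lemma unit_square_unif_continuous h (e : R) : 0 < e ->
  (forall z, unit_square z -> h w @[w --> within unit_square (nbhs z)] --> h z) ->
  exists2 r : R, 0 < r & forall z w, unit_square z -> unit_square w ->
    `|w.1 - z.1| < r -> `|w.2 - z.2| < r -> `|h w - h z| < e.
Proof.
move=> e0 ch.
have e20 : 0 < e / 2 by rewrite divr_gt0.
have /compact_near_coveringP/near_covering_withinP := compact_unit_square.
pose Q (r : R) z := forall w, unit_square w ->
    `|w.1 - z.1| < r -> `|w.2 - z.2| < r -> `|h w - h z| < e.
move=> /(_ R (0^'+) Q _)[].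
- move=> z sz.
  have /cvgrPdist_lt/(_ _ e20) := ch z sz.
  rewrite near_withinE => /nbhs_ballP[r /= r0 rP].
  have r20 : 0 < r / 2 by rewrite divr_gt0.
  near=> z' r' => sz' w sw wz1 wz2.
  have [zz1 zz2] : ball z (r / 2) z' by near: z'; exact: nbhsx_ballx.
  have r'r : r' < r / 2 by near: r'; exact: nbhs_right_lt.
  have bz' : ball z r z'.
    by split; [apply: le_ball zz1|apply: le_ball zz2]; rewrite ler_pdivrMr//; lra.
  have bw : ball z r w.
    by split; rewrite (splitr r); [apply: (ball_triangle zz1)|apply: (ball_triangle zz2)];
      rewrite /ball/= distrC; apply: lt_trans r'r.
  have /= h1 := rP _ bz' sz'; have /= h2 := rP _ bw sw.
  rewrite (_ : h w - h z' = (h z - h z') - (h z - h w)); last by ring.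
  by rewrite (le_lt_trans (ler_normB _ _))// [ltRHS]splitr ltrD.
- move=> r0 /= r00 rP; exists (r0 / 2); first by rewrite divr_gt0.
  move=> z w sz sw; apply: rP => //=; last by rewrite divr_gt0.
  rewrite /ball_/= sub0r normrN gtr0_norm ?divr_gt0// ltr_pdivrMr//; lra.
Unshelve. all: by end_near. Qed.

(** The class of functions on which a functional is evaluated: only their values
    on the square matter. *)
Definition square_bounded h :=
  measurable_fun [set: R * R] h /\
  exists C, forall z, unit_square z -> `|h z| <= C.

Record positive_functional L : Prop := PositiveFunctional {
  pfunD : forall h g, square_bounded h -> square_bounded g ->
    L (fun z => h z + g z) = L h + L g ;
  pfunZ : forall c h, square_bounded h -> L (fun z => c * h z) = c * L h ;
  pfun_le : forall h g, square_bounded h -> square_bounded g ->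
    (forall z, unit_square z -> h z <= g z) -> L h <= L g }.

Definition monomial (i j : nat) (z : R * R) : R := z.1 ^+ i * z.2 ^+ j.

Lemma square_bounded_cst c : square_bounded (fun=> c).
Proof. by split; [exact: measurable_cst|exists `|c|]. Qed.

Lemma square_boundedD h g : square_bounded h -> square_bounded g ->
  square_bounded (fun z => h z + g z).
Proof.
move=> [mh [C hC]] [mg [C' gC]]; split; first exact: measurable_funD.
exists (C + C') => z sz; apply: le_trans (ler_normD _ _) _.
by rewrite lerD ?hC ?gC.
Qed.

Lemma square_boundedM h g : square_bounded h -> square_bounded g ->
  square_bounded (fun z => h z * g z).
Proof.
move=> [mh [C hC]] [mg [C' gC]]; split; first exact: measurable_funM.
by exists (C * C') => z sz; rewrite normrM ler_pM ?hC ?gC.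
Qed.

Lemma square_boundedX h n : square_bounded h ->
  square_bounded (fun z => h z ^+ n).
Proof.
move=> bh; elim: n => [|n IH].
  by under eq_fun do rewrite expr0; exact: square_bounded_cst.
by under eq_fun do rewrite exprS; exact: square_boundedM.
Qed.

Lemma square_bounded_fst : square_bounded fst.
Proof.
by split; [exact: measurable_fst|exists 1 => z [/andP[z0 z1] _]; rewrite ger0_norm].
Qed.

Lemma square_bounded_snd : square_bounded snd.
Proof.
by split; [exact: measurable_snd|exists 1 => z [_ /andP[z0 z1]]; rewrite ger0_norm].
Qed.

Lemma square_bounded_monomial i j : square_bounded (monomial i j).
Proof.
by apply: square_boundedM; apply: square_boundedX;
  [exact: square_bounded_fst|exact: square_bounded_snd].
Qed.

Lemma square_boundedB h g : square_bounded h -> square_bounded g ->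
  square_bounded (fun z => h z - g z).
Proof.
move=> bh bg; under eq_fun do rewrite -mulN1r.
by apply: square_boundedD => //; apply: square_boundedM => //; exact: square_bounded_cst.
Qed.

(** Positivity alone makes the functionals continuous for uniform bounds. *)
Lemma pfun_norm L h g u : positive_functional L -> square_bounded h ->
  square_bounded g -> square_bounded u ->
  (forall z, unit_square z -> `|h z - g z| <= u z) -> `|L h - L g| <= L u.
Proof.
move=> pL bh bg bu hgu; rewrite ler_norml; apply/andP; split.
- suff : L g <= L h + L u by lra.
  rewrite -(pfunD pL)//; apply: pfun_le => //; first exact: square_boundedD.
  by move=> z sz; have := hgu _ sz; rewrite ler_norml => /andP[+ _]; lra.
- suff : L h <= L g + L u by lra.
  rewrite -(pfunD pL)//; apply: pfun_le => //; first exact: square_boundedD.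
  by move=> z sz; have := hgu _ sz; rewrite ler_norml => /andP[_]; lra.
Qed.

Section convergence.
Variables (L_ : nat -> (R * R -> R) -> R) (L : (R * R -> R) -> R).
Hypothesis pL_ : forall n, positive_functional (L_ n).
Hypothesis pL : positive_functional L.
Hypothesis moments : forall i j,
  L_ n (monomial i j) @[n --> \oo] --> L (monomial i j).

Let good h := square_bounded h /\ (L_ n h @[n --> \oo] --> L h).

Let goodD h g : good h -> good g -> good (fun z => h z + g z).
Proof.
move=> [bh ch] [bg cg]; split; first exact: square_boundedD.
under eq_fun do rewrite (pfunD (pL_ _))//.
by rewrite (pfunD pL)//; exact: cvgD.
Qed.

Let goodZ c h : good h -> good (fun z => c * h z).
Proof.
move=> [bh ch]; split.
  by apply: square_boundedM => //; exact: square_bounded_cst.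
under eq_fun do rewrite (pfunZ (pL_ _))//.
by rewrite (pfunZ pL)//; apply: cvgM => //; exact: cvg_cst.
Qed.

Let good_monomial i j : good (monomial i j).
Proof. by split; [exact: square_bounded_monomial|exact: moments]. Qed.

Let good_bernstein1 n phi i j :
  good (fun z => monomial i j z * bernstein n z.2 phi).
Proof.
elim: n phi j => [|n IH] phi j /=.
  under eq_fun do rewrite mulrC; exact: goodZ.
rewrite (_ : (fun z => _) = (fun z =>
  monomial i j.+1 z * bernstein n z.2 (phi \o S) +
  (monomial i j z * bernstein n z.2 phi +
   -1 * (monomial i j.+1 z * bernstein n z.2 phi)))).
  by apply: goodD => //; apply: goodD => //; exact: goodZ.
by apply/funext => z; rewrite /monomial exprS; ring.
Qed.

Let good_bernstein2 n m (phi : nat -> nat -> R) i j :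
  good (fun z => monomial i j z *
                 bernstein n z.1 (fun k => bernstein m z.2 (phi k))).
Proof.
elim: n phi i => [|n IH] phi i /=; first exact: good_bernstein1.
rewrite (_ : (fun z => _) = (fun z =>
  monomial i.+1 j z *
    bernstein n z.1 (fun k => bernstein m z.2 ((phi \o S) k)) +
  (monomial i j z * bernstein n z.1 (fun k => bernstein m z.2 (phi k)) +
   -1 * (monomial i.+1 j z *
    bernstein n z.1 (fun k => bernstein m z.2 (phi k)))))).
  by apply: goodD; [exact: IH|apply: goodD; [exact: IH|apply: goodZ; exact: IH]].
by apply/funext => z; rewrite /monomial exprS /comp; ring.
Qed.

Let good_bernstein n (f : R -> R -> R) :
  good (fun z => bernstein2 n f z.1 z.2).
Proof.
have := good_bernstein2 n n (fun k l => f (k%:R / n%:R) (l%:R / n%:R)) 0 0.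
by under eq_fun do rewrite /monomial !expr0 !mul1r.
Qed.

Let good_cst c : good (fun=> c).
Proof.
have := goodZ c (good_monomial 0 0).
by under eq_fun do rewrite /monomial !expr0 !mulr1.
Qed.

(** The total masses [L_ n 1] converge, so the approximation error is uniform
    in [n]. *)
Let good_uniform_limit h : square_bounded h ->
  (forall e, 0 < e -> exists2 g, good g &
     forall z, unit_square z -> `|h z - g z| <= e) ->
  L_ n h @[n --> \oo] --> L h.
Proof.
move=> bh H; apply/cvgrPdist_le => e e0.
have [_ c1] := good_cst 1.
set M := L (fun=> 1); have M0 : 0 <= M.
  rewrite -[leLHS](mul0r M) -(pfunZ pL); last exact: square_bounded_cst.
  by apply: (pfun_le pL) => [||z _]; [exact: square_bounded_cst..|rewrite mul0r].
have Mpos : 0 < 2 * M + 2 by lra.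
pose r := e / (2 * M + 2).
have r0 : 0 < r by rewrite divr_gt0.
have [g [bg cg] hg] := H _ r0.
have hgL (K : (R * R -> R) -> R) : positive_functional K ->
    `|K h - K g| <= r * K (fun=> 1).
  move=> pK; rewrite -(pfunZ pK); last exact: square_bounded_cst.
  apply: (pfun_norm pK) => // [|z sz]; last by rewrite mulr1 hg.
  by apply: square_boundedM; exact: square_bounded_cst.
near=> n.
have d1 := hgL _ pL; have d2 := hgL _ (pL_ n).
have d3 : `|L g - L_ n g| <= r / 2.
  near: n; apply: (cvgrPdist_le _ _).1; first exact: cg.
  by rewrite divr_gt0.
have d4 : `|M - L_ n (fun=> 1)| <= 1.
  by near: n; apply: (cvgrPdist_le _ _).1.
have -> : L h - L_ n h = (L h - L g) + (L g - L_ n g) - (L_ n h - L_ n g) by ring.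
apply: le_trans (ler_normB _ _) _; apply: le_trans (lerD (ler_normD _ _) (lexx _)) _.
have : L_ n (fun=> 1) <= M + 1 by move: d4; rewrite ler_norml => /andP[? _]; lra.
move=> /(ler_wpM2l (ltW r0)).
have : r * (2 * M + 2) = e by rewrite /r divfK// gt_eqF.
rewrite -/M in d1; nra.
Unshelve. all: by end_near. Qed.

Let cvg_continuous h : square_bounded h ->
  (forall z, unit_square z -> h w @[w --> within unit_square (nbhs z)] --> h z) ->
  L_ n h @[n --> \oo] --> L h.
Proof.
move=> bh ch; apply: good_uniform_limit => // e e0.
have [_ [C hC]] := bh.
have C0 : 0 <= C.
  by apply: le_trans (hC (0, 0) _) => //; split; rewrite lexx ler01.
have e20 : 0 < e / 2 by rewrite divr_gt0.
have [r r0 rP] := unit_square_unif_continuous e20 ch.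
pose K := 2 * C / r ^+ 2.
have K0 : 0 <= K by rewrite divr_ge0 ?mulr_ge0 ?exprn_ge0 ?(ltW r0).
pose n := (Num.truncn (K / (e / 2))).+1.
exists (fun z => bernstein2 n (fun a b => h (a, b)) z.1 z.2) => //.
move=> [a b] [/= a01 b01]; rewrite distrC.
apply: (@le_trans _ _ (e / 2 + K / n%:R)).
  apply: bernstein2_bound => // a' b' a01' b01'.
  have [h1|h1] := ltP `|a' - a| r; last first.
    apply: (@le_trans _ _ (K * r ^+ 2)).
      rewrite divfK ?gt_eqF ?exprn_gt0//.
      by rewrite (le_trans (ler_normB _ _))// mulr_natl mulr2n lerD// hC.
    have : r ^+ 2 <= (a' - a) ^+ 2.
      by rewrite -[leRHS]real_normK ?num_real// ler_sqr ?nnegrE// ltW.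
    move=> /(ler_wpM2l K0); have := mulr_ge0 K0 (sqr_ge0 (b' - b)); lra.
  have [h2|h2] := ltP `|b' - b| r; last first.
    apply: (@le_trans _ _ (K * r ^+ 2)).
      rewrite divfK ?gt_eqF ?exprn_gt0//.
      by rewrite (le_trans (ler_normB _ _))// mulr_natl mulr2n lerD// hC.
    have : r ^+ 2 <= (b' - b) ^+ 2.
      by rewrite -[leRHS]real_normK ?num_real// ler_sqr ?nnegrE// ltW.
    move=> /(ler_wpM2l K0); have := mulr_ge0 K0 (sqr_ge0 (a' - a)); lra.
  have /ltW : `|h (a', b') - h (a, b)| < e / 2 by exact: rP.
  have := mulr_ge0 K0 (addr_ge0 (sqr_ge0 (a' - a)) (sqr_ge0 (b' - b))); lra.
rewrite [leRHS]splitr lerD2l ler_pdivrMr ?ltr0n// mulrC -ler_pdivrMr//.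
by rewrite ltW// truncnS_gt.
Qed.

(** Weak convergence from convergence of moments. The test function may jump
    on the sides [z.1 = 0] and [z.2 = 0] because the limit does not charge
    them; the polynomial cutoff [1 - (1 - z.1 * z.2) ^+ M] vanishes there and
    tends to [1] elsewhere, so the mass that it removes is itself a combination
    of moments. *)
Theorem moment_method h :
  L (fun z => (1 - z.1 * z.2) ^+ M) @[M --> \oo] --> 0 ->
  square_bounded h ->
  (forall z, unit_square z -> 0 < z.1 -> 0 < z.2 ->
    h w @[w --> within unit_square (nbhs z)] --> h z) ->
  L_ n h @[n --> \oo] --> L h.
Proof.
move=> L0 bh ch; have [_ [C hC]] := bh.
have C0 : 0 <= C.
  by apply: le_trans (hC (0, 0) _) => //; split; rewrite lexx ler01.
pose chi M (z : R * R) := (1 - z.1 * z.2) ^+ M.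
have bz : square_bounded (fun z => 1 - z.1 * z.2).
  apply: square_boundedB; first exact: square_bounded_cst.
  by apply: square_boundedM; [exact: square_bounded_fst|exact: square_bounded_snd].
have bchi M : square_bounded (chi M) by exact: square_boundedX.
have chi01 M z : unit_square z -> 0 <= chi M z <= 1.
  move=> [/andP[z10 z11] /andP[z20 z21]].
  have ? : 0 <= 1 - z.1 * z.2 by nra.
  by rewrite exprn_ge0//= exprn_ile1//; nra.
have bg M : square_bounded (fun z => h z * (1 - chi M z)).
  apply: square_boundedM => //; apply: square_boundedB => //.
  exact: square_bounded_cst.
have chi_cont M z : chi M w @[w --> within unit_square (nbhs z)] --> chi M z.
  apply: cvg_within_filter.
  apply: (@cvg_comp _ _ _ (fun w : R * R => 1 - w.1 * w.2)
    (fun x : R => x ^+ M) _ (nbhs (1 - z.1 * z.2))); last exact: exprn_continuous.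
  apply: cvgB; first exact: cvg_cst.
  by apply: cvgM; [exact: cvg_fst|exact: cvg_snd].
have cg M z : unit_square z ->
    h w * (1 - chi M w) @[w --> within unit_square (nbhs z)] -->
    h z * (1 - chi M z).
  move=> sz; have [/andP[z10 z11] /andP[z20 z21]] := sz.
  have [/andP[z1 z2]|z0] := boolP ((0 < z.1) && (0 < z.2)).
    by apply: cvgM; [exact: ch|apply: cvgB; [exact: cvg_cst|exact: chi_cont]].
  have chi1 : chi M z = 1.
    move: z0; rewrite negb_and -!leNgt => /orP[] z0.
    - have -> : chi M z = (1 - 0 * z.2) ^+ M.
        by rewrite /chi (_ : z.1 = 0)//; apply/eqP; rewrite eq_le z0.
      by rewrite mul0r subr0 expr1n.
    - have -> : chi M z = (1 - z.1 * 0) ^+ M.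
        by rewrite /chi (_ : z.2 = 0)//; apply/eqP; rewrite eq_le z0.
      by rewrite mulr0 subr0 expr1n.
  rewrite chi1 subrr mulr0; apply/norm_cvg0P.
  apply: (@squeeze_cvgr _ _ _ _ (fun=> 0) (fun w => C * (1 - chi M w))).
  - rewrite near_withinE; near=> w => sw.
    have /andP[c0 c1] := chi01 M _ sw.
    by rewrite normr_ge0/= normrM (ger0_norm (_ : 0 <= 1 - chi M w)) ?ler_wpM2r ?hC//; lra.
  - exact: cvg_cst.
  - rewrite (_ : 0 = C * (1 - chi M z)); last by rewrite chi1 subrr mulr0.
    apply: cvgM; first exact: cvg_cst.
    by apply: cvgB; [exact: cvg_cst|exact: chi_cont].
have cL_ M : L_ n (chi M) @[n --> \oo] --> L (chi M).
  by apply: cvg_continuous => // z _; exact: chi_cont.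
have cut (K : (R * R -> R) -> R) M : positive_functional K ->
    `|K h - K (fun z => h z * (1 - chi M z))| <= C * K (chi M).
  move=> pK; rewrite -(pfunZ pK)//; apply: (pfun_norm pK) => //.
    by apply: square_boundedM => //; exact: square_bounded_cst.
  move=> z sz; have /andP[c0 c1] := chi01 M _ sz.
  have -> : h z - h z * (1 - chi M z) = h z * chi M z by ring.
  by rewrite normrM (ger0_norm c0) ler_wpM2r// hC.
apply/cvgrPdist_le => e e0.
have r0 : 0 < e / (3 * (C + 1)) by rewrite divr_gt0// mulr_gt0//; lra.
have [M _ /(_ M (leqnn _)) HM] := (cvgrPdist_lt _ _).1 L0 _ r0.
have {HM} : L (chi M) * (3 * (C + 1)) < e.
  rewrite -ltr_pdivlMr; last by rewrite mulr_gt0//; lra.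
  by apply: le_lt_trans HM; rewrite sub0r normrN ler_norm.
set l := L (chi M) => HM.
have s0 : 0 < e / 3 - C * l.
  have : 0 <= l.
    have b0 := square_bounded_cst 0.
    apply: le_trans (pfun_norm pL b0 b0 (bchi M) _) => // z sz.
    by rewrite subrr normr0; case/andP: (chi01 M _ sz).
  by move=> l0; nra.
near=> n.
have d1 := cut _ M pL; have d2 := cut _ M (pL_ n).
have d3 : `|L (fun z => h z * (1 - chi M z)) - L_ n (fun z => h z * (1 - chi M z))|
    <= e / 3.
  near: n; apply: (cvgrPdist_le _ _).1; last by rewrite divr_gt0.
  by apply: cvg_continuous => //; exact: cg.
have d4 : `|C * l - C * L_ n (chi M)| <= e / 3 - C * l.
  near: n; apply: (cvgrPdist_le _ _).1 => //.
  by apply: cvgM; [exact: cvg_cst|exact: cL_].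
rewrite -/l in d1.
move: d1 d2 d3 d4; rewrite !ler_norml.
by move=> /andP[? ?] /andP[? ?] /andP[? ?] /andP[? ?]; lra.
Unshelve. all: by end_near. Qed.

End convergence.

End moment_method.

(** * Independence *)

Section layer_cake.
Context {d} {T : measurableType d} {R : realType} (P : probability T R).
Notation mu := (@lebesgue_measure R).

(** Tonelli's theorem on the region [0 <= z < Y w]. *)
Lemma layer_cake (Y W : T -> R) (g : R -> R) :
  measurable_fun [set: T] Y -> measurable_fun [set: T] W ->
  measurable_fun [set: R] g ->
  (forall w, 0 <= W w) -> (forall z, 0 <= g z) ->
  (\int[P]_w ((W w)%:E * \int[mu]_(z in `[0%R, (Y w)[) (g z)%:E) =
   \int[mu]_(z in `[0%R, +oo[)
     ((g z)%:E * \int[P]_(w in [set w | (z < Y w)%R]) (W w)%:E))%E.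
Proof.
move=> mY mW mg W0 g0.
pose A : set (T * measurableTypeR R) := [set x | 0 <= x.2 /\ x.2 < Y x.1].
have mA : measurable A.
  have -> : A = (fun x => 0 <= x.2) @^-1` [set true] `&`
                (fun x => x.2 < Y x.1) @^-1` [set true].
    by apply/seteqP; split.
  rewrite -[X in measurable X]setTI setIA; apply: measurableI.
    have : measurable_fun setT (fun x : T * measurableTypeR R => 0 <= x.2).
      by apply: measurable_fun_ler => //; exact: measurable_snd.
    exact.
  rewrite -[X in measurable X]setTI.
  have : measurable_fun setT (fun x : T * measurableTypeR R => x.2 < Y x.1).
    apply: measurable_fun_ltr; first exact: measurable_snd.
    exact: (measurableT_comp mY measurable_fst).
  exact.
pose F (x : T * measurableTypeR R) := (W x.1 * g x.2 * \1_A x)%:E.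
have mF : measurable_fun setT F.
  apply/measurable_EFinP; apply: measurable_funM; last exact: measurable_indic.
  apply: measurable_funM; first exact: (measurableT_comp mW measurable_fst).
  exact: (measurableT_comp mg measurable_snd).
have F0 x : (0 <= F x)%E by rewrite lee_fin !mulr_ge0.
transitivity (\int[P]_w \int[mu]_z F (w, z))%E.
  apply: eq_integral => w _; rewrite -ge0_integralZl//=; last 3 first.
  - exact/measurable_EFinP/measurable_funTS.
  - by move=> z _; rewrite lee_fin.
  - by rewrite lee_fin.
  rewrite [LHS]integral_mkcond; apply: eq_integral => z _.
  rewrite /F /= indicE patchE; case: ifPn.
    by rewrite inE /= in_itv/= => zI; rewrite mem_set ?mulr1//; apply/andP.
  rewrite notin_setE/= in_itv/= => zI; rewrite memNset ?mulr0//.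
  by move=> [? ?]; apply: zI; apply/andP.
rewrite (fubini_tonelli F)// [RHS]integral_mkcond.
apply: eq_integral => z _; rewrite patchE; case: ifPn.
  rewrite inE /= in_itv/= andbT => z0.
  have mYz : measurable [set w | z < Y w].
    rewrite -[X in measurable X]setTI.
    have : measurable_fun setT (fun w => z < Y w) by exact: measurable_fun_ltr.
    by move=> /(_ measurableT [set true]); exact.
  rewrite -ge0_integralZl//=; last 3 first.
  - exact/measurable_EFinP/measurable_funTS.
  - by move=> w _; rewrite lee_fin.
  - by rewrite lee_fin.
  rewrite [RHS]integral_mkcond; apply: eq_integral => w _.
  rewrite /F /= indicE patchE; case: ifPn.
    by rewrite inE /= => zY; rewrite mem_set ?mulr1// mulrC.
  by rewrite notin_setE/= => zY; rewrite memNset ?mulr0// => -[].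
rewrite notin_setE/= in_itv/= andbT => z0.
apply: integral0_eq => w _; rewrite /F indicE memNset ?mulr0// => -[].
by move=> /z0.
Qed.

(** Layer cake: a function of [Y] integrates against the weight [W] through the
    integrals of [W] over the events [z < Y] alone. *)
Lemma integral_weight_prod (Y W : T -> R) (c : R) :
  measurable_fun [set: T] Y -> measurable_fun [set: T] W ->
  (forall w, 0 <= Y w) -> (forall w, 0 <= W w) -> 0 <= c ->
  (forall B, measurable B ->
    (\int[P]_(w in Y @^-1` B) (W w)%:E = c%:E * P (Y @^-1` B))%E) ->
  (\int[P]_w (Y w * W w)%:E = c%:E * \int[P]_w (Y w)%:E)%E.
Proof.
move=> mY mW Y0 W0 c0 H.
have itv_len w : (\int[mu]_(z in `[0%R, (Y w)[) (cst 1%:E z) = (Y w)%:E)%E.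
  rewrite integral_cst//= mul1e lebesgue_measure_itv/= lte_fin.
  case: ifPn => [_|]; first by rewrite oppr0 adde0.
  by rewrite -leNgt => Yw; congr EFin; apply/eqP; rewrite eq_le Yw Y0.
have cake (V : T -> R) : measurable_fun [set: T] V -> (forall w, 0 <= V w) ->
    (\int[P]_w (Y w * V w)%:E =
     \int[mu]_(z in `[0%R, +oo[) \int[P]_(w in Y @^-1` `]z, +oo[) (V w)%:E)%E.
  move=> mV V0; have := layer_cake mY mV (measurable_cst (1 : R)) V0 (fun=> ler01).
  under eq_integral do rewrite itv_len -EFinM mulrC.
  move=> ->; apply: eq_integral => z _; rewrite mul1e; congr integral.
  by apply/seteqP; split => w /=; rewrite in_itv/= andbT.
rewrite -ge0_integralZl//=; last 2 first.
- exact/measurable_EFinP.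
- by move=> w _; rewrite lee_fin.
under [RHS]eq_integral do rewrite -EFinM mulrC.
rewrite cake// (cake (cst c))//; apply: eq_integral => z _.
rewrite H// -[RHS]/(\int[P]_(w in _) cst c%:E w)%E integral_cst//.
by rewrite -[X in measurable X]setTI; exact: mY.
Qed.

End layer_cake.

Lemma integral_mul_indic {d} {T : measurableType d} {R : realType}
    (m : {measure set T -> \bar R}) (E D : set T) (f : T -> R) :
  (\int[m]_(w in E) (f w * \1_D w)%:E = \int[m]_(w in E `&` D) (f w)%:E)%E.
Proof.
rewrite [RHS]integral_mkcondr; apply: eq_integral => w _.
rewrite patchE indicE; case: (w \in D); by rewrite ?mulr1 ?mulr0.
Qed.

Section mutual_independence.
Context {d} {T : measurableType d} {R : realType} (P : probability T R).

Let sub_measurable (G : set_system T) : G `<=` measurable ->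
  <<s G >> `<=` measurable.
Proof. by move=> GM; exact: smallest_sub (@sigma_algebra_measurable _ T) GM. Qed.

(** Dynkin's argument, one sigma-algebra at a time: for fixed events in the
    other systems, both sides are finite measures of the remaining event. *)
Lemma mutually_independent_sigma (I : choiceType) (G : I -> set_system T) :
  (forall i, G i `<=` measurable) -> (forall i, setI_closed (G i)) ->
  (forall i, G i setT) -> mutually_independent P G ->
  mutually_independent P (fun i => <<s G i >>).
Proof.
move=> GM GI GT indG.
suff ext : forall (K L : seq I) (B : I -> set T), uniq (K ++ L) ->
    (forall i, i \in K -> <<s G i >> (B i)) -> (forall i, i \in L -> G i (B i)) ->
    P (\big[setI/setT]_(i <- K ++ L) B i) = (\prod_(i <- K ++ L) P (B i))%E.
  move=> J B uJ GB; rewrite bigcap_seq -[J]cats0; apply: ext => //.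
  by rewrite cats0.
elim=> [|k K IH] L B.
  by move=> /= uL _ GB; rewrite -bigcap_seq; exact: indG.
move=> uKL GBK GBL; have /= /andP[kKL uKL'] := uKL.
set rest := \big[setI/setT]_(i <- K ++ L) B i.
have mB i : i \in k :: K ++ L -> measurable (B i).
  rewrite -cat_cons mem_cat => /orP[iK|iL]; last exact/GM/GBL.
  by apply: sub_measurable (GBK _ iK); exact: GM.
have mrest : measurable rest.
  rewrite /rest -bigcap_seq; apply: fin_bigcap_measurable => // i /= iKL.
  by apply: mB; rewrite in_cons iKL orbT.
have Prest : P rest = (\prod_(i <- K ++ L) P (B i))%E.
  by apply: IH => // i iK; apply: GBK; rewrite in_cons iK orbT.
have frest : P rest \is a fin_num by exact: fin_num_measure.
rewrite !big_cons -/rest -Prest.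
have r0 : 0 <= fine (P rest) by rewrite fine_ge0.
pose m1 : {measure set T -> \bar R} := mrestr P mrest.
pose m2 : {measure set T -> \bar R} := mscale (NngNum r0) P.
suff : forall S, <<s G k >> S -> m1 S = m2 S.
  move=> /(_ (B k)); rewrite /m1 /m2 /= /mscale/= /mrestr fineK// [RHS]muleC.
  by apply; apply: GBK; rewrite mem_head.
apply: (@g_sigma_algebra_measure_unique _ R T (G k) (GM k) (fun=> setT) (fun=> GT k) _ m1 m2 (GI k)).
- by rewrite bigcup_const.
- move=> S GS; rewrite /m1 /m2 /= /mscale/= /mrestr fineK//.
  pose B' i := if i == k then S else B i.
  have B'E i : i \in K ++ L -> B' i = B i.
    by move=> iKL; rewrite /B'; case: eqVneq => // ik; move: kKL; rewrite -ik iKL.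
  have pKL : perm_eq (K ++ k :: L) (k :: K ++ L) by rewrite -cat1s -[k :: K ++ L]cat1s perm_catCA.
  have := IH (k :: L) B'.
  rewrite (perm_uniq pKL) => /(_ uKL).
  rewrite !(perm_big _ pKL) !big_cons.
  have B'k : B' k = S by rewrite /B' eqxx.
  rewrite !B'k.
  rewrite (eq_big_seq _ B'E) -/rest.
  have -> : (\prod_(i <- K ++ L) P (B' i))%E = P rest.
    by rewrite Prest; apply: eq_big_seq => i iKL; rewrite B'E.
  rewrite muleC => -> //.
  + move=> i iK; rewrite B'E ?mem_cat ?iK//.
    by apply: GBK; rewrite in_cons iK orbT.
  + move=> i; rewrite in_cons => /orP[/eqP->|iL]; first by rewrite B'k.
    by rewrite B'E ?mem_cat ?iL ?orbT//; exact: GBL.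
- by move=> _; rewrite -ge0_fin_numE// fin_num_measure.
Qed.

Lemma mutually_independent_sub (I : choiceType) (G H : I -> set_system T) :
  (forall i, H i `<=` G i) -> mutually_independent P G ->
  mutually_independent P H.
Proof. by move=> HG iG J B uJ HB; apply: iG => // i iJ; exact/HG/HB. Qed.

(** Independence is only known on events: the layer-cake formula above extends
    it to one factor of the product at a time. *)
Lemma integral_prod_independent (I : choiceType) (Y : I -> T -> R) (J : seq I) :
  (forall i, measurable_fun setT (Y i)) -> (forall i w, 0 <= Y i w <= 1) ->
  mutually_independent P (fun i => g_sigma_algebra_preimage (Y i)) ->
  uniq J ->
  \int[P]_w (\prod_(i <- J) Y i w) = \prod_(i <- J) \int[P]_w Y i w.
Proof.
move=> mY Y01 indY uJ.
have mW (K : seq I) : measurable_fun setT (fun w => \prod_(i <- K) Y i w).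
  exact: measurable_prod.
have W01 (K : seq I) w : 0 <= \prod_(i <- K) Y i w <= 1.
  rewrite prodr_ge0//= => [|i _]; last by case/andP: (Y01 i w).
  by apply: Num.Theory.prodr_ile1 => i _.
have iW (K : seq I) (D : set T) : measurable D ->
    P.-integrable D (fun w => (\prod_(i <- K) Y i w)%:E).
  move=> mD; apply: (integrable_dominated (g := fun=> 1)) => //.
  - exact: measurable_funTS.
  - exact: finite_measure_integrable_cst.
  - by move=> w _; rewrite ger0_norm; case/andP: (W01 K w).
suff key : forall (K L : seq I) (B : I -> set T), uniq (K ++ L) ->
    (forall i, g_sigma_algebra_preimage (Y i) (B i)) ->
    (\int[P]_(w in \big[setI/setT]_(i <- L) B i) (\prod_(i <- K) Y i w)%:E =
     (\prod_(i <- K) \int[P]_w Y i w)%:E * \prod_(i <- L) P (B i))%E.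
  have := key J [::] (fun=> setT); rewrite cats0 !big_nil mule1.
  move=> /(_ uJ)/= key'; rewrite /Rintegral key'//.
  by move=> i; exists setT => //; rewrite setTI.
have mYpre i B : measurable B -> measurable (Y i @^-1` B).
  by move=> mB; rewrite -[X in measurable X]setTI; exact: mY.
elim=> [|k K IH] L B0 uKL GB.
  under eq_integral do rewrite big_nil.
  have mL : measurable (\big[setI/setT]_(i <- L) B0 i).
    apply: bigsetI_measurable => i _; have [C mC <-] := GB i.
    by rewrite setTI; exact: mYpre.
  rewrite integral_cst// big_nil !mul1e -bigcap_seq.
  by apply: indY => // i _; exact: GB.
have mL : measurable (\big[setI/setT]_(i <- L) B0 i).
  apply: bigsetI_measurable => i _; have [C mC <-] := GB i.
  by rewrite setTI; exact: mYpre.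
set D := \big[setI/setT]_(i <- L) B0 i in mL *.
have /= /andP[kKL uKL'] := uKL.
have c0 : 0 <= (\prod_(i <- K) \int[P]_w Y i w) * fine (\prod_(i <- L) P (B0 i))%E.
  rewrite mulr_ge0//; last by rewrite fine_ge0// prode_ge0.
  by apply: prodr_ge0 => i _; apply: Rintegral_ge0 => w _; case/andP: (Y01 i w).
have fL : (\prod_(i <- L) P (B0 i))%E \is a fin_num.
  apply: prode_fin_num => i _; apply: fin_num_measure.
  by have [C mC <-] := GB i; rewrite setTI; exact: mYpre.
have mW' : measurable_fun setT (fun w => (\prod_(i <- K) Y i w) * \1_D w).
  by apply: measurable_funM => //; exact: measurable_indic.
have W'0 w : 0 <= (\prod_(i <- K) Y i w) * \1_D w.
  by rewrite mulr_ge0//; case/andP: (W01 K w).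
have Yk0 w : 0 <= Y k w by case/andP: (Y01 k w).
have /= := integral_weight_prod (P := P) (mY k) mW' Yk0 W'0 c0.
have -> : (\int[P]_w (Y k w * (\prod_(i <- K) Y i w * \1_D w))%:E =
    \int[P]_(w in D) (\prod_(i <- k :: K) Y i w)%:E)%E.
  rewrite -[D in RHS]setTI -integral_mul_indic; apply: eq_integral => w _.
  by rewrite big_cons mulrA.
move=> ->.
- rewrite EFinM fineK// big_cons EFinM /Rintegral fineK; last first.
    by apply: integrable_fin_num => //; have := iW [:: k] _ measurableT;
      under eq_fun do rewrite big_seq1.
  by rewrite muleC muleA.
- move=> B mB; rewrite integral_mul_indic.
  pose B' i := if i == k then Y k @^-1` B else B0 i.
  have B'k : B' k = Y k @^-1` B by rewrite /B' eqxx.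
  have B'E i : i \in L -> B' i = B0 i.
    move=> iL; rewrite /B'; case: eqVneq => // ik.
    by move: kKL; rewrite -ik mem_cat iL orbT.
  have := IH (k :: L) B'; rewrite !big_cons B'k !(eq_big_seq _ B'E) -/D.
  have -> : (\prod_(i <- L) P (B' i) = \prod_(i <- L) P (B0 i))%E.
    by apply: eq_big_seq => i iL; rewrite B'E.
  move=> ->; first by rewrite EFinM fineK// -muleA; congr (_ * _)%E; rewrite muleC.
  + have pKL : perm_eq (K ++ k :: L) (k :: K ++ L).
      by rewrite -cat1s -[k :: K ++ L]cat1s perm_catCA.
    by rewrite (perm_uniq pKL).
  + move=> i; rewrite /B'; case: eqVneq => [->|_]; last exact: GB.
    by exists B => //; rewrite setTI.
Qed.

End mutual_independence.

Section pairs.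
Context {d} {T : measurableType d} {R : realType}.

(** A pi-system that generates the events of the pair, on which independence and
    equality of laws can be checked. *)
Definition pair_events (Y Z : T -> R) : set_system T :=
  [set A | exists B C : set R,
     [/\ measurable B, measurable C & A = Y @^-1` B `&` Z @^-1` C]].

Lemma pair_eventsT Y Z : pair_events Y Z setT.
Proof. by exists setT, setT; split => //; rewrite !preimage_setT setTI. Qed.

Lemma pair_eventsI Y Z : setI_closed (pair_events Y Z).
Proof.
move=> _ _ [B [C [mB mC ->]]] [B' [C' [mB' mC' ->]]].
exists (B `&` B'), (C `&` C'); split; [exact: measurableI..|].
by rewrite !preimage_setI setIACA.
Qed.

Lemma pair_events_measurable Y Z : measurable_fun setT Y ->
  measurable_fun setT Z -> pair_events Y Z `<=` measurable.
Proof.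
move=> mY mZ _ [B [C [mB mC ->]]].
by apply: measurableI; rewrite -[X in measurable X]setTI; [exact: mY|exact: mZ].
Qed.

Lemma preimage_pair_sub (Y Z : T -> R) (F : R * R -> R) :
  measurable_fun setT F ->
  g_sigma_algebra_preimage (fun w => F (Y w, Z w)) `<=` <<s pair_events Y Z >>.
Proof.
move=> mF.
pose S := g_sigma_algebraType (pair_events Y Z).
have mY : measurable_fun setT (Y : S -> R).
  move=> _ B mB; rewrite setTI; apply: sub_sigma_algebra.
  by exists B, setT; split => //; rewrite preimage_setT setIT.
have mZ : measurable_fun setT (Z : S -> R).
  move=> _ B mB; rewrite setTI; apply: sub_sigma_algebra.
  by exists setT, B; split => //; rewrite preimage_setT setTI.
have mFYZ : measurable_fun setT ((fun w => F (Y w, Z w)) : S -> R).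
  by apply: (measurableT_comp mF); exact: measurable_fun_pair.
by move=> _ [B mB <-]; exact: mFYZ.
Qed.

Lemma mutually_independent_pairs (P : probability T R) (I : choiceType)
    (Y Z : I -> T -> R) (F : I -> R * R -> R) :
  (forall i, measurable_fun setT (Y i)) -> (forall i, measurable_fun setT (Z i)) ->
  (forall i, measurable_fun setT (F i)) ->
  mutually_independent P (fun i => pair_events (Y i) (Z i)) ->
  mutually_independent P
    (fun i => g_sigma_algebra_preimage (fun w => F i (Y i w, Z i w))).
Proof.
move=> mY mZ mF indYZ.
apply: (mutually_independent_sub (G := fun i => <<s pair_events (Y i) (Z i) >>)).
  by move=> i; exact: preimage_pair_sub.
apply: mutually_independent_sigma => // i.
- exact: pair_events_measurable.
- exact: pair_eventsI.
- exact: pair_eventsT.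
Qed.

(** The law of a pair is determined by its values on rectangles. *)
Lemma eq_pair_law (P : probability T R) (Y Z Y' Z' : T -> R) (F : R * R -> R) :
  measurable_fun setT Y -> measurable_fun setT Z ->
  measurable_fun setT Y' -> measurable_fun setT Z' -> measurable_fun setT F ->
  (forall B C, measurable B -> measurable C ->
    P (Y @^-1` B `&` Z @^-1` C) = P (Y' @^-1` B `&` Z' @^-1` C)) ->
  forall B, measurable B ->
    P ((fun w => F (Y w, Z w)) @^-1` B) = P ((fun w => F (Y' w, Z' w)) @^-1` B).
Proof.
move=> mY mZ mY' mZ' mF H B mB.
have mYZ : measurable_fun setT (fun w => (Y w, Z w)) by exact: measurable_fun_pair.
have mYZ' : measurable_fun setT (fun w => (Y' w, Z' w)) by exact: measurable_fun_pair.
pose m1 : {measure set (R * R) -> \bar R} := pushforward P (fun w => (Y w, Z w)).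
pose m2 : {measure set (R * R) -> \bar R} := pushforward P (fun w => (Y' w, Z' w)).
have mFB : measurable (F @^-1` B) by rewrite -[X in measurable X]setTI; exact: mF.
suff : m1 mYZ (F @^-1` B) = m2 mYZ' (F @^-1` B) by [].
apply: (@measure_unique _ R (R * R)%type
  [set A `*` C | A in measurable & C in measurable] (fun=> setT)) => //.
- exact: measurable_prod_measurableType.
- move=> _ _ [A mA [C mC <-]] [A' mA' [C' mC' <-]]; rewrite -setXI.
  by exists (A `&` A'); [exact: measurableI|exists (C `&` C'); [exact: measurableI|]].
- by move=> _; exists setT => //; exists setT => //; rewrite setXTT.
- by rewrite bigcup_const.
- by move=> _ [A mA [C mC <-]]; exact: H.
- move=> _; rewrite /m1/= /pushforward preimage_setT.
  by rewrite (le_lt_trans (probability_le1 P _))// ltry.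
Qed.

End pairs.

(** * Integration by antiderivatives on unbounded or singular intervals *)

Section fundamental_theorem.
Context {R : realType}.
Notation mu := (@lebesgue_measure R).

Lemma FTC_segment (a b : R) (F f : R -> R) : a < b ->
  (forall x, a <= x <= b -> is_derive x 1 F (f x)) ->
  (forall x, a <= x <= b -> {for x, continuous f}) ->
  mu.-integrable `[a, b] (EFin \o f) /\ \int[mu]_(x in `[a, b]) f x = F b - F a.
Proof.
move=> ab dF cf.
have cw : {within `[a, b], continuous f}.
  by apply: continuous_in_subspaceT => x; rewrite inE/= in_itv/=; exact: cf.
have cF x : a <= x <= b -> {for x, continuous F}.
  move=> xab; apply: differentiable_continuous; apply/derivable1_diffP.
  by have /@ex_derive := dF _ xab.
split; first exact: continuous_compact_integrable (@segment_compact _ _ _) cw.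
rewrite /Rintegral (@continuous_FTC2 _ f F a b)//.
- split.
  + move=> x; rewrite in_itv/= => /andP[ax xb].
    by apply: (@ex_derive _ _ _ _ _ _ (f x)); apply: dF; rewrite !ltW.
  + by apply: cvg_at_right_filter; apply: cF; rewrite lexx ltW.
  + by apply: cvg_at_left_filter; apply: cF; rewrite lexx ltW.
- move=> x; rewrite in_itv/= => /andP[ax xb]; rewrite derive1E.
  by apply: (@derive_val _ _ _ _ _ _ (f x)); apply: dF; rewrite !ltW.
Qed.

Section exhaustion.
Variables (D : set R) (a_ b_ : nat -> R) (F f : R -> R).
Hypothesis mD : measurable D.
Hypothesis ab : forall n, a_ n < b_ n.
Hypothesis subD : forall n x, a_ n <= x <= b_ n -> D x.
Hypothesis exhD : forall x, D x -> \forall n \near \oo, a_ n <= x <= b_ n.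
Hypothesis dF : forall x, D x -> is_derive x 1 F (f x).
Hypothesis cf : forall x, D x -> {for x, continuous f}.

Let mf : measurable_fun D f.
Proof.
apply: subspace_continuous_measurable_fun => //.
by apply: continuous_in_subspaceT => x; rewrite inE; exact: cf.
Qed.

Let f_ n x := f x * \1_`[a_ n, b_ n] x.

Let mf_ n : measurable_fun D (f_ n).
Proof. by apply: measurable_funM => //; exact: measurable_indic. Qed.

Let cvgf_ x : D x -> f_ n x @[n --> \oo] --> f x.
Proof.
move=> Dx; apply: cvg_near_cst; near=> n.
rewrite /f_ indicE mem_set ?mulr1//= in_itv/=.
by near: n; exact: exhD.
Unshelve. all: by end_near. Qed.

Let int_f n : (\int[mu]_(x in D) (f_ n x)%:E = (F (b_ n) - F (a_ n))%:E)%E.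
Proof.
have [||intf <-] := @FTC_segment (a_ n) (b_ n) F f (ab n).
- by move=> x /subD /dF.
- by move=> x /subD /cf.
rewrite integral_mul_indic setIidr; last by move=> x /=; rewrite in_itv/=; exact: subD.
by rewrite /Rintegral fineK//; exact: integrable_fin_num.
Qed.

(** The truncations of [f] to the segments converge to [f] under the domination
    by [f] itself. *)
Lemma FTC_exhaustion (l l' : R) : mu.-integrable D (EFin \o f) ->
  F (a_ n) @[n --> \oo] --> l -> F (b_ n) @[n --> \oo] --> l' ->
  \int[mu]_(x in D) f x = l' - l.
Proof.
move=> intf cl cl'.
have c1 : \int[mu]_(x in D) f_ n x @[n --> \oo] --> \int[mu]_(x in D) f x.
  apply: (@cvg_Rintegral_dominated _ _ R mu D f_ f (fun x => `|f x|)) => //.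
    exact: (integrable_abse intf).
  move=> n x Dx; rewrite normrM indicE.
  by case: (_ \in _); rewrite ?normr1 ?mulr1// normr0 mulr0.
have c2 : \int[mu]_(x in D) f_ n x @[n --> \oo] --> l' - l.
  rewrite /Rintegral; under eq_fun do rewrite int_f/=.
  exact: cvgB.
exact: cvg_unique c1 c2.
Qed.

(** For nonnegative [f] integrability itself follows from bounded increments of
    the primitive, by Fatou's lemma. *)
Lemma integrable_exhaustion (C : R) : (forall x, D x -> 0 <= f x) ->
  (forall n, F (b_ n) - F (a_ n) <= C) -> mu.-integrable D (EFin \o f).
Proof.
move=> f0 FC; apply/integrableP; split; first exact/measurable_EFinP.
have f_0 n x : D x -> (0 <= (f_ n x)%:E)%E.
  by move=> Dx; rewrite lee_fin mulr_ge0// f0.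
have mEf_ n : measurable_fun D (EFin \o f_ n) by exact/measurable_EFinP.
have /= := fatou mu mD mEf_ f_0.
have -> : (\int[mu]_(x in D) `|(EFin \o f) x| =
    \int[mu]_(x in D) limn_einf (fun n => (f_ n x)%:E))%E.
  apply: eq_integral => x; rewrite inE => Dx /=; rewrite ger0_norm ?f0//.
  apply/esym; have cE : (f_ n x)%:E @[n --> \oo] --> (f x)%:E.
    by apply/cvg_EFin; [exact: nearW|exact: cvgf_].
  have [-> _] := cvg_limn_einf_sup cE; first by [].
move=> /le_lt_trans; apply; apply: (@le_lt_trans _ _ C%:E); last by rewrite ltry.
rewrite limn_einf_lim; apply: lime_le; first exact: is_cvg_einfs.
apply: nearW => n; apply: (@le_trans _ _ (\int[mu]_(x in D) (f_ n x)%:E)%E).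
  by apply: ereal_inf_lbound; exists n => //=; exact: leqnn.
by rewrite int_f lee_fin.
Qed.

End exhaustion.

End fundamental_theorem.

Section affine_change_of_variable.
Context {R : realType}.
Notation mu := (@lebesgue_measure R).
Variables u v : R.
Hypothesis u0 : u != 0.

Let affine (x : measurableTypeR R) : measurableTypeR R := u * x + v.

Let measurable_affine : measurable_fun setT affine.
Proof. by apply: measurable_funD => //; exact: measurable_funM. Qed.

Let affine_measure (A : set R) : measurable A ->
  (mu A = `|u|%:E * mu (affine @^-1` A))%E.
Proof.
move=> mA.
pose m : {measure set (measurableTypeR R) -> \bar R} :=
  mscale (NngNum (normr_ge0 u)) (pushforward mu affine).
suff : mu A = m measurable_affine A by [].
apply: lebesgue_measure_unique => // X /ocitvP[->|[[a b] /= ab ->]].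
  by rewrite !measure0.
rewrite /m/= /mscale/= /pushforward.
have [up|un|uE] := ltgtP u 0; last by move: u0; rewrite uE eqxx.
- have -> : affine @^-1` `]a, b] = `[(b - v) / u, (a - v) / u[%classic.
    apply/seteqP; split => x /=; rewrite !in_itv/= /affine => /andP[h1 h2];
      apply/andP; split.
    + by rewrite ler_ndivrMr//; lra.
    + by rewrite ltr_ndivlMr//; lra.
    + by move: h2; rewrite ltr_ndivlMr//; lra.
    + by move: h1; rewrite ler_ndivrMr//; lra.
  rewrite !lebesgue_measure_itv/= !lte_fin ab ltr_nM2r ?invr_lt0// ltrD2r ab.
  rewrite -!EFinB -EFinM; congr EFin; rewrite ltr0_norm//.
  by field.
- have -> : affine @^-1` `]a, b] = `](a - v) / u, (b - v) / u]%classic.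
    apply/seteqP; split => x /=; rewrite !in_itv/= /affine => /andP[h1 h2];
      apply/andP; split.
    + by rewrite ltr_pdivrMr//; lra.
    + by rewrite ler_pdivlMr//; lra.
    + by move: h1; rewrite ltr_pdivrMr//; lra.
    + by move: h2; rewrite ler_pdivlMr//; lra.
  rewrite !lebesgue_measure_itv/= !lte_fin ab ltr_pM2r ?invr_gt0// ltrD2r ab.
  rewrite -!EFinB -EFinM; congr EFin; rewrite gtr0_norm//.
  by field.
Qed.

(** Lebesgue measure is the only measure with the right value on intervals, so
    that it is [|u|] times its image under the affine map. *)
Lemma ge0_integral_affine (f : R -> \bar R) :
  measurable_fun setT f -> (forall x, 0 <= f x)%E ->
  (\int[mu]_x f x = `|u|%:E * \int[mu]_x f (u * x + v)%R)%E.
Proof.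
move=> mf f0.
pose m : {measure set (measurableTypeR R) -> \bar R} :=
  mscale (NngNum (normr_ge0 u)) (pushforward mu affine).
transitivity (\int[m measurable_affine]_x f x)%E.
  by apply: eq_measure_integral => A mA _; exact: affine_measure.
rewrite /m ge0_integral_mscale//; congr (_ * _)%E.
by rewrite ge0_integral_pushforward// preimage_setT.
Qed.

Lemma integrable_affine (f : R -> R) : mu.-integrable setT (EFin \o f) ->
  mu.-integrable setT (fun x => (f (u * x + v))%:E).
Proof.
move=> /integrableP[mf fi].
have mfu : measurable_fun setT (fun x => (f (u * x + v))%:E).
  exact: (measurableT_comp mf measurable_affine).
apply/integrableP; split => //.
have E := @ge0_integral_affine (fun x => `|(f x)%:E|)%E.
have {E}E : (\int[mu]_x `|(f x)%:E| =
    `|u|%:E * \int[mu]_x `|(f (u * x + v))%:E|)%E.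
  by apply: E => //; exact: measurableT_comp.
rewrite ltNge; apply/negP; rewrite leye_eq => /eqP E'.
by move: fi; rewrite /= E E' gt0_muley// lte_fin normr_gt0.
Qed.

Lemma Rintegral_affine (f : R -> R) : mu.-integrable setT (EFin \o f) ->
  \int[mu]_x f x = `|u| * \int[mu]_x f (u * x + v).
Proof.
move=> fi; have fui := integrable_affine fi.
have mf : measurable_fun setT (EFin \o f) by case/integrableP : fi.
have En (g : R -> \bar R) : measurable_fun setT g -> (forall x, (0 <= g x)%E) ->
    fine (\int[mu]_x g x)%E = `|u| * fine (\int[mu]_x g (u * x + v)%R)%E.
  move=> mg g0; rewrite ge0_integral_affine//.
  have [->|goo] := eqVneq (\int[mu]_x g (u * x + v)%R)%E +oo%E.
    by rewrite gt0_muley ?lte_fin ?normr_gt0//= mulr0.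
  by rewrite fineM// ge0_fin_numE ?integral_ge0// ltey.
have RE (g : R -> R) : mu.-integrable setT (EFin \o g) ->
    \int[mu]_x g x = fine (\int[mu]_x (EFin \o g)^\+ x)%E -
                     fine (\int[mu]_x (EFin \o g)^\- x)%E.
  move=> ig; rewrite /Rintegral integralE fineB//.
  - exact: integrable_pos_fin_num.
  - exact: integrable_neg_fin_num.
rewrite (RE f)// (RE (fun x => f (u * x + v)))// mulrBr; congr (_ - _).
- have := En ((EFin \o f)^\+)%E (measurable_funepos mf) (fun x => funepos_ge0 _ x).
  by move=> ->; congr (_ * fine _); apply: eq_integral => x _; rewrite !funeposE.
- have := En ((EFin \o f)^\-)%E (measurable_funeneg mf) (fun x => funeneg_ge0 _ x).
  by move=> ->; congr (_ * fine _); apply: eq_integral => x _; rewrite !funenegE.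
Qed.

End affine_change_of_variable.

(** * The jump measure of a stable subordinator *)

Lemma integrable_setU {d} {T : measurableType d} {R : realType}
    (m : {measure set T -> \bar R}) (A B : set T) (f : T -> \bar R) :
  measurable A -> measurable B -> [disjoint A & B] ->
  m.-integrable A f -> m.-integrable B f -> m.-integrable (A `|` B) f.
Proof.
move=> mA mB AB /integrableP[mfA fA] /integrableP[mfB fB].
have mf : measurable_fun (A `|` B) f by apply/measurable_funU.
apply/integrableP; split => //; rewrite ge0_integral_setU//.
  by rewrite lte_add_pinfty.
exact: measurableT_comp.
Qed.

Section integrable_real.
Context {d} {T : measurableType d} {R : realType}.
Variables (m : {measure set T -> \bar R}) (D : set T) (mD : measurable D).

Lemma integrable_mulr (c : R) (f : T -> R) : m.-integrable D (EFin \o f) ->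
  m.-integrable D (fun x => (c * f x)%:E).
Proof.
move=> fi; have := integrableZl mD c fi.
by congr (integrable _ _ _); apply/funext => x /=; rewrite EFinM.
Qed.

Lemma integrable_addr (f g : T -> R) : m.-integrable D (EFin \o f) ->
  m.-integrable D (EFin \o g) -> m.-integrable D (fun x => (f x + g x)%:E).
Proof.
move=> fi gi; have := integrableD mD fi gi.
by congr (integrable _ _ _); apply/funext => x /=; rewrite EFinD.
Qed.

Lemma integrable_subr (f g : T -> R) : m.-integrable D (EFin \o f) ->
  m.-integrable D (EFin \o g) -> m.-integrable D (fun x => (f x - g x)%:E).
Proof.
move=> fi gi; have := integrableB mD fi gi.
by congr (integrable _ _ _); apply/funext => x /=; rewrite EFinB.
Qed.

End integrable_real.

Section jump_kernel.
Context {R : realType}.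
Notation mu := (@lebesgue_measure R).
Variable alpha : R.
Hypotheses (alpha_gt0 : 0 < alpha) (alpha_lt1 : alpha < 1).

Lemma powR_shift (z r s : R) : 0 < z -> z `^ r * z `^ s = z `^ (r + s).
Proof. by move=> z0; rewrite powRD// (gt_eqF z0) implybT. Qed.

Lemma powRN1 (z : R) : 0 < z -> z * z `^ (- alpha - 1) = z `^ (- alpha).
Proof.
move=> z0; rewrite -{1}[z](@powRr1 R) ?ltW// powR_shift//.
by congr (_ `^ _); ring.
Qed.

(** [min(1, z) z^(-alpha-1)] dominates the integrands over the jumps: it carries the
    singularity at [0] of a function vanishing there, and the decay at infinity. *)
Definition jump_weight (z : R) := Num.min 1 z * z `^ (- alpha - 1).

Lemma jump_weight_ge0 z : 0 < z -> 0 <= jump_weight z.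
Proof. by move=> z0; rewrite mulr_ge0 ?powR_ge0// le_min ler01 ltW. Qed.

Lemma measurable_jump_weight : measurable_fun setT jump_weight.
Proof.
apply: measurable_funM; last exact: measurable_powR.
exact: measurable_minr.
Qed.

Let derive_powR (r c z : R) : 0 < z -> c * r = 1 ->
  is_derive z 1 (fun x => c * x `^ r) (z `^ (r - 1)).
Proof.
move=> z0 cr.
have := is_deriveZ c (is_derive1_powR r z0).
by move/is_derive_eq; apply; rewrite /GRing.scale/= mulrA cr mul1r.
Qed.

Lemma continuous_powR (r z : R) : 0 < z -> {for z, continuous (@powR R ^~ r)}.
Proof.
move=> z0; apply: differentiable_continuous; apply/derivable1_diffP.
by have /@ex_derive := is_derive1_powR r z0.
Qed.

Lemma integrable_jump_weight :
  mu.-integrable `]0, +oo[ (EFin \o jump_weight).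
Proof.
have -> : `]0, +oo[%classic = `]0, 1] `|` `]1, +oo[ :> set R.
  apply/seteqP; split => x /=; rewrite !in_itv/= ?andbT.
    by move=> x0; have [x1|x1] := leP x 1; [left; rewrite x0|right].
  by move=> [/andP[]//|]; apply: lt_trans.
apply: integrable_setU => //.
- by apply/disj_setPLR => x /=; rewrite !in_itv/= andbT => /andP[_]; rewrite leNgt => /negP.
- have i1 : mu.-integrable `]0, 1] (EFin \o (fun z => z `^ (1 - alpha - 1))).
    apply: (@integrable_exhaustion _ _ (fun n => n.+2%:R^-1) (fun=> 1)
      (fun z => (1 - alpha)^-1 * z `^ (1 - alpha)) _ _ _ _ _ _ _ (1 - alpha)^-1) => //.
    + by move=> n; rewrite invf_lt1 ?ltr1n ?ltr0n.
    + move=> n x /andP[x0 x1] /=; rewrite in_itv/= x1 andbT.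
      by apply: lt_le_trans x0; rewrite invr_gt0 ltr0n.
    + move=> x /=; rewrite in_itv/= => /andP[x0 ->].
      near=> n; rewrite andbT invf_ple ?posrE ?ltr0n//.
      near: n; exists (Num.truncn x^-1) => // n /= xn.
      apply: ltW; apply: lt_le_trans (truncnS_gt _) _.
      by rewrite ler_nat ltnS; apply: leq_trans xn _.
    + move=> x /=; rewrite in_itv/= => /andP[x0 _]; apply: derive_powR => //.
      by rewrite mulVf// gt_eqF// subr_gt0.
    + by move=> x /=; rewrite in_itv/= => /andP[x0 _]; exact: continuous_powR.
    + by move=> x _; exact: powR_ge0.
    + move=> n; rewrite powR1 mulr1 gerBl mulr_ge0 ?powR_ge0// invr_ge0 subr_ge0.
      exact: ltW.
  apply: (@integrable_dominated _ _ R mu _ _ _ _ _ i1) => //.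
    by apply: measurable_funTS; exact: measurable_jump_weight.
  move=> x /=; rewrite in_itv/= => /andP[x0 x1].
  rewrite ger0_norm ?jump_weight_ge0// /jump_weight min_r// powRN1//.
  by rewrite [X in _ <= _ `^ X](_ : _ = - alpha)//; ring.
- have i2 : mu.-integrable `[1, +oo[ (EFin \o (fun z => z `^ (- alpha - 1))).
    have pos (x : R) : `[1, +oo[%classic x -> 0 < x.
      by rewrite /= in_itv/= andbT; exact: lt_le_trans.
    apply: (@integrable_exhaustion _ _ (fun=> 1) (fun n => n.+2%:R)
      (fun z => (- alpha)^-1 * z `^ (- alpha)) _ _ _ _ _ _ _ (alpha)^-1) => //.
    + by move=> n; rewrite ltr1n.
    + by move=> n x /andP[x0 x1] /=; rewrite in_itv/= x0.
    + move=> x /=; rewrite in_itv/= andbT => ->; near=> n => /=.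
      near: n; exists (Num.truncn x) => // n /= xn.
      apply: ltW; apply: lt_le_trans (truncnS_gt _) _.
      by rewrite ler_nat ltnS; apply: leq_trans xn _.
    + move=> x /pos x0; apply: derive_powR => //.
      by rewrite mulVf// oppr_eq0 gt_eqF.
    + by move=> x /pos x0; exact: continuous_powR.
    + by move=> x _; exact: powR_ge0.
    + move=> n; rewrite powR1 mulr1 invrN mulNr opprK gerDr oppr_le0.
      by rewrite mulr_ge0 ?powR_ge0// invr_ge0 ltW.
  have i3 : mu.-integrable `]1, +oo[ (EFin \o (fun z => z `^ (- alpha - 1))).
    apply: integrableS i2 => //; apply: subset_itvr; by rewrite bnd_simp.
  apply: (@integrable_dominated _ _ R mu _ _ _ _ _ i3) => //.
    by apply: measurable_funTS; exact: measurable_jump_weight.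
  move=> x /=; rewrite in_itv/= andbT => x1.
  rewrite ger0_norm ?jump_weight_ge0 ?(lt_trans _ x1)// /jump_weight.
  by rewrite min_l ?mul1r// ltW.
Unshelve. all: by end_near. Qed.

(** Integration by parts, the boundary terms vanishing at [0] because
    [alpha < 1] and at infinity because [0 < alpha]. *)
Lemma integration_by_parts_powR (g g' : R -> R) (C : R) :
  (forall y : R, 0 < y -> is_derive y 1 g (g' y)) ->
  (forall y : R, 0 < y -> {for y, continuous g'}) ->
  (forall y : R, 0 < y -> `|g y| <= C * Num.min 1 y) ->
  (forall y : R, 0 < y -> `|g' y| * y <= C * Num.min 1 y) ->
  [/\ mu.-integrable `]0, +oo[ (fun y => (g' y * y `^ (- alpha))%:E),
      mu.-integrable `]0, +oo[ (fun y => (g y * y `^ (- alpha - 1))%:E) &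
      \int[mu]_(y in `]0, +oo[) (g' y * y `^ (- alpha)) =
      alpha * \int[mu]_(y in `]0, +oo[) (g y * y `^ (- alpha - 1))].
Proof.
move=> dg cg' gC g'C.
have pos (x : R) : `]0, +oo[%classic x -> 0 < x by rewrite /= in_itv/= andbT.
have cg (y : R) : 0 < y -> {for y, continuous g}.
  move=> y0; apply: differentiable_continuous; apply/derivable1_diffP.
  by have /@ex_derive := dg _ y0.
have mD : measurable (`]0, +oo[%classic : set R) by [].
have meas (h : R -> R) : (forall y : R, 0 < y -> {for y, continuous h}) ->
    measurable_fun (`]0, +oo[%classic : set R) h.
  move=> ch; apply: open_continuous_measurable_fun => // x.
  by rewrite inE => /pos; exact: ch.
have iW : mu.-integrable `]0, +oo[ (EFin \o (fun y => C * jump_weight y)).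
  exact: integrable_mulr integrable_jump_weight.
have i1 : mu.-integrable `]0, +oo[ (fun y => (g' y * y `^ (- alpha))%:E).
  apply: (@integrable_dominated _ _ R mu _ _ _ _ _ iW) => //.
    by apply: measurable_funM; [exact: meas|apply: measurable_funTS; exact: measurable_powR].
  move=> y /pos y0; rewrite normrM (ger0_norm (powR_ge0 _ _)) -powRN1//.
  by rewrite !mulrA ler_wpM2r ?powR_ge0// g'C.
have i2 : mu.-integrable `]0, +oo[ (fun y => (g y * y `^ (- alpha - 1))%:E).
  apply: (@integrable_dominated _ _ R mu _ _ _ _ _ iW) => //.
    by apply: measurable_funM; [exact: meas|apply: measurable_funTS; exact: measurable_powR].
  move=> y /pos y0; rewrite normrM (ger0_norm (powR_ge0 _ _)).
  by rewrite mulrA ler_wpM2r ?powR_ge0// gC.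
split => //.
have i3 : mu.-integrable `]0, +oo[ (fun y => (alpha * (g y * y `^ (- alpha - 1)))%:E).
  exact: integrable_mulr i2.
rewrite -RintegralZl//; apply/eqP; rewrite -subr_eq0 -RintegralB//; apply/eqP.
pose F y := g y * y `^ (- alpha).
have inv0 : (n.+2%:R^-1 : R) @[n --> \oo] --> (0 : R).
  by have := @cvg_harmonic R; rewrite -(cvg_shiftS _).
have C0 : 0 <= C.
  have := gC 1 ltr01; rewrite minxx mulr1; apply: le_trans; exact: normr_ge0.
rewrite [RHS](_ : 0 = 0 - 0); last by rewrite subrr.
apply: (@FTC_exhaustion _ _ (fun n => n.+2%:R^-1) (fun n => n.+2%:R) F) => //.
- by move=> n; rewrite (@lt_trans _ _ 1)// ?ltr1n// invf_lt1 ?ltr1n ?ltr0n.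
- move=> n x /andP[x0 x1] /=; rewrite in_itv/= andbT.
  by apply: lt_le_trans x0; rewrite invr_gt0 ltr0n.
- move=> x /pos x0; near=> n; apply/andP; split.
    rewrite invf_ple ?posrE ?ltr0n//.
    near: n; exists (Num.truncn x^-1) => // n /= xn.
    apply: ltW; apply: lt_le_trans (truncnS_gt _) _.
    by rewrite ler_nat ltnS; apply: leq_trans xn _.
  near: n; exists (Num.truncn x) => // n /= xn.
  apply: ltW; apply: lt_le_trans (truncnS_gt _) _.
  by rewrite ler_nat ltnS; apply: leq_trans xn _.
- move=> x /pos x0.
  have := is_deriveM (dg _ x0) (is_derive1_powR (- alpha) x0).
  by move/is_derive_eq; apply; rewrite /GRing.scale/=; ring.
- move=> x /pos x0; apply: cvgB; [apply: cvgM|apply: cvgM; [exact: cvg_cst|apply: cvgM]].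
  + exact: cg'.
  + exact: continuous_powR.
  + exact: cg.
  + exact: continuous_powR.
- exact: integrable_subr.
- apply/norm_cvg0P; apply: (@squeeze_cvgr _ _ _ _ (fun=> 0)
    (fun n => C * (n.+2%:R^-1) `^ (1 - alpha))).
  + apply: nearW => n; rewrite normr_ge0/= normrM (ger0_norm (powR_ge0 _ _)).
    have y0 : 0 < n.+2%:R^-1 :> R by rewrite invr_gt0 ltr0n.
    rewrite -powR_shift// powRr1 ?(ltW y0)//.
    rewrite mulrA ler_wpM2r ?powR_ge0//; apply: le_trans (gC _ y0) _.
    by rewrite ler_wpM2l// ge_min lexx orbT.
  + exact: cvg_cst.
  + rewrite -[X in _ --> X](mulr0 C); apply: cvgM; first exact: cvg_cst.
    have a1 : 0 < 1 - alpha by rewrite subr_gt0.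
    have /cvg_at_rightP := powR_cvg0 a1; apply.
    by split => // n; rewrite invr_gt0 ltr0n.
- apply/norm_cvg0P; apply: (@squeeze_cvgr _ _ _ _ (fun=> 0)
    (fun n => C * (n.+2%:R^-1) `^ alpha)).
  + apply: nearW => n; rewrite normr_ge0/= normrM (ger0_norm (powR_ge0 _ _)).
    have y0 : 0 < n.+2%:R :> R by rewrite ltr0n.
    have -> : n.+2%:R^-1 `^ alpha = n.+2%:R `^ (- alpha) :> R.
      by rewrite -powR_inv1 ?ltW// -powRrM mulN1r.
    rewrite ler_wpM2r ?powR_ge0//; apply: le_trans (gC _ y0) _.
    by rewrite ler_piMr// ge_min lexx.
  + exact: cvg_cst.
  + rewrite -[X in _ --> X](mulr0 C); apply: cvgM; first exact: cvg_cst.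
    have /cvg_at_rightP := powR_cvg0 alpha_gt0; apply.
    by split => // n; rewrite invr_gt0 ltr0n.
Unshelve. all: by end_near. Qed.

End jump_kernel.

Section laplace_exponent.
Context {R : realType}.
Notation mu := (@lebesgue_measure R).
Variable alpha : R.
Hypotheses (alpha_gt0 : 0 < alpha) (alpha_lt1 : alpha < 1).

Lemma expR_bounds (x : R) : 0 <= x ->
  [/\ 0 <= 1 - expR (- x), 1 - expR (- x) <= 1, 1 - expR (- x) <= x &
      x * expR (- x) <= 1].
Proof.
move=> x0; have e0 := expR_gt0 (- x); have e1 : expR (- x) <= 1.
  by rewrite expR_le1 oppr_le0.
have := expR_ge1Dx (- x); have := expR_ge1Dx x.
have : expR x * expR (- x) = 1 by rewrite -expRD subrr expR0.
by move=> *; split; nra.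
Qed.

Lemma is_derive_expRN (u x : R) :
  is_derive x 1 (fun y => 1 - expR (- (u * y))) (u * expR (- (u * x))).
Proof.
have d1 : is_derive x 1 (fun y : R => - (u * y)) (- u).
  have := is_deriveN (is_deriveZ u (is_derive_id x 1)).
  by move/is_derive_eq; apply; rewrite /GRing.scale/= mulr1.
have := is_deriveB (is_derive_cst (1 : R) x 1)
  (@is_derive1_comp _ expR (fun y => - (u * y)) _ _ _
    (is_derive_expR (- (u * x))) d1).
by move/is_derive_eq; apply; ring.
Qed.

Lemma continuous_expRN (u : R) : continuous (fun y : R => expR (- (u * y))).
Proof.
move=> y; apply: continuous_comp; last exact: continuous_expR.
by apply: cvgN; apply: cvgM; [exact: cvg_cst|exact: cvg_id].
Qed.

(** The case [g y = 1 - exp(- u y)] of the integration by parts. *)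
Lemma laplace_kernel (u : R) : 0 <= u ->
  [/\ mu.-integrable `]0, +oo[ (fun y => (u * expR (- (u * y)) * y `^ (- alpha))%:E),
      mu.-integrable `]0, +oo[
        (fun y => ((1 - expR (- (u * y))) * y `^ (- alpha - 1))%:E) &
      \int[mu]_(y in `]0, +oo[) (u * expR (- (u * y)) * y `^ (- alpha)) =
      alpha * \int[mu]_(y in `]0, +oo[)
                ((1 - expR (- (u * y))) * y `^ (- alpha - 1))].
Proof.
move=> u0; apply: (integration_by_parts_powR alpha_gt0 alpha_lt1 (C := 1 + u)).
- by move=> y _; exact: is_derive_expRN.
- move=> y _; apply: cvgM; first exact: cvg_cst.
  exact: continuous_expRN.
- move=> y y0; have uy0 : 0 <= u * y by rewrite mulr_ge0// ltW.
  have [h1 h2 h3 _] := expR_bounds uy0; rewrite ger0_norm//.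
  by case: (leP 1 y) => y1; [nra|nra].
- move=> y y0; have uy0 : 0 <= u * y by rewrite mulr_ge0// ltW.
  have [h1 h2 h3 h4] := expR_bounds uy0; have e0 := expR_gt0 (- (u * y)).
  rewrite ger0_norm ?mulr_ge0 ?expR_ge0//.
  have -> : u * expR (- (u * y)) * y = u * y * expR (- (u * y)) by ring.
  by case: (leP 1 y) => y1; [nra|nra].
Qed.

Lemma integrable_gamma_kernel (u : R) : 0 < u ->
  mu.-integrable `]0, +oo[ (fun y => (expR (- (u * y)) * y `^ (- alpha))%:E).
Proof.
move=> u0; have [i1 _ _] := laplace_kernel (ltW u0).
have := @integrable_mulr _ _ R mu _ (measurable_itv _) u^-1
  (fun y => u * expR (- (u * y)) * y `^ (- alpha)) i1.
congr (integrable _ _ _); apply/funext => y; congr EFin.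
by rewrite !mulrA mulVf ?gt_eqF// mul1r.
Qed.

Lemma GammaE :
  Gamma (1 - alpha) =
  \int[mu]_(y in `]0, +oo[) (expR (- y) * y `^ (- alpha)).
Proof.
apply: eq_Rintegral => y _; rewrite mulrC.
by congr (_ * _ `^ _); ring.
Qed.

(** The substitution [u y] in Euler's integral. *)
Lemma laplace_gamma (u : R) : 0 < u ->
  \int[mu]_(y in `]0, +oo[) (u * expR (- (u * y)) * y `^ (- alpha)) =
  u `^ alpha * Gamma (1 - alpha).
Proof.
move=> u0; have uN0 : u != 0 by rewrite gt_eqF.
have i1 := integrable_gamma_kernel ltr01.
pose f : R -> R := (fun y => expR (- (1 * y)) * y `^ (- alpha)) \_ `]0, +oo[.
have if_ : mu.-integrable setT (EFin \o f).
  rewrite /f -restrict_EFin.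
  exact: ((@integrable_mkcond _ _ R mu _ _ (measurable_itv `]0, +oo[)).1 i1).
have -> : Gamma (1 - alpha) = \int[mu]_y f y.
  rewrite GammaE /f -Rintegral_mkcond; apply: eq_Rintegral => y _.
  by rewrite mul1r.
rewrite (Rintegral_affine 0 uN0 if_) gtr0_norm//.
rewrite Rintegral_mkcond mulrA -RintegralZl//; last exact: integrable_affine.
apply: eq_Rintegral => y _; rewrite /f !patchE addr0.
have -> : (u * y \in `]0, +oo[%classic) = (y \in `]0, +oo[%classic).
  by apply/idP/idP; rewrite !inE/= !in_itv/= !andbT pmulr_rgt0.
case: ifPn; last by rewrite mulr0.
rewrite inE/= in_itv/= andbT => y0; rewrite mul1r powRM ?ltW//.
have : u `^ alpha * u `^ (- alpha) = 1 by rewrite powR_shift// subrr powRr0.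
set a := u `^ alpha; set b := u `^ (- alpha) => ab.
transitivity (a * b * u * expR (- (u * y)) * y `^ (- alpha)).
  by rewrite ab mul1r.
ring.
Qed.

Lemma Gamma_gt0 : 0 < Gamma (1 - alpha).
Proof.
have i1 := integrable_gamma_kernel ltr01.
have mI : measurable (`]0, 1] : set R)%classic by [].
have mf : measurable_fun (`]0, +oo[ : set R)%classic (fun y => expR (-1) * \1_`]0, 1] y : R).
  by apply: measurable_funM => //; exact: measurable_indic.
have fle (y : R) : 0 < y ->
    expR (-1) * \1_`]0, 1] y <= expR (- (1 * y)) * y `^ (- alpha).
  move=> y0; rewrite indicE; have [y1|y1] := leP y 1; last first.
    by rewrite memNset ?mulr0 ?mulr_ge0 ?expR_ge0 ?powR_ge0//= in_itv/= leNgt y1 andbF.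
  rewrite mem_set ?mulr1; last by rewrite /= in_itv/= y0.
  rewrite -[leLHS]mulr1 ler_pM ?expR_ge0//; first by rewrite ler_expR mul1r lerN2.
  rewrite powRN -(invr1 R) lef_pV2 ?posrE ?powR_gt0//.
  have <- : 1 `^ alpha = 1 :> R by rewrite powR1.
  by rewrite ge0_ler_powR ?nnegrE// ltW.
have if_ : mu.-integrable `]0, +oo[ (EFin \o (fun y => expR (-1) * \1_`]0, 1] y)).
  apply: (@integrable_dominated _ _ R mu _ _ _ _ _ i1) => // y.
  rewrite /= in_itv/= andbT => y0; rewrite ger0_norm ?mulr_ge0 ?expR_ge0//.
  exact: fle.
apply: (@lt_le_trans _ _ (\int[mu]_(y in `]0, +oo[) (expR (- 1) * \1_`]0, 1] y))).
  rewrite /Rintegral integral_mul_indic setIidr; last first.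
    by apply: subset_itvl; rewrite bnd_simp.
  rewrite integral_cst//= lebesgue_measure_itv/= lte_fin ltr01 -EFinB -EFinM/=.
  by rewrite subr0 mulr1 expR_gt0.
rewrite GammaE; under [leRHS]eq_Rintegral do rewrite -[X in expR (- X)]mul1r.
apply: le_Rintegral => // y.
by rewrite /= in_itv/= andbT; exact: fle.
Qed.

(** The Laplace exponent [u^alpha] is carried by the jumps
    [alpha / Gamma(1 - alpha) y^(-alpha-1) dy]. *)
Lemma levy_laplace (u : R) : 0 <= u ->
  \int[mu]_(y in `]0, +oo[) ((1 - expR (- (u * y))) * y `^ (- alpha - 1)) =
  alpha^-1 * (u `^ alpha * Gamma (1 - alpha)).
Proof.
rewrite le_eqVlt => /predU1P[<-|u0].
  rewrite powR0 ?gt_eqF// mul0r mulr0 /Rintegral integral0_eq// => y _.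
  by rewrite mul0r oppr0 expR0 subrr mul0r.
have [_ _ E] := laplace_kernel (ltW u0).
by rewrite -(laplace_gamma u0) E mulrA mulVf ?mul1r// gt_eqF.
Qed.

End laplace_exponent.

(** * Weighted means on the square and grouping of independent events *)

Section weighted_mean.
Context {d} {T : measurableType d} {R : realType}.
Variable m : {measure set T -> \bar R}.

Section functional.
Variables (D : set T) (w U V : T -> R).
Hypothesis mD : measurable D.
Hypothesis iw : m.-integrable D (EFin \o w).
Hypothesis w0 : forall x, D x -> 0 <= w x.
Hypothesis mU : measurable_fun setT U.
Hypothesis mV : measurable_fun setT V.
Hypothesis UV : forall x, D x -> unit_square (U x, V x).

Lemma integrable_weighted (h : R * R -> R) : square_bounded h ->
  m.-integrable D (fun x => (w x * h (U x, V x))%:E).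
Proof.
move=> [mh [C hC]].
have iCw : m.-integrable D (fun x => (C * w x)%:E) by exact: integrable_mulr.
apply: (integrable_dominated mD _ iCw).
  apply: measurable_funM.
    by apply/measurable_EFinP; case/integrableP : iw.
  apply: measurable_funTS; apply: (measurableT_comp mh).
  exact: measurable_fun_pair.
move=> x Dx; rewrite normrM (ger0_norm (w0 Dx)) mulrC.
by apply: ler_wpM2r; [exact: w0|exact/hC/UV].
Qed.

Lemma weighted_mean :
  positive_functional (fun h => \int[m]_(x in D) (w x * h (U x, V x))).
Proof.
split.
- move=> h g bh bg; rewrite -RintegralD//; try exact: integrable_weighted.
  by apply: eq_Rintegral => x _; rewrite mulrDr.
- move=> c h bh; rewrite -RintegralZl//; last exact: integrable_weighted.
  by apply: eq_Rintegral => x _; rewrite mulrCA.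
- move=> h g bh bg hg; apply: le_Rintegral => //; try exact: integrable_weighted.
  by move=> x Dx; apply: ler_wpM2l; [exact: w0|exact/hg/UV].
Qed.

(** The mass that a cutoff removes vanishes when the two variables are
    positive. *)
Lemma weighted_mean_cutoff : (forall x, D x -> 0 < U x /\ 0 < V x) ->
  \int[m]_(x in D) (w x * (1 - U x * V x) ^+ M) @[M --> \oo] --> 0.
Proof.
move=> UV0.
have Emu : measurable_fun D (fun x => 1 - U x * V x).
  by apply: measurable_funTS; apply: measurable_funB => //; exact: measurable_funM.
have mw : measurable_fun D w by apply/measurable_EFinP; case/integrableP : iw.
have UV1 x : D x -> 0 <= 1 - U x * V x < 1.
  move=> Dx; have /= [/andP[? ?] /andP[? ?]] := UV Dx.
  have [? ?] := UV0 _ Dx.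
  by rewrite subr_ge0 mulr_ile1//= ltrBlDr ltrDl mulr_gt0.
have -> : 0 = \int[m]_(x in D) (w x * 0).
  by rewrite /Rintegral integral0_eq// => x _; rewrite mulr0.
apply: (cvg_Rintegral_dominated (g := w)) => //.
- move=> M; apply: measurable_funM => //; exact: measurable_funX.
- by apply: measurable_funM => //; exact: measurable_cst.
- move=> x Dx; apply: cvgM; first exact: cvg_cst.
  have /andP[h0 h1] := UV1 _ Dx; apply: cvg_expr; by rewrite ger0_norm.
- move=> M x Dx; have /andP[h0 h1] := UV1 _ Dx; have wx := w0 Dx.
  rewrite normrM (ger0_norm wx) ler_piMr// normrX ger0_norm//.
  by apply: exprn_ile1 => //; exact: ltW.
Qed.

End functional.
End weighted_mean.

Section blocks.
Context {d} {T : measurableType d} {R : realType} (P : probability T R).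

(** The events decided by the indices in [D i]; disjoint blocks will again be
    independent. *)
Definition block_events (I K : choiceType) (G : I -> set_system T)
    (D : K -> seq I) (i : K) : set_system T :=
  [set A | exists2 B : I -> set T, (forall k, k \in D i -> G k (B k)) &
                                  A = \bigcap_(k in [set` D i]) B k].

(** Membership in the block [i] is recovered from the index by [pi], so blocks are
    disjoint and their concatenation has no repetition. *)
Lemma mutually_independent_blocks (I K : choiceType) (G : I -> set_system T)
    (D : K -> seq I) (pi : I -> K) :
  (forall i, uniq (D i)) -> (forall i k, k \in D i -> pi k = i) ->
  mutually_independent P G -> mutually_independent P (block_events G D).
Proof.
move=> uD piD indG J A uJ HA.
have /choice[B HB] : forall i, exists B : I -> set T, i \in J ->
    (forall k, k \in D i -> G k (B k)) /\ A i = \bigcap_(k in [set` D i]) B k.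
  move=> i; have [iJ|] := boolP (i \in J); last by exists (fun=> set0).
  by have [B GB ->] := HA _ iJ; exists B.
pose B' k := B (pi k) k.
have BB' i k : k \in D i -> B' k = B i k by move=> kD; rewrite /B' (piD i).
have AE i : i \in J -> A i = \bigcap_(k in [set` D i]) B' k.
  move=> /HB[_ ->]; apply: eq_bigcapr => k /= kD; exact/esym/BB'.
have GB' i k : i \in J -> k \in D i -> G k (B' k).
  by move=> /HB[H _] kD; rewrite (BB' i)//; exact: H.
have PA i : i \in J -> P (A i) = (\prod_(k <- D i) P (B' k))%E.
  by move=> iJ; rewrite AE//; apply: indG => // k; exact: GB'.
have uF : uniq (flatten (map D J)).
  elim: J uJ {HA HB AE GB' PA} => //= i J IH /andP[iJ uJ].
  rewrite cat_uniq uD IH// andbT; apply/hasPn => k /flatten_mapP[j jJ kj].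
  apply/negP => /= ki; move: iJ; rewrite -(piD _ _ ki) (piD _ _ kj) jJ//.
have -> : (\prod_(i <- J) P (A i) =
    \prod_(k <- flatten (map D J)) P (B' k))%E.
  by rewrite big_flatten big_map; apply: eq_big_seq => i iJ; exact: PA.
have -> : \bigcap_(i in [set` J]) A i =
    \bigcap_(k in [set` flatten (map D J)]) B' k.
  apply/seteqP; split => w Aw.
    move=> k /= /flatten_mapP[i iJ ki]; have := Aw i iJ.
    by rewrite AE//; exact.
  move=> i /= iJ; rewrite AE// => k /= ki; apply: Aw => /=.
  by apply/flatten_mapP; exists i.
apply: indG => // k /flatten_mapP[i iJ ki]; exact: GB' iJ ki.
Qed.

End blocks.

(** * The compound Poisson sum *)

Lemma Rintegral_probability_cst {d} {T : measurableType d} {R : realType}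
    (P : probability T R) (r : R) : \int[P]_w r = r.
Proof.
rewrite Rintegral_cst//.
have -> : fine (P [set: T]) = fine (1 : \bar R)%E by congr fine; exact: probability_setT.
by rewrite mulr1.
Qed.

Section pareto.
Context {d} {T : measurableType d} {R : realType} (P : probability T R).
Notation mu := (@lebesgue_measure R).
Variables (alpha : R) (X : {RV P >-> R}).
Hypotheses (alpha_gt0 : 0 < alpha) (alpha_lt1 : alpha < 1).
Hypothesis X_exp : forall B : set R, measurable B ->
  distribution P X B = exponential_prob alpha B.

Lemma exponential_tail (x : R) : 0 < x ->
  P [set w | x < X w] = (expR (- (alpha * x)))%:E.
Proof.
move=> x0.
have -> : [set w | x < X w] = ~` (X @^-1` `]-oo, x]).
  apply/seteqP; split => w /=; rewrite in_itv/=.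
    by move=> xX; apply/negP; rewrite -ltNge.
  by move/negP; rewrite -ltNge.
have mX (i : interval R) : measurable (X @^-1` [set` i]).
  by rewrite -[X in measurable X]setTI; exact: measurable_funP.
rewrite probability_setC//.
have -> : X @^-1` `]-oo, x] = X @^-1` `]-oo, 0[ `|` X @^-1` `[0, x].
  apply/seteqP; split => w /=; rewrite !in_itv/=.
    by move=> Xx; have [X0|X0] := ltP (X w) 0; [left|right].
  by move=> [X0|/andP[]//]; rewrite ltW// (lt_trans X0).
rewrite measureU; [|exact: mX|exact: mX|]; last first.
  by apply/seteqP; split => w //= []; rewrite !in_itv/= => h /andP[]; rewrite leNgt h.
have P0 : P (X @^-1` `]-oo, 0[) = 0%E.
  rewrite -[LHS]/(distribution P X `]-oo, 0[%classic) X_exp//.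
  apply: integral0_eq => y /=; rewrite in_itv/= => y0.
  by rewrite lt0_exponential_pdf.
have Px : P (X @^-1` `[0, x]) = (1 - (expR (- alpha * x))%:E)%E.
  rewrite -[LHS]/(distribution P X `[0, x]%classic) X_exp//.
  exact: exponential_prob_itv0c.
transitivity (1 - (0 + (1 - (expR (- alpha * x))%:E)))%E.
  by congr (_ - (_ + _))%E.
rewrite add0e -[1%E]/((1 : R)%:E) -!EFinB; congr EFin.
by rewrite mulNr; ring.
Qed.

Lemma pareto_tail (gamma z : R) : 0 < gamma -> gamma < z ->
  P [set w | z < gamma * expR (X w)] = (gamma `^ alpha * z `^ (- alpha))%:E.
Proof.
move=> g0 gz; have z0 : 0 < z := lt_trans g0 gz.
have zg0 : 0 < z / gamma by rewrite divr_gt0.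
have -> : [set w | z < gamma * expR (X w)] = [set w | ln (z / gamma) < X w].
  apply/seteqP; split => w /=; rewrite [gamma * _]mulrC -ltr_pdivrMr//.
    by move=> zX; rewrite -ltr_expR lnK ?posrE.
  by rewrite -ltr_expR lnK ?posrE.
rewrite exponential_tail; last by rewrite ln_gt0// ltr_pdivlMr// mul1r.
congr EFin; rewrite /powR !gt_eqF// -expRD lnM ?posrE ?invr_gt0// lnV ?posrE//.
by congr expR; ring.
Qed.

Let mXe (c : R) : measurable_fun setT (fun w => c * expR (X w)).
Proof.
apply: measurable_funM => //; apply: measurableT_comp => //.
Qed.

Let tail (gamma z : R) := fine (P [set w | z < gamma * expR (X w)]).

Let measurable_exceed (gamma z : R) :
  measurable [set w | z < gamma * expR (X w)].
Proof.
rewrite -[X in measurable X]setTI.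
have : measurable_fun setT (fun w => z < gamma * expR (X w)).
  exact: measurable_fun_ltr.
by move=> /(_ measurableT [set true]); exact.
Qed.

Let tail01 gamma z : 0 <= tail gamma z <= 1.
Proof.
have := probability_le1 P (measurable_exceed gamma z).
rewrite /tail fine_ge0//= -lee_fin fineK// fin_num_measure//.
Qed.

Let measurable_tail gamma : measurable_fun (setT : set R) (tail gamma).
Proof.
apply: nonincreasing_measurable => // r s rs.
apply: fine_le; rewrite ?fin_num_measure//.
by apply: le_measure; rewrite ?inE// => w /=; exact: le_lt_trans.
Qed.

(** Layer-cake formula for [1 - exp(- u Y)]. *)
Lemma pareto_laplace (gamma u : R) : 0 < gamma -> 0 < u ->
  1 - \int[P]_w expR (- (u * (gamma * expR (X w)))) =
  \int[mu]_(z in `]0, +oo[)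
    (u * expR (- (u * z)) * fine (P [set w | z < gamma * expR (X w)])).
Proof.
move=> g0 u0; set Y := fun w => gamma * expR (X w).
have Y0 w : 0 < Y w by rewrite mulr_gt0 ?expR_gt0.
have mY : measurable_fun setT Y by exact: mXe.
have mexp : measurable_fun setT (fun w => expR (- (u * Y w))).
  apply: measurableT_comp => //; apply: measurableT_comp => //.
  exact: measurable_funM.
have e01 w : 0 <= expR (- (u * Y w)) <= 1.
  by rewrite expR_ge0/= expR_le1 oppr_le0 mulr_ge0// ltW.
have iexp : P.-integrable setT (fun w => (expR (- (u * Y w)))%:E).
  apply: (integrable_dominated (g := fun=> 1)) => //.
    exact: finite_measure_integrable_cst.
  by move=> w _; have /andP[? ?] := e01 w; rewrite ger0_norm.
have i1 : P.-integrable setT (fun=> (1 : R)%:E) by exact: finite_measure_integrable_cst.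
have -> : 1 - \int[P]_w expR (- (u * Y w)) = \int[P]_w (1 - expR (- (u * Y w))).
  rewrite RintegralB//; congr (_ - _).
  by rewrite Rintegral_probability_cst.
pose g z := u * expR (- (u * z)).
have mg : measurable_fun (setT : set R) g.
  by apply: continuous_measurable_fun => z; apply: cvgM;
    [exact: cvg_cst|exact: continuous_expRN].
have g_ge0 z : 0 <= g z by rewrite mulr_ge0 ?expR_ge0// ltW.
have cake := layer_cake P mY (measurable_cst (1 : R)) mg (fun=> ler01) g_ge0.
rewrite /Rintegral.
transitivity (fine (\int[P]_w (1%:E * \int[mu]_(z in `[0%R, (Y w)[) (g z)%:E))%E).
  congr fine; apply: eq_integral => w _; rewrite mul1e.
  have [||ig E] := @FTC_segment _ 0 (Y w) (fun y => 1 - expR (- (u * y))) g (Y0 w).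
  - by move=> z _; exact: is_derive_expRN.
  - by move=> z _; apply: cvgM; [exact: cvg_cst|exact: continuous_expRN].
  have mgY : measurable_fun `[0, Y w[ (EFin \o g).
    by apply/measurable_EFinP; exact: measurable_funTS.
  rewrite integral_itv_bndo_bndc// -[RHS]fineK; last exact: integrable_fin_num.
  congr EFin; move: E; rewrite /Rintegral => ->.
  by rewrite mulr0 oppr0 expR0 subrr subr0.
rewrite cake; congr fine.
have cakeE (z : R) : ((g z)%:E * \int[P]_(w in [set w | (z < Y w)%R]) (cst 1 w)%:E =
    (g z * fine (P [set w | (z < Y w)%R]))%:E)%E.
  rewrite -[X in (_ * X)%E]/(\int[P]_(w in _) cst 1%:E w)%E integral_cst; last exact: measurable_exceed.
  rewrite mul1e [RHS]EFinM fineK//; apply: fin_num_measure.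
  exact: measurable_exceed.
transitivity (\int[mu]_(z in `[0%R, +oo[)
    (g z * fine (P [set w | (z < Y w)%R]))%:E)%E.
  by apply: eq_integral => z _; exact: cakeE.
apply/esym/integral_itv_obnd_cbnd/measurable_EFinP.
apply: measurable_funM; first exact: measurable_funTS.
by apply: measurable_funTS; exact: (measurable_tail gamma).
Qed.

(** After division by [gamma^alpha] the tail is [z^(-alpha)] on [z > gamma] and at
    most [z^(-alpha)] below, so the integrals converge by domination to the Euler
    integral of [laplace_gamma]. *)
Lemma pareto_limit (gamma : nat -> R) (u : R) :
  (forall n, 0 < gamma n) -> gamma n @[n --> \oo] --> 0 -> 0 <= u ->
  gamma n `^ (- alpha) *
    (1 - \int[P]_w expR (- (u * (gamma n * expR (X w))))) @[n --> \oo] -->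
  u `^ alpha * Gamma (1 - alpha).
Proof.
move=> g0 cg; rewrite le_eqVlt => /predU1P[<-|u0].
  rewrite powR0 ?gt_eqF// mul0r; apply: cvg_near_cst; apply: nearW => n.
  under eq_Rintegral do rewrite mul0r oppr0 expR0.
  by rewrite Rintegral_probability_cst subrr mulr0.
under eq_fun do rewrite pareto_laplace//.
rewrite -laplace_gamma//.
have [i1 _ _] := laplace_kernel alpha_gt0 alpha_lt1 (ltW u0).
have mker : measurable_fun (`]0, +oo[ : set R)%classic (fun z => u * expR (- (u * z))).
  apply: measurable_funTS; apply: continuous_measurable_fun => z.
  by apply: cvgM; [exact: cvg_cst|exact: continuous_expRN].
pose f n z := u * expR (- (u * z)) * (gamma n `^ (- alpha) * tail (gamma n) z).
have mf n : measurable_fun (`]0, +oo[ : set R)%classic (f n).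
  apply: measurable_funM => //; apply: measurable_funM => //.
  by apply: measurable_funTS; exact: (measurable_tail (gamma n)).
have pos (x : R) : `]0, +oo[%classic x -> 0 < x by rewrite /= in_itv/= andbT.
have fle n z : 0 < z -> `|f n z| <= u * expR (- (u * z)) * z `^ (- alpha).
  move=> z0; have /andP[t0 t1] := tail01 (gamma n) z.
  rewrite !normrM (ger0_norm (ltW u0)) !ger0_norm ?expR_ge0 ?powR_ge0//.
  apply: ler_wpM2l; first by rewrite mulr_ge0 ?expR_ge0// ltW.
  have [zg|gz] := leP z (gamma n).
    apply: le_trans (ler_piMr (powR_ge0 _ _) t1) _.
    rewrite !powRN lef_pV2 ?posrE ?powR_gt0// ge0_ler_powR ?nnegrE// ltW//.
  rewrite /tail pareto_tail//= mulrA powR_shift// addNr powRr0 mul1r.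
  exact: lexx.
have fcvg z : 0 < z -> f n z @[n --> \oo] --> u * expR (- (u * z)) * z `^ (- alpha).
  move=> z0; apply: cvg_near_cst; near=> n.
  have gz : gamma n < z by near: n; exact: (cvgr_lt _ cg).
  by rewrite /f /tail pareto_tail//= [X in _ * X]mulrA powR_shift// addNr powRr0 mul1r.
have fE n : gamma n `^ (- alpha) * \int[mu]_(z in `]0, +oo[)
      (u * expR (- (u * z)) * fine (P [set w | z < gamma n * expR (X w)])) =
    \int[mu]_(z in `]0, +oo[) f n z.
  rewrite -RintegralZl//; last first.
    have i2 : mu.-integrable `]0, +oo[ (EFin \o f n).
      apply: (@integrable_dominated _ _ R mu _ _ _ _ _ i1) => //; first exact: mf.
      by move=> z /pos; exact: fle.
    have := @integrable_mulr _ _ R mu _ (measurable_itv _) (gamma n `^ alpha) _ i2.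
    congr (integrable _ _ _); apply/funext => z; congr EFin; rewrite /f /tail.
    have : gamma n `^ alpha * gamma n `^ (- alpha) = 1.
      by rewrite powR_shift// subrr powRr0.
    set a := gamma n `^ alpha; set b := gamma n `^ (- alpha) => ab.
    rewrite -[RHS]mul1r -ab; ring.
  by apply: eq_Rintegral => z _; rewrite /f mulrCA.
rewrite (_ : (fun n => _) = (fun n => \int[mu]_(z in `]0, +oo[) f n z)); last first.
  by apply/funext => n; exact: fE.
apply: (@cvg_Rintegral_dominated _ _ R mu `]0, +oo[%classic _ _
  (fun z => u * expR (- (u * z)) * z `^ (- alpha))) => //.
- by apply: measurable_funM => //; apply: measurable_funTS; exact: measurable_powR.
- by move=> z /pos; exact: fcvg.
- by move=> n z /pos; exact: fle.
Unshelve. all: by end_near. Qed.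

End pareto.

Section compound_poisson.
Context {d} {T : measurableType d} {R : realType} (P : probability T R).

Lemma ae_eq_Rintegral (f g : T -> R) : measurable_fun setT f ->
  measurable_fun setT g -> {ae P, forall w, f w = g w} ->
  \int[P]_w f w = \int[P]_w g w.
Proof.
move=> mf mg fg; rewrite /Rintegral; congr fine.
apply: ae_eq_integral => //; [exact/measurable_EFinP..|].
by apply: filterS fg => w + _ => ->.
Qed.

Lemma ae_eq_probability (A B : set T) : measurable A -> measurable B ->
  {ae P, forall w, A w <-> B w} -> P A = P B.
Proof.
move=> mA mB AB.
rewrite -[in LHS](setIT A) -[in RHS](setIT B) -!integral_indic//.
apply: ae_eq_integral => //.
- by apply/measurable_EFinP; exact: measurable_indic.
- by apply/measurable_EFinP; exact: measurable_indic.
- apply: filterS AB => w AB _; congr EFin; rewrite !indicE; congr (_ %:R).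
  by congr nat_of_bool; apply/idP/idP; rewrite !inE => /AB.
Qed.

Lemma integrable_01 (f : T -> R) : measurable_fun setT f ->
  (forall w, 0 <= f w <= 1) -> P.-integrable setT (EFin \o f).
Proof.
move=> mf f01; apply: (integrable_dominated (g := fun=> 1)) => //.
  exact: finite_measure_integrable_cst.
by move=> w _; have /andP[? ?] := f01 w; rewrite ger0_norm.
Qed.

Variables (N : {RV P >-> nat}) (mean : R) (Y : nat -> T -> R) (M : R).
Hypothesis mean_gt0 : 0 < mean.
Hypothesis N_poisson : forall i, P [set w | N w = i] = (poisson_pmf mean i)%:E.
Hypothesis mY : forall j, measurable_fun setT (Y j).
Hypothesis Y01 : forall j w, 0 <= Y j w <= 1.
Hypothesis EY : forall j, \int[P]_w Y j w = M.
Hypothesis indY : forall i : nat, mutually_independent P (fun k : option nat =>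
  g_sigma_algebra_preimage
    (if k is Some j then Y j else (\1_[set w | N w = i] : T -> R))).

Let measurable_level i : measurable [set w | N w = i].
Proof.
have -> : [set w | N w = i] = N @^-1` [set i] by apply/seteqP; split.
by rewrite -[X in measurable X]setTI; exact: measurable_funP.
Qed.

(** On the event [N = i] the product has [i + 1] factors, independent of each other
    and of that event. *)
Lemma integral_poisson_level i :
  (\int[P]_(w in [set w | N w = i]) (\prod_(0 <= j < (N w).+1) Y j w)%:E =
   (poisson_pmf mean i * M ^+ i.+1)%:E)%E.
Proof.
pose Z (k : option nat) := if k is Some j then Y j else (\1_[set w | N w = i] : T -> R).
have mZ k : measurable_fun setT (Z k).
  by case: k => [j|] //=; exact: measurable_indic.
have Z01 k w : 0 <= Z k w <= 1.
  by case: k => [j|] //=; rewrite indicE ler0n lern1; case: (_ \in _).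
pose J := None :: map Some (index_iota 0 i.+1).
have uJ : uniq J.
  rewrite /J cons_uniq map_inj_uniq; last by move=> ? ? [].
  rewrite /index_iota iota_uniq andbT.
  by elim: (iota _ _) => //= a s; rewrite inE.
have := integral_prod_independent mZ Z01 (@indY i) uJ.
rewrite {2}/J big_cons big_map.
under [X in _ = _ * X -> _]eq_bigr do rewrite /= EY.
rewrite prodr_const_nat subn0 => E.
have -> : (\int[P]_(w in [set w | N w = i]) (\prod_(0 <= j < (N w).+1) Y j w)%:E =
    \int[P]_w (\prod_(k <- J) Z k w)%:E)%E.
  rewrite -[[set w | _]]setTI -integral_mul_indic; apply: eq_integral => w _.
  congr EFin; rewrite /J big_cons big_map /= indicE mulrC.
  have [/set_mem <-//|_] := boolP (w \in [set w | N w = i]).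
  by rewrite !mul0r.
rewrite -[LHS]fineK; last first.
  apply: integrable_fin_num => //; apply: integrable_01.
    exact: measurable_prod.
  move=> w; rewrite prodr_ge0//= => [|k _]; last by case/andP: (Z01 k w).
  by apply: Num.Theory.prodr_ile1 => k _.
congr EFin; rewrite -[LHS]/(\int[P]_w (\prod_(k <- J) Z k w)) E; congr (_ * _).
rewrite /Rintegral /=.
have -> : (\int[P]_w (\1_[set w | N w = i] w)%:E = P [set w | N w = i])%E.
  by rewrite integral_indic// setIT.
by rewrite N_poisson.
Qed.

(** The generating function of the Poisson law, evaluated at the common mean
    of the factors. *)
Lemma compound_poisson_mean :
  \int[P]_w (\prod_(0 <= j < (N w).+1) Y j w) = M * expR (- (mean * (1 - M))).
Proof.
have Y01' n w : 0 <= \prod_(0 <= j < n) Y j w <= 1.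
  rewrite prodr_ge0//= => [|j _]; last by case/andP: (Y01 j w).
  by apply: Num.Theory.prodr_ile1 => j _.
have TE : [set: T] = \bigcup_i [set w | N w = i].
  by apply/seteqP; split => // w _; exists (N w).
have mf : measurable_fun setT (fun w => (\prod_(0 <= j < (N w).+1) Y j w)).
  move=> _ B mB; rewrite setTI.
  have -> : (fun w => \prod_(0 <= j < (N w).+1) Y j w) @^-1` B =
    \bigcup_n ([set w | N w = n] `&`
               (fun w => \prod_(0 <= j < n.+1) Y j w) @^-1` B).
    by apply/seteqP; split => [w Bw|w [n _ [/= <-]] //]; exists (N w).
  apply: bigcup_measurable => n _; apply: measurableI => //.
  rewrite -[X in measurable X]setTI.
  suff : measurable_fun [set: T] (fun w => \prod_(0 <= j < n.+1) Y j w) by apply.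
  exact: measurable_prod.
rewrite /Rintegral TE ge0_integral_bigcup//=; last 3 first.
- by rewrite -TE; apply/measurable_EFinP.
- by move=> w _; rewrite lee_fin; case/andP: (Y01' (N w).+1 w).
- apply/trivIsetP => i j _ _ /eqP ij; apply/seteqP; split => // w [/= Ni Nj].
  by apply: ij; rewrite -Ni -Nj.
under eq_eseriesr do rewrite integral_poisson_level.
under eq_eseriesr => i _.
  rewrite /poisson_pmf mean_gt0.
  rewrite (_ : _ * _ * _ * _ = (M * expR (- mean)) * ((mean * M) ^+ i / i`!%:R)); last first.
    by rewrite exprS exprMn; field; rewrite pnatr_eq0 -lt0n fact_gt0.
  over.
have -> : expR (- (mean * (1 - M))) = expR (- mean) * expR (mean * M).
  by rewrite -expRD; congr expR; ring.
rewrite mulrA; set c := M * expR (- mean); set x := mean * M.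
have c1 : c * series (exp_coeff x) n @[n --> \oo] --> c * expR x.
  by apply: cvgM; [exact: cvg_cst|exact: is_cvg_series_exp_coeff].
rewrite -[RHS]/(fine (c * expR x)%:E); congr fine.
apply/cvg_lim => //.
rewrite (_ : (fun n => _) = (fun n => (c * series (exp_coeff x) n)%:E)).
  by apply/cvg_EFin; [exact: nearW|exact: c1].
apply/funext => n; rewrite sumEFin; congr EFin.
by rewrite /series/= big_distrr.
Qed.

End compound_poisson.

Section compound_sum.
Context {d} {T : measurableType d} {R : realType} (P : probability T R).
Variables (lambda alpha p q : R).
Hypotheses (lambda_gt0 : 0 < lambda) (alpha_gt0 : 0 < alpha) (alpha_lt1 : alpha < 1).
Hypotheses (p_ge0 : 0 <= p) (q_ge0 : 0 <= q) (pq1 : p + q = 1).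
Variables (N : R -> {RV P >-> nat}) (X eps : nat -> {RV P >-> R}).
Hypothesis N_poisson : poisson_process lambda N.
Hypothesis X_exp : forall j (B : set R), measurable B ->
  distribution P (X j) B = exponential_prob alpha B.
Hypothesis eps_pos : forall j, P [set w | eps j w = 1] = p%:E.
Hypothesis eps_neg : forall j, P [set w | eps j w = -1] = q%:E.
Hypothesis indep : mutually_independent P (driving_sigma N X eps).

Lemma measurable_preimage (Z : {RV P >-> R}) (B : set R) : measurable B ->
  measurable (Z @^-1` B).
Proof. by move=> mB; rewrite -[X in measurable X]setTI; exact: measurable_funP. Qed.

Lemma poisson_level (s : R) i : 0 < s ->
  P [set w | N s w = i] = (poisson_pmf (lambda * s) i)%:E.
Proof.
move=> s0; have mN t n : measurable [set w | N t w = n].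
  have -> : [set w | N t w = n] = N t @^-1` [set n] by apply/seteqP; split.
  by rewrite -[X in measurable X]setTI; exact: measurable_funP.
have := poisson_incr N_poisson (lexx 0) s0 [set i].
rewrite /poisson_prob subr0 mulr_gt0// esum_set1; last first.
  by rewrite lee_fin poisson_pmf_ge0.
move=> <-; apply: ae_eq_probability => //.
- have -> : [set w | [set i] (N s w - N 0 w)%N] =
      \bigcup_n ([set w | N 0 w = n] `&` \bigcup_(k in [set k | (k - n)%N = i])
         [set w | N s w = k]).
    apply/seteqP; split => [w /= Nw|w [n _ [/= <- [k /= kn Nk]]]]; last by rewrite Nk.
    by exists (N 0 w) => //; split => //; exists (N s w).
  apply: bigcupT_measurable => n; apply: measurableI => //.
  by apply: bigcup_measurable => k _.
- by apply: filterS (poisson_start N_poisson) => w /= ->; rewrite subn0.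
Qed.

(** The contribution of the [j]-th jump to [exp(- u A_+ - v A_-)]; as the sign is
    almost surely [1] or [-1], one of the two positive parts vanishes and the
    other is [1]. *)
Definition jump_factor (u v gamma : R) (j : nat) (w : T) : R :=
  expR (- ((u * Num.max (eps j w) 0 + v * Num.max (- eps j w) 0) *
           (gamma * expR (X j w)))).

Lemma jump_factor01 u v gamma j w : 0 <= u -> 0 <= v -> 0 <= gamma ->
  0 <= jump_factor u v gamma j w <= 1.
Proof.
move=> u0 v0 g0; rewrite expR_ge0/= expR_le1 oppr_le0.
by rewrite mulr_ge0 ?addr_ge0 ?mulr_ge0 ?expR_ge0 ?le_max ?lexx ?orbT.
Qed.

Let jump_fun (u v gamma : R) (z : R * R) : R :=
  expR (- ((u * Num.max z.1 0 + v * Num.max (- z.1) 0) * (gamma * expR z.2))).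

Let measurable_jump_fun u v gamma : measurable_fun setT (jump_fun u v gamma).
Proof.
apply: measurableT_comp => //; apply: measurableT_comp => //.
apply: measurable_funM.
  apply: measurable_funD; apply: measurable_funM => //.
    by apply: measurable_maxr => //; exact: measurable_fst.
  by apply: measurable_maxr => //; apply: measurableT_comp => //; exact: measurable_fst.
by apply: measurable_funM => //; apply: measurableT_comp => //; exact: measurable_snd.
Qed.

Lemma measurable_jump_factor u v gamma j :
  measurable_fun setT (jump_factor u v gamma j).
Proof.
have mpair : measurable_fun setT (fun w => (eps j w, X j w)).
  exact: measurable_fun_pair.
exact: measurableT_comp (measurable_jump_fun u v gamma) mpair.
Qed.

Let exponential_law j (f : R -> R) : measurable_fun setT f -> (forall x, 0 <= f x) ->
  \int[P]_w f (X j w) = \int[P]_w f (X 0%N w).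
Proof.
move=> mf f0; have H k : (\int[P]_w (f (X k w))%:E =
    \int[distribution P (X k)]_y (f y)%:E)%E.
  by rewrite ge0_integral_distribution//; exact/measurable_EFinP.
rewrite /Rintegral !H; congr fine; apply: eq_measure_integral => A mA _.
exact: etrans (X_exp j mA) (esym (X_exp 0%N mA)).
Qed.

Let sign_weight j (a c : R) (f : R -> R) : P [set w | eps j w = a] = c%:E ->
  measurable_fun setT f -> (forall x, 0 <= f x <= 1) -> 0 <= c ->
  \int[P]_w (f (X j w) * \1_[set w | eps j w = a] w) = c * \int[P]_w f (X 0%N w).
Proof.
move=> Pa mf f01 c0.
have f0 x : 0 <= f x by case/andP: (f01 x).
have ma : measurable [set w | eps j w = a].
  have -> : [set w | eps j w = a] = eps j @^-1` [set a] by apply/seteqP; split.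
  exact: measurable_preimage.
have mfX : measurable_fun setT (fun w => f (X j w)) by exact: measurableT_comp.
have mI : measurable_fun setT (\1_[set w | eps j w = a] : T -> R).
  exact: measurable_indic.
have H (B : set R) : measurable B ->
    (\int[P]_(w in (fun w => f (X j w)) @^-1` B) (\1_[set w | eps j w = a] w)%:E =
     c%:E * P ((fun w => f (X j w)) @^-1` B))%E.
  move=> mB.
  have mfB : measurable (f @^-1` B) by rewrite -[X in measurable X]setTI; exact: mf.
  have mXB : measurable (X j @^-1` (f @^-1` B)) by exact: measurable_preimage.
  rewrite integral_indic//.
  pose A (k : (unit + nat + nat)%type) : set T :=
    if k is inr _ then [set w | eps j w = a] else X j @^-1` (f @^-1` B).
  have E : P (\bigcap_(k in [set` [:: inl (inr j); inr j]]) A k) =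
      (\prod_(k <- [:: inl (inr j); inr j]) P (A k))%E.
    apply: indep => // k; rewrite !inE => /orP[]/eqP->.
    - by exists (f @^-1` B) => //; rewrite setTI.
    - by exists [set a] => //; rewrite setTI; apply/seteqP; split.
  move: E; rewrite bigcap_seq !big_cons !big_nil setIT mule1 /= => E.
  rewrite setIC; apply: etrans E _.
  by rewrite muleC; congr (_ * _)%E; exact: Pa.
have I0 w : 0 <= \1_[set w | eps j w = a] w :> R by rewrite indicE.
have E := integral_weight_prod (P := P) mfX mI (fun w => f0 _) I0 c0 H.
rewrite -(exponential_law j mf f0) /Rintegral E fineM//.
by apply: integrable_fin_num => //; apply: integrable_01.
Qed.

(** Conditioning on the sign [eps j], which is independent of [X j]. *)
Lemma jump_factor_mean u v gamma j : 0 <= u -> 0 <= v -> 0 < gamma ->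
  \int[P]_w jump_factor u v gamma j w =
  p * \int[P]_w expR (- (u * (gamma * expR (X 0%N w)))) +
  q * \int[P]_w expR (- (v * (gamma * expR (X 0%N w)))).
Proof.
move=> u0 v0 g0.
have mE c : measurable_fun (setT : set R) (fun x => expR (- (c * (gamma * expR x)))).
  apply: measurableT_comp => //; apply: measurableT_comp => //.
  by apply: measurable_funM => //; apply: measurable_funM.
have E01 c x : 0 <= c -> 0 <= expR (- (c * (gamma * expR x))) <= 1.
  move=> c0; rewrite expR_ge0/= expR_le1 oppr_le0.
  by rewrite !mulr_ge0 ?expR_ge0// ltW.
have ma a : measurable [set w | eps j w = a].
  have -> : [set w | eps j w = a] = eps j @^-1` [set a] by apply/seteqP; split.
  exact: measurable_preimage.
have mg c a : measurable_fun setT (fun w =>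
    expR (- (c * (gamma * expR (X j w)))) * \1_[set w | eps j w = a] w : R).
  apply: measurable_funM; last exact: measurable_indic.
  exact: (measurableT_comp (mE c)).
have ig c a : 0 <= c -> P.-integrable setT (EFin \o (fun w =>
    expR (- (c * (gamma * expR (X j w)))) * \1_[set w | eps j w = a] w : R)).
  move=> c0; apply: integrable_01 => // w.
  have /andP[h0 h1] := E01 c (X j w) c0.
  by rewrite indicE; case: (_ \in _); rewrite ?mulr1 ?mulr0 ?h0// lexx ler01.
rewrite -(sign_weight (eps_pos j) (mE u) (fun x => E01 u x u0) p_ge0).
rewrite -(sign_weight (eps_neg j) (mE v) (fun x => E01 v x v0) q_ge0).
rewrite -RintegralD//; [|exact: ig..].
apply: ae_eq_Rintegral.
- exact: measurable_jump_factor.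
- by apply: measurable_funD; exact: mg.
exists (~` ([set w | eps j w = 1] `|` [set w | eps j w = -1])); split.
- by apply: measurableC; exact: measurableU.
- rewrite probability_setC; last exact: measurableU.
  rewrite measureU//; last first.
    by apply/seteqP; split => // w [/= ->]; lra.
  rewrite -[X in (_ - X)%E]/(_ + _)%E.
  transitivity (1 - (p%:E + q%:E))%E; first by congr (_ - (_ + _))%E; [exact: eps_pos|exact: eps_neg].
  by rewrite -EFinD pq1 subrr.
- move=> w; apply: contra_not => -[] /= epsw; rewrite /jump_factor epsw !indicE.
  + rewrite mem_set// memNset/=; last by rewrite epsw; lra.
    rewrite mulr1 mulr0 addr0 (max_idPl _) ?ler01// (max_idPr _) ?lerN10//.
    by rewrite mulr1 mulr0 addr0.
  + rewrite memNset/=; last by rewrite epsw; lra.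
    rewrite mem_set// mulr1 mulr0 add0r opprK (max_idPr _) ?lerN10//.
    by rewrite (max_idPl _) ?ler01// mulr1 mulr0 add0r.
Qed.

(** The driving random variables are regrouped in blocks: [X j] and [eps j] for the
    [j]-th jump, and the Poisson process alone for [None]. *)
Lemma jump_factor_independent (u v gamma s : R) (i : nat) : 0 <= s ->
  mutually_independent P (fun k : option nat => g_sigma_algebra_preimage
    (if k is Some j then jump_factor u v gamma j
     else (\1_[set w | N s w = i] : T -> R))).
Proof.
move=> s0.
pose Y (k : option nat) : T -> R :=
  if k is Some j then eps j : T -> R else \1_[set w | N s w = i].
pose Z (k : option nat) : T -> R :=
  if k is Some j then X j : T -> R else \1_[set w | N s w = i].
pose F (k : option nat) : R * R -> R :=
  if k is Some _ then jump_fun u v gamma else fst.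
have -> : (fun k : option nat => g_sigma_algebra_preimage
    (if k is Some j then jump_factor u v gamma j
     else (\1_[set w | N s w = i] : T -> R))) =
    (fun k => g_sigma_algebra_preimage (fun w => F k (Y k w, Z k w))).
  by apply/funext => -[j|].
have mNi : measurable [set w | N s w = i].
  have -> : [set w | N s w = i] = N s @^-1` [set i] by apply/seteqP; split.
  by rewrite -[X in measurable X]setTI; exact: measurable_funP.
apply: mutually_independent_pairs.
- by case=> [j|] /=; [exact: measurable_funP|exact: measurable_indic].
- by case=> [j|] /=; [exact: measurable_funP|exact: measurable_indic].
- by case=> [j|] /=; [exact: measurable_jump_fun|exact: measurable_fst].
pose D (k : option nat) : seq (unit + nat + nat)%type :=
  if k is Some j then [:: inl (inr j); inr j] else [:: inl (inl tt)].
pose pi (k : (unit + nat + nat)%type) : option nat :=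
  match k with inl (inl _) => None | inl (inr j) => Some j | inr j => Some j end.
apply: (mutually_independent_sub (G := block_events (driving_sigma N X eps) D)); last first.
  apply: (mutually_independent_blocks (pi := pi)) => //.
  - by case.
  - by case=> [j|] k; rewrite !inE; [move=> /orP[]/eqP->|move=> /eqP->].
case=> [j|] _ [B [C [mB mC ->]]].
- exists (fun k => if k is inr _ then eps j @^-1` B else X j @^-1` C).
    move=> k; rewrite !inE => /orP[]/eqP->.
      by exists C => //; rewrite setTI.
    by exists B => //; rewrite setTI.
  by rewrite bigcap_seq !big_cons big_nil setIT setIC.
- pose I : nat -> R := fun n => (n == i)%:R.
  exists (fun=> (fun w => I (N s w)) @^-1` (B `&` C)).
    move=> k; rewrite !inE => /eqP->; apply: sub_sigma_algebra.
    exists s => //=; exists (I @^-1` (B `&` C)) => //; by rewrite setTI.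
  rewrite bigcap_seq big_cons big_nil setIT preimage_setI.
  have IE w : I (N s w) = \1_[set w | N s w = i] w :> R.
    rewrite indicE /I; congr (_ %:R); congr nat_of_bool.
    by apply/eqP/idP; rewrite inE.
  by congr (_ `&` _); apply/seteqP; split => w /=; rewrite IE.
Qed.

End compound_sum.

(** * Convergence of the compound sums *)

Section subordinator.
Context {d} {T : measurableType d} {R : realType} (P : probability T R).
Variables (alpha : R) (H : R -> {RV P >-> R}).
Hypothesis H_stable : stable_subordinator alpha H.

(** The process starts at [0] almost surely and its paths do not decrease. *)
Lemma subordinator_ge0 t : 0 <= t -> {ae P, forall w, 0 <= H t w}.
Proof.
move=> t0; have := levy_start (stable_levy H_stable).
have := stable_path H_stable; apply: filterS2 => w ndH H0.
by rewrite -H0; apply: ndH.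
Qed.

Lemma measurable_pospart t : measurable_fun setT (fun w => Num.max (H t w) 0).
Proof. exact: measurable_maxr. Qed.

(** Replacing [H t] by its positive part, equal to it almost surely, keeps all
    exponentials in the unit interval everywhere. *)
Lemma subordinator_laplace t u : 0 <= t -> 0 <= u ->
  \int[P]_w expR (- (u * Num.max (H t w) 0)) = expR (- (t * u `^ alpha)).
Proof.
move=> t0 u0; have := stable_laplace H_stable t0 u0.
rewrite unlock => /(congr1 fine)/=; rewrite mulNr => <-.
apply: ae_eq_Rintegral.
- apply: measurableT_comp => //; apply: measurableT_comp => //.
  by apply: measurable_funM => //; exact: measurable_pospart.
- by apply: measurableT_comp => //; exact: measurable_funM.
- apply: filterS (subordinator_ge0 t0) => w Hw.
  by rewrite (max_idPl _)// mulNr.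
Qed.

End subordinator.

Section random_sum_moments.
Context {d} {T : measurableType d} {R : realType} (P : probability T R).
Variables (lambda alpha p q : R).
Hypotheses (lambda_gt0 : 0 < lambda) (alpha_gt0 : 0 < alpha) (alpha_lt1 : alpha < 1).
Hypotheses (p_ge0 : 0 <= p) (q_ge0 : 0 <= q) (pq1 : p + q = 1).
Variables (N : R -> {RV P >-> nat}) (X eps : nat -> {RV P >-> R}).
Hypothesis N_poisson : poisson_process lambda N.
Hypothesis X_exp : forall j (B : set R), measurable B ->
  distribution P (X j) B = exponential_prob alpha B.
Hypothesis eps_pos : forall j, P [set w | eps j w = 1] = p%:E.
Hypothesis eps_neg : forall j, P [set w | eps j w = -1] = q%:E.
Hypothesis indep : mutually_independent P (driving_sigma N X eps).

Let measurable_pos j : measurable_fun setT (fun w => Num.max (eps j w) 0).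
Proof. exact: measurable_maxr. Qed.

Let measurable_neg j : measurable_fun setT (fun w => Num.max (- eps j w) 0).
Proof. by apply: measurable_maxr => //; exact: measurableT_comp. Qed.

Let eps_p j : {RV P >-> R} := mfun_Sub (mem_set (measurable_pos j)).
Let eps_n j : {RV P >-> R} := mfun_Sub (mem_set (measurable_neg j)).

Definition positive_sum gamma s : {RV P >-> R} := random_sumRV N X eps_p gamma s.
Definition negative_sum gamma s : {RV P >-> R} := random_sumRV N X eps_n gamma s.

Lemma random_sumE gamma s w :
  random_sum N X eps gamma s w = positive_sum gamma s w - negative_sum gamma s w.
Proof.
rewrite /positive_sum /negative_sum /= /random_sum -sumrB.
apply: eq_bigr => j _ /=; rewrite -!mulrBl; congr (_ * _ * _).
by case: (leP (eps j w) 0) => e0; case: (leP (- eps j w) 0) => e1; lra.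
Qed.

Lemma positive_sum_ge0 gamma s w : 0 <= gamma -> 0 <= positive_sum gamma s w.
Proof.
move=> g0; apply: sumr_ge0 => j _ /=.
by rewrite !mulr_ge0 ?expR_ge0// le_max lexx orbT.
Qed.

Lemma negative_sum_ge0 gamma s w : 0 <= gamma -> 0 <= negative_sum gamma s w.
Proof.
move=> g0; apply: sumr_ge0 => j _ /=.
by rewrite !mulr_ge0 ?expR_ge0// le_max lexx orbT.
Qed.

Let laplace_jump gamma (u : R) := \int[P]_w expR (- (u * (gamma * expR (X 0%N w)))).

(** The general compound Poisson formula, applied to the jump factors. *)
Lemma random_sum_moment gamma s (m k : nat) : 0 < gamma -> 0 < s ->
  let M := p * laplace_jump gamma m%:R + q * laplace_jump gamma k%:R in
  \int[P]_w (expR (- positive_sum gamma s w) ^+ m *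
             expR (- negative_sum gamma s w) ^+ k) =
  M * expR (- (lambda * s * (1 - M))).
Proof.
move=> g0 s0 M.
rewrite -(@compound_poisson_mean _ _ _ P (N s) (lambda * s)
  (jump_factor X eps m%:R k%:R gamma) M).
- apply: eq_Rintegral => w _; rewrite -!expRM_natl -expRD /jump_factor -expR_sum.
  congr expR; rewrite /positive_sum /negative_sum /= /random_sum !mulrN -opprD.
  rewrite sumrN !mulr_sumr -big_split/=; congr (- _); apply: eq_bigr => j _ /=.
  ring.
- by rewrite mulr_gt0.
- by move=> i; exact: poisson_level.
- by move=> j; exact: measurable_jump_factor.
- by move=> j w; apply: jump_factor01 => //; exact: ltW.
- by move=> j; apply: (jump_factor_mean _ _ _ X_exp eps_pos eps_neg indep).
- by move=> i; apply: jump_factor_independent => //; exact: ltW.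
Qed.

(** Each factor [1 - M] is of order [gamma^alpha], which the time scale
    [t / gamma^alpha] compensates. *)
Lemma random_sum_moment_limit (gamma : nat -> R) (t : R) (m k : nat) :
  (forall n, 0 < gamma n) -> gamma n @[n --> \oo] --> 0 -> 0 < t ->
  \int[P]_w (expR (- positive_sum (gamma n) (t / gamma n `^ alpha) w) ^+ m *
             expR (- negative_sum (gamma n) (t / gamma n `^ alpha) w) ^+ k)
    @[n --> \oo] -->
  expR (- (p * (lambda * Gamma (1 - alpha) * t) * m%:R `^ alpha)) *
  expR (- (q * (lambda * Gamma (1 - alpha) * t) * k%:R `^ alpha)).
Proof.
move=> g0 cg t0.
pose M n := p * laplace_jump (gamma n) m%:R + q * laplace_jump (gamma n) k%:R.
have s0 n : 0 < t / gamma n `^ alpha by rewrite divr_gt0// powR_gt0.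
rewrite (_ : (fun n => _) = (fun n => M n *
  expR (- (lambda * (t / gamma n `^ alpha) * (1 - M n))))); last first.
  by apply/funext => n; exact: random_sum_moment.
have lim (l : nat) : gamma n `^ (- alpha) * (1 - laplace_jump (gamma n) l%:R)
    @[n --> \oo] --> l%:R `^ alpha * Gamma (1 - alpha).
  by apply: (pareto_limit alpha_gt0 alpha_lt1 (X_exp 0)).
have gE n : (gamma n `^ alpha)^-1 = gamma n `^ (- alpha) by rewrite powRN.
have c1 : gamma n `^ (- alpha) * (1 - M n) @[n --> \oo] -->
    p * (m%:R `^ alpha * Gamma (1 - alpha)) + q * (k%:R `^ alpha * Gamma (1 - alpha)).
  rewrite (_ : (fun n => _) = (fun n =>
    p * (gamma n `^ (- alpha) * (1 - laplace_jump (gamma n) m%:R)) +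
    q * (gamma n `^ (- alpha) * (1 - laplace_jump (gamma n) k%:R)))).
    by apply: cvgD; apply: cvgM; [exact: cvg_cst|exact: lim|exact: cvg_cst|exact: lim].
  by apply/funext => n; rewrite /M -{1}pq1; ring.
have cga : gamma n `^ alpha @[n --> \oo] --> (0 : R).
  by have /cvg_at_rightP := powR_cvg0 alpha_gt0; apply.
have cM : M n @[n --> \oo] --> (1 : R).
  have c2 : 1 - gamma n `^ alpha * (gamma n `^ (- alpha) * (1 - M n))
      @[n --> \oo] --> 1 - 0 * (p * (m%:R `^ alpha * Gamma (1 - alpha)) +
                              q * (k%:R `^ alpha * Gamma (1 - alpha))).
    by apply: cvgB; [exact: cvg_cst|exact: cvgM].
  move: c2; rewrite mul0r subr0.
  apply: cvg_trans; apply: near_eq_cvg; apply: nearW => n /=.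
  have : gamma n `^ alpha * gamma n `^ (- alpha) = 1 by rewrite powR_shift// subrr powRr0.
  move=> E; change (1 - gamma n `^ alpha * (gamma n `^ (- alpha) * (1 - M n)) = M n).
  by rewrite mulrA E; ring.
have -> : expR (- (p * (lambda * Gamma (1 - alpha) * t) * m%:R `^ alpha)) *
    expR (- (q * (lambda * Gamma (1 - alpha) * t) * k%:R `^ alpha)) =
  1 * expR (- ((lambda * t) * (p * (m%:R `^ alpha * Gamma (1 - alpha)) +
    q * (k%:R `^ alpha * Gamma (1 - alpha))))).
  by rewrite -expRD mul1r; congr expR; ring.
apply: cvgM => //.
rewrite (_ : (fun n => _) = (fun n => expR (- ((lambda * t) *
  (gamma n `^ (- alpha) * (1 - M n)))))); last first.
  by apply/funext => n; rewrite gE; congr expR; ring.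
apply: continuous_cvg; first exact: continuous_expR.
by apply: cvgN; apply: cvgM; [exact: cvg_cst|exact: c1].
Qed.

End random_sum_moments.

Section independent_processes.
Context {d} {T : measurableType d} {R : realType} (P : probability T R).
Variables (H1 H2 : R -> {RV P >-> R}).
Hypothesis H12_indep : mutually_independent P
  (fun b : bool => process_sigma (if b then H1 else H2)).

Lemma process_sigma_preimage (H : R -> {RV P >-> R}) t (f : R -> R) : 0 <= t ->
  measurable_fun setT f ->
  g_sigma_algebra_preimage (fun w => f (H t w)) `<=` process_sigma H.
Proof.
move=> t0 mf _ [B mB <-]; apply: sub_sigma_algebra; exists t => //=.
by exists (f @^-1` B) => //; rewrite -[X in measurable X]setTI; exact: mf.
Qed.

Let integral_independent_01 t1 t2 (f g : R -> R) : 0 <= t1 -> 0 <= t2 ->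
  measurable_fun setT f -> measurable_fun setT g ->
  (forall x, 0 <= f x <= 1) -> (forall x, 0 <= g x <= 1) ->
  \int[P]_w (f (H1 t1 w) * g (H2 t2 w)) =
  (\int[P]_w f (H1 t1 w)) * (\int[P]_w g (H2 t2 w)).
Proof.
move=> t10 t20 mf mg f01 g01.
pose Y (b : bool) : T -> R := if b then fun w => f (H1 t1 w) else fun w => g (H2 t2 w).
have mY b : measurable_fun setT (Y b) by case: b; exact: measurableT_comp.
have Y01 b w : 0 <= Y b w <= 1 by case: b; [exact: f01|exact: g01].
have iY : mutually_independent P (fun b => g_sigma_algebra_preimage (Y b)).
  apply: (mutually_independent_sub _ H12_indep).
  by case; exact: process_sigma_preimage.
have := integral_prod_independent mY Y01 iY (_ : uniq [:: true; false]).
move=> /(_ isT); rewrite !big_cons big_nil mulr1 /= => <-.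
by apply: eq_Rintegral => w _; rewrite !big_cons big_nil mulr1.
Qed.

(** The product rule for values in the unit interval extends to values between
    [-1] and [1] by affine rescaling. *)
Lemma integral_independent t1 t2 (f g : R -> R) : 0 <= t1 -> 0 <= t2 ->
  measurable_fun setT f -> measurable_fun setT g ->
  (forall x, `|f x| <= 1) -> (forall x, `|g x| <= 1) ->
  \int[P]_w (f (H1 t1 w) * g (H2 t2 w)) =
  (\int[P]_w f (H1 t1 w)) * (\int[P]_w g (H2 t2 w)).
Proof.
move=> t10 t20 mf mg f1 g1.
pose f' x := (f x + 1) / 2; pose g' x := (g x + 1) / 2.
have mf' : measurable_fun setT f' by apply: measurable_funM => //; exact: measurable_funD.
have mg' : measurable_fun setT g' by apply: measurable_funM => //; exact: measurable_funD.
have f'01 x : 0 <= f' x <= 1.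
  by have := f1 x; rewrite ler_norml /f' => /andP[? ?]; apply/andP; split; lra.
have g'01 x : 0 <= g' x <= 1.
  by have := g1 x; rewrite ler_norml /g' => /andP[? ?]; apply/andP; split; lra.
have E := integral_independent_01 t10 t20 mf' mg' f'01 g'01.
have if1 : P.-integrable setT (EFin \o (fun w => f' (H1 t1 w))).
  by apply: integrable_01 => // ; exact: measurableT_comp.
have ig1 : P.-integrable setT (EFin \o (fun w => g' (H2 t2 w))).
  by apply: integrable_01 => // ; exact: measurableT_comp.
have ifg : P.-integrable setT (EFin \o (fun w => f' (H1 t1 w) * g' (H2 t2 w))).
  apply: integrable_01 => [|w].
    by apply: measurable_funM; exact: measurableT_comp.
  have /andP[? ?] := f'01 (H1 t1 w); have /andP[? ?] := g'01 (H2 t2 w).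
  by rewrite mulr_ge0//= mulr_ile1.
have i1 : P.-integrable setT (EFin \o (fun=> 1 : R)) by exact: finite_measure_integrable_cst.
have affineE (h : T -> R) : P.-integrable setT (EFin \o h) ->
    \int[P]_w (2 * h w - 1) = 2 * (\int[P]_w h w) - 1.
  move=> ih; rewrite RintegralB//; last exact: integrable_mulr.
  by rewrite RintegralZl// Rintegral_probability_cst.
have -> : \int[P]_w f (H1 t1 w) = 2 * (\int[P]_w f' (H1 t1 w)) - 1.
  by rewrite -affineE//; apply: eq_Rintegral => w _; rewrite /f'; field.
have -> : \int[P]_w g (H2 t2 w) = 2 * (\int[P]_w g' (H2 t2 w)) - 1.
  by rewrite -affineE//; apply: eq_Rintegral => w _; rewrite /g'; field.
have -> : \int[P]_w (f (H1 t1 w) * g (H2 t2 w)) =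
    \int[P]_w ((4 * (f' (H1 t1 w) * g' (H2 t2 w)) - 2 * f' (H1 t1 w)) -
               (2 * g' (H2 t2 w) - 1)).
  by apply: eq_Rintegral => w _; rewrite /f' /g'; field.
have i4 := integrable_mulr measurableT 4 ifg.
have i2f := integrable_mulr measurableT 2 if1.
have i2g := integrable_mulr measurableT 2 ig1.
rewrite RintegralB//; [|exact: integrable_subr i4 i2f|exact: integrable_subr i2g i1].
rewrite RintegralB// (affineE (fun w => g' (H2 t2 w)))// !RintegralZl// E; ring.
Qed.

End independent_processes.

Section convergence.
Context {R : realType} (lambda alpha p q : R).
Hypotheses (lambda_gt0 : 0 < lambda) (alpha_gt0 : 0 < alpha) (alpha_lt1 : alpha < 1).
Hypotheses (p_ge0 : 0 <= p) (q_ge0 : 0 <= q) (pq1 : p + q = 1).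
Context {d} {T : measurableType d} (P : probability T R).
Variables (N : R -> {RV P >-> nat}) (X eps : nat -> {RV P >-> R}).
Hypothesis N_poisson : poisson_process lambda N.
Hypothesis X_exp : forall j (B : set R), measurable B ->
  distribution P (X j) B = exponential_prob alpha B.
Hypothesis eps_pos : forall j, P [set w | eps j w = 1] = p%:E.
Hypothesis eps_neg : forall j, P [set w | eps j w = -1] = q%:E.
Hypothesis indep : mutually_independent P (driving_sigma N X eps).
Context {d'} {T' : measurableType d'} (P' : probability T' R).
Variables (H1 H2 : R -> {RV P' >-> R}).
Hypothesis H1_stable : stable_subordinator alpha H1.
Hypothesis H2_stable : stable_subordinator alpha H2.
Hypothesis H12_indep : mutually_independent P'
  (fun b : bool => process_sigma (if b then H1 else H2)).

Lemma expectation_bounded {d0} {T0 : measurableType d0} (P0 : probability T0 R)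
    (f : T0 -> R) C : measurable_fun setT f -> (forall w, `|f w| <= C) ->
  P0.-integrable setT (EFin \o f) /\ ('E_P0[f] = (\int[P0]_w f w)%:E)%E.
Proof.
move=> mf fC; have i1 : P0.-integrable setT (EFin \o f).
  apply: (integrable_dominated (g := fun=> C)) => //.
  exact: finite_measure_integrable_cst.
by split => //; rewrite unlock /Rintegral fineK//; exact: integrable_fin_num.
Qed.

(** The moment method for [(exp(- A_+), exp(- A_-))]: moments are Laplace
    transforms at integers, and they converge by [random_sum_moment_limit]. *)
Lemma random_sum_cvg (t : R) (Y : {RV P' >-> R}) : 0 < t ->
  (forall w, Y w = H1 (p * (lambda * Gamma (1 - alpha) * t)) w -
                   H2 (q * (lambda * Gamma (1 - alpha) * t)) w) ->
  cvg_in_distribution (0 : R)^'+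
    (fun gamma => random_sumRV N X eps gamma (t / gamma `^ alpha)) Y.
Proof.
move=> t0 YE h ch [C hC].
have mh : measurable_fun setT h by exact: continuous_measurable_fun.
pose A gamma := random_sumRV N X eps gamma (t / gamma `^ alpha).
have mhA gamma : measurable_fun setT (h \o A gamma) by exact: measurableT_comp.
have mhY : measurable_fun setT (h \o Y) by exact: measurableT_comp.
have EA gamma := (expectation_bounded P (mhA gamma) (fun w => hC (A gamma w))).2.
have EY := (expectation_bounded P' mhY (fun w => hC (Y w))).2.
rewrite EY (_ : (fun gamma => _) = (fun gamma => (\int[P]_w (h \o A gamma) w)%:E)); last first.
  by apply/funext => gamma; exact: EA.
apply/cvg_EFin; first exact: nearW.
apply/cvg_at_rightP => gamma [g0 cg]; rewrite /comp.
set t1 := p * _ in YE; set t2 := q * _ in YE.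
have G0 := Gamma_gt0 alpha_gt0 alpha_lt1.
have t10 : 0 <= t1 by rewrite !mulr_ge0// ltW.
have t20 : 0 <= t2 by rewrite !mulr_ge0// ltW.
pose U n w := expR (- positive_sum N X eps (gamma n) (t / gamma n `^ alpha) w).
pose V n w := expR (- negative_sum N X eps (gamma n) (t / gamma n `^ alpha) w).
pose U' w := expR (- Num.max (H1 t1 w) 0).
pose V' w := expR (- Num.max (H2 t2 w) 0).
have mU n : measurable_fun setT (U n) by do 2 apply: measurableT_comp => //.
have mV n : measurable_fun setT (V n) by do 2 apply: measurableT_comp => //.
have mU' : measurable_fun setT U'.
  by do 2 apply: measurableT_comp => //; exact: measurable_maxr.
have mV' : measurable_fun setT V'.
  by do 2 apply: measurableT_comp => //; exact: measurable_maxr.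
have e01 (x : R) : 0 <= x -> 0 <= expR (- x) <= 1.
  by move=> x0; rewrite expR_ge0/= expR_le1 oppr_le0.
have UV n w : setT w -> unit_square (U n w, V n w).
  by move=> _; split; apply: e01; [apply: positive_sum_ge0|apply: negative_sum_ge0];
    exact: ltW.
have UV' w : setT w -> unit_square (U' w, V' w).
  by move=> _; split; apply: e01; rewrite le_max lexx orbT.
(* [h (A_+ - A_-) = g (exp (- A_+), exp (- A_-))] *)
pose g (z : R * R) := h (ln z.2 - ln z.1).
have mg : measurable_fun setT g.
  by apply: measurableT_comp => //; apply: measurable_funB; apply: measurableT_comp.
have i1 : P.-integrable setT (EFin \o (fun=> 1 : R)) by exact: finite_measure_integrable_cst.
have i1' : P'.-integrable setT (EFin \o (fun=> 1 : R)) by exact: finite_measure_integrable_cst.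
have := @moment_method R (fun n h => \int[P]_w (1 * h (U n w, V n w)))
  (fun h => \int[P']_w (1 * h (U' w, V' w))) _ _ _ g.
have -> : \int[P']_w h (Y w) = \int[P']_w (1 * g (U' w, V' w)).
  apply: ae_eq_Rintegral => //.
  - apply: measurable_funM => //; apply: (measurableT_comp mg).
    exact: measurable_fun_pair.
  - have h1 := subordinator_ge0 H1_stable t10.
    have h2 := subordinator_ge0 H2_stable t20.
    apply: filterS2 h1 h2 => w h1 h2.
    rewrite mul1r /g /U' /V' /= !expRK (max_idPl h1) (max_idPl h2) YE.
    by congr h; ring.
rewrite (_ : (fun n => \int[P]_w h (A (gamma n) w)) =
    (fun n => \int[P]_w (1 * g (U n w, V n w)))); last first.
  apply/funext => n; apply: eq_Rintegral => w _.
  rewrite mul1r -[RHS]/(h (ln (V n w) - ln (U n w))) /U /V !expRK.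
  rewrite -[LHS]/(h (random_sum N X eps (gamma n) (t / gamma n `^ alpha) w)).
  by rewrite random_sumE; congr h; rewrite opprK addrC.
apply.
- by move=> n; apply: weighted_mean => // w; exact: UV.
- by apply: weighted_mean => // w; exact: UV'.
- move=> i j; rewrite /monomial/=.
  under eq_fun do under eq_Rintegral do rewrite mul1r.
  under eq_Rintegral do rewrite mul1r /U' /V' -!expRM_natl !mulrN.
  rewrite (integral_independent H12_indep (f := fun x => expR (- (i%:R * Num.max x 0)))
    (g := fun x => expR (- (j%:R * Num.max x 0)))) //; last 4 first.
  + by do 2 apply: measurableT_comp => //; apply: measurable_funM => //; exact: measurable_maxr.
  + by do 2 apply: measurableT_comp => //; apply: measurable_funM => //; exact: measurable_maxr.
  + move=> x; rewrite ger0_norm ?expR_ge0// expR_le1 oppr_le0.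
    by rewrite mulr_ge0// le_max lexx orbT.
  + move=> x; rewrite ger0_norm ?expR_ge0// expR_le1 oppr_le0.
    by rewrite mulr_ge0// le_max lexx orbT.
  rewrite (subordinator_laplace H1_stable)// (subordinator_laplace H2_stable)//.
  exact: (random_sum_moment_limit lambda_gt0 alpha_gt0 alpha_lt1 p_ge0 q_ge0 pq1
    N_poisson X_exp eps_pos eps_neg indep).
- apply: (weighted_mean_cutoff (w := fun=> 1)) => // w _.
  by split; exact: expR_gt0.
- by split => //; exists C => z _; exact: hC.
- move=> z sz z1 z2; apply: cvg_within_filter.
  apply: (@cvg_comp _ _ _ (fun w : R * R => ln w.2 - ln w.1) h _
    (nbhs (ln z.2 - ln z.1))); last exact: ch.
  apply: cvgB.
  + apply: (@cvg_comp _ _ _ (fun w : R * R => w.2) (@ln R) _ (nbhs z.2)).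
      exact: cvg_snd.
    exact: continuous_ln.
  + apply: (@cvg_comp _ _ _ (fun w : R * R => w.1) (@ln R) _ (nbhs z.1)).
      exact: cvg_fst.
    exact: continuous_ln.
Qed.

End convergence.

(** * The limit is a Lévy process *)

Section difference_levy.
Context {d} {T : measurableType d} {R : realType} (P : probability T R).
Variables (H1 H2 : R -> {RV P >-> R}).
Hypothesis H1_levy : levy_process H1.
Hypothesis H2_levy : levy_process H2.
Hypothesis H12_indep : mutually_independent P
  (fun b : bool => process_sigma (if b then H1 else H2)).

Let S (b : bool) := g_sigma_algebraType
  (\bigcup_(t in [set t : R | 0 <= t])
     g_sigma_algebra_preimage ((if b then H1 else H2) t)).

Let measurable_process b t : 0 <= t ->
  measurable_fun setT ((if b then H1 else H2) t : S b -> R).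
Proof.
move=> t0 _ B mB; rewrite setTI; apply: sub_sigma_algebra; exists t => //=.
by exists B => //; rewrite setTI.
Qed.

Let measurable_increment b s t : 0 <= s -> 0 <= t ->
  measurable_fun setT
    ((fun w => (if b then H1 else H2) t w - (if b then H1 else H2) s w) : S b -> R).
Proof. by move=> s0 t0; apply: measurable_funB; exact: measurable_process. Qed.

Lemma independent_processesI (A B : set T) :
  process_sigma H1 A -> process_sigma H2 B -> P (A `&` B) = (P A * P B)%E.
Proof.
move=> mA mB.
have := H12_indep (J := [:: true; false]) (B := fun b => if b then A else B) isT.
rewrite bigcap_seq !big_cons !big_nil setIT mule1 /=; apply.
by move=> b; case: b.
Qed.

Variables (c1 c2 : R) (Y : R -> {RV P >-> R}).
Hypotheses (c10 : 0 <= c1) (c20 : 0 <= c2).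
Hypothesis YE : forall t w, Y t w = H1 (c1 * t) w - H2 (c2 * t) w.

Let D1 s t w := H1 (c1 * t) w - H1 (c1 * s) w.
Let D2 s t w := H2 (c2 * t) w - H2 (c2 * s) w.

Let mD1 s t : measurable_fun setT (D1 s t). Proof. exact: measurable_funB. Qed.
Let mD2 s t : measurable_fun setT (D2 s t). Proof. exact: measurable_funB. Qed.

Let diff (z : R * R) : R := z.1 - z.2.

Let measurable_diff : measurable_fun setT diff.
Proof. by apply: measurable_funB; [exact: measurable_fst|exact: measurable_snd]. Qed.

Let incrementE s t : (fun w => Y t w - Y s w) = (fun w => diff (D1 s t w, D2 s t w)).
Proof. by apply/funext => w; rewrite !YE /diff/= /D1 /D2; ring. Qed.

Let sigma_D1 s t (B : set R) : 0 <= s -> 0 <= t -> measurable B ->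
  process_sigma H1 (D1 s t @^-1` B).
Proof.
move=> s0 t0 mB; have := @measurable_increment true (c1 * s) (c1 * t).
move=> /(_ (mulr_ge0 c10 s0) (mulr_ge0 c10 t0) measurableT _ mB).
by rewrite setTI.
Qed.

Let sigma_D2 s t (B : set R) : 0 <= s -> 0 <= t -> measurable B ->
  process_sigma H2 (D2 s t @^-1` B).
Proof.
move=> s0 t0 mB; have := @measurable_increment false (c2 * s) (c2 * t).
move=> /(_ (mulr_ge0 c20 s0) (mulr_ge0 c20 t0) measurableT _ mB).
by rewrite setTI.
Qed.

Let sigma_bigcap (b : bool) (J : seq nat) (A : nat -> set T) :
  (forall i, process_sigma (if b then H1 else H2) (A i)) ->
  process_sigma (if b then H1 else H2) (\bigcap_(i in [set` J]) A i).
Proof.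
move=> mA; rewrite bigcap_seq.
suff : measurable (\big[setI/setT]_(i <- J) A i : set (S b)) by [].
by apply: bigsetI_measurable => i _; exact: mA.
Qed.

(** An increment of [Y] is a function of the pair of increments of [H1] and [H2]
    over a rescaled interval; rectangles in these pairs factor first between
    the two processes, and then between the intervals. *)
Lemma difference_independent_increments : independent_increments P Y.
Proof.
move=> t t0 ndt.
have tn0 n : 0 <= t n by apply: le_trans t0 _; exact: ndt.
rewrite (_ : (fun i => _) = (fun i => g_sigma_algebra_preimage
    (fun w => diff (D1 (t i) (t i.+1) w, D2 (t i) (t i.+1) w)))); last first.
  by apply/funext => i; rewrite -incrementE.
apply: (@mutually_independent_pairs _ _ _ P nat (fun i => D1 (t i) (t i.+1))
  (fun i => D2 (t i) (t i.+1)) (fun=> diff)) => // J A uJ HA.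
have /choice[BC HBC] : forall i, exists BC : set R * set R, 
    [/\ measurable BC.1, measurable BC.2 & i \in J ->
      A i = D1 (t i) (t i.+1) @^-1` BC.1 `&` D2 (t i) (t i.+1) @^-1` BC.2].
  move=> i; have [iJ|niJ] := boolP (i \in J); last first.
    by exists (setT, setT); split => //= iJ; rewrite iJ in niJ.
  by have [B [C [mB mC ->]]] := HA _ iJ; exists (B, C); split => //=.
pose A1 i := D1 (t i) (t i.+1) @^-1` (BC i).1.
pose A2 i := D2 (t i) (t i.+1) @^-1` (BC i).2.
have sA1 i : process_sigma H1 (A1 i) by apply: sigma_D1 => //; have [] := HBC i.
have sA2 i : process_sigma H2 (A2 i) by apply: sigma_D2 => //; have [] := HBC i.
have AE i : i \in J -> A i = A1 i `&` A2 i by have [_ _] := HBC i.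
have -> : \bigcap_(i in [set` J]) A i =
    \bigcap_(i in [set` J]) A1 i `&` \bigcap_(i in [set` J]) A2 i.
  by rewrite -bigcapI; apply: eq_bigcapr => i /= iJ; exact: AE.
rewrite independent_processesI; last 2 first.
- exact: (@sigma_bigcap true).
- exact: (@sigma_bigcap false).
have -> : (\prod_(i <- J) P (A i) = \prod_(i <- J) (P (A1 i) * P (A2 i)))%E.
  by apply: eq_big_seq => i iJ; rewrite AE// independent_processesI.
rewrite big_split/=; congr (_ * _)%E.
- have := levy_indep H1_levy (t := fun n => c1 * t n).
  move=> /(_ (mulr_ge0 c10 t0) _ J A1 uJ); apply.
    by move=> m n mn; rewrite ler_wpM2l// ndt.
  by move=> i _; exists (BC i).1; [by have [] := HBC i|rewrite setTI].
- have := levy_indep H2_levy (t := fun n => c2 * t n).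
  move=> /(_ (mulr_ge0 c20 t0) _ J A2 uJ); apply.
    by move=> m n mn; rewrite ler_wpM2l// ndt.
  by move=> i _; exists (BC i).2; [by have [] := HBC i|rewrite setTI].
Qed.

(** The pair of increments has the law of the pair of values, since the
    components are independent and each is stationary. *)
Lemma difference_stationary_increments : stationary_increments P Y.
Proof.
move=> s t s0 st B mB; have t0 := le_trans s0 st.
have ts0 : 0 <= t - s by rewrite subr_ge0.
transitivity (P ((fun w => diff (D1 s t w, D2 s t w)) @^-1` B)).
  by rewrite -incrementE.
transitivity (P ((fun w => diff (H1 (c1 * (t - s)) w, H2 (c2 * (t - s)) w)) @^-1` B)).
  apply: eq_pair_law => // C C' mC mC'.
  rewrite !independent_processesI; last 4 first.
  - by have := @measurable_process true (c1 * (t - s));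
      move=> /(_ (mulr_ge0 c10 ts0) measurableT _ mC); rewrite setTI.
  - by have := @measurable_process false (c2 * (t - s));
      move=> /(_ (mulr_ge0 c20 ts0) measurableT _ mC'); rewrite setTI.
  - exact: sigma_D1.
  - exact: sigma_D2.
  congr (_ * _)%E; rewrite mulrBr.
  - apply: (levy_stat H1_levy) => //; first exact: mulr_ge0.
    by rewrite ler_wpM2l.
  - apply: (levy_stat H2_levy) => //; first exact: mulr_ge0.
    by rewrite ler_wpM2l.
by congr (P _); apply/seteqP; split => w /=; rewrite YE.
Qed.

Let cadlag_scale (x : R -> R) (c : R) : 0 <= c -> cadlag x ->
  cadlag (fun t => x (c * t)).
Proof.
rewrite le_eqVlt => /predU1P[<- _|c0 [rx lx]].
  split => [t t0|t t0]; under eq_fun do rewrite mul0r.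
    by rewrite mul0r; exact: cvg_cst.
  exact: is_cvg_cst.
split => t t0.
- apply/cvg_at_rightP => u [ut cu].
  have /cvg_at_rightP := rx (c * t) (mulr_ge0 (ltW c0) t0); apply; split.
    by move=> n; rewrite ltr_pM2l.
  by apply: cvgM => //; exact: cvg_cst.
- have /cvg_ex[l cl] := lx (c * t) (mulr_gt0 c0 t0); apply/cvg_ex; exists l.
  apply/cvg_at_leftP => u [ut cu].
  have /cvg_at_leftP := cl; apply; split.
    by move=> n; rewrite ltr_pM2l.
  by apply: cvgM => //; exact: cvg_cst.
Qed.

Theorem difference_levy : levy_process Y.
Proof.
split.
- have h1 := levy_start H1_levy; have h2 := levy_start H2_levy.
  apply: filterS2 h1 h2 => w h1 h2.
  by rewrite YE !mulr0 h1 h2 subrr.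
- exact: difference_independent_increments.
- exact: difference_stationary_increments.
- have h1 := levy_path H1_levy; have h2 := levy_path H2_levy.
  apply: filterS2 h1 h2 => w /(cadlag_scale c10)[r1 l1] /(cadlag_scale c20)[r2 l2].
  have -> : Y ^~ w = (fun t => H1 (c1 * t) w - H2 (c2 * t) w).
    by apply/funext => t; rewrite YE.
  split => t t0; first exact: cvgB (r1 _ t0) (r2 _ t0).
  by apply: is_cvgB; [exact: l1|exact: l2].
Qed.

End difference_levy.

(** * The Fourier symbol *)

Section taylor.
Context {R : realType}.

Lemma is_derive_quotient (f : R -> R) (a l : R) (u : nat -> R) :
  is_derive a 1 f l -> (forall n, u n != 0) -> u n @[n --> \oo] --> 0 ->
  (u n)^-1 * (f (u n + a) - f a) @[n --> \oo] --> l.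
Proof.
move=> [df <-] u0 cu.
have : h^-1 *: ((f \o shift a) (h *: 1) - f a) @[h --> 0^'] --> 'D_1 f a by exact: df.
move=> /cvgr_dnbhsP/(_ u (conj u0 cu)); apply: cvg_trans.
by apply: near_eq_cvg; apply: nearW => n /=; rewrite /GRing.scale/= mulr1.
Qed.

Lemma taylor2_bound (f f' f'' : R -> R) (K : R) :
  (forall x : R, is_derive x 1 f (f' x)) ->
  (forall x : R, is_derive x 1 f' (f'' x)) ->
  f 0 = 0 -> f' 0 = 0 -> (forall x : R, 0 <= x -> `|f'' x| <= K) ->
  forall y : R, 0 <= y -> `|f y| <= K * y ^+ 2.
Proof.
move=> df df' f0 f'0 f''K.
have cont (g dg : R -> R) : (forall x : R, is_derive x 1 g (dg x)) -> continuous g.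
  move=> dg' x; apply: differentiable_continuous; apply/derivable1_diffP.
  by have /@ex_derive := dg' x.
have step (g dg : R -> R) (L y : R) : (forall x : R, is_derive x 1 g (dg x)) ->
    g 0 = 0 -> 0 <= y -> (forall x : R, 0 <= x <= y -> `|dg x| <= L) -> `|g y| <= L * y.
  move=> dgx g0 y0 dgL.
  have h1 x : x \in `]0, y[%R -> is_derive x 1 g (dg x) by move=> _; exact: dgx.
  have h2 : {within `[0, y], continuous g} by exact/continuous_subspaceT/(cont _ _ dgx).
  have [c] := MVT_segment y0 h1 h2.
  rewrite in_itv/= => c0y; rewrite g0 !subr0 => ->.
  by rewrite normrM (ger0_norm y0) ler_wpM2r// dgL.
have K0 : 0 <= K by apply: le_trans (f''K 0 (lexx _)).
move=> y y0; rewrite expr2 mulrA.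
apply: (step f f') => // x /andP[x0 xy].
apply: (@le_trans _ _ (K * x)); last by rewrite ler_wpM2l.
by apply: (step f' f'') => // z /andP[z0 _]; exact: f''K.
Qed.

End taylor.

Section subordinator_symbol.
Context {d} {T : measurableType d} {R : realType} (P : probability T R).
Notation mu := (@lebesgue_measure R).
Variables (alpha : R) (H : R -> {RV P >-> R}).
Hypotheses (alpha_gt0 : 0 < alpha) (alpha_lt1 : alpha < 1).
Hypothesis H_stable : stable_subordinator alpha H.

Definition levy_integral (G : R -> R) :=
  \int[mu]_(y in `]0, +oo[) (G y * y `^ (- alpha - 1)).

Lemma integrable_levy (G : R -> R) C : measurable_fun setT G ->
  (forall y : R, 0 < y -> `|G y| <= C * Num.min 1 y) ->
  mu.-integrable `]0, +oo[ (fun y => (G y * y `^ (- alpha - 1))%:E).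
Proof.
move=> mG GC.
have iW := @integrable_mulr _ _ R mu _ (measurable_itv _) C _
  (integrable_jump_weight alpha_gt0 alpha_lt1).
apply: (@integrable_dominated _ _ R mu _ _ _ _ _ iW) => //.
  by apply: measurable_funM; apply: measurable_funTS => //; exact: measurable_powR.
move=> y /=; rewrite in_itv/= andbT => y0.
rewrite normrM (ger0_norm (powR_ge0 _ _)) /jump_weight mulrA.
by rewrite ler_wpM2r ?powR_ge0// GC.
Qed.

Let Hp s w := Num.max (H s w) 0.
Let U s w := expR (- Hp s w).

Let mHp s : measurable_fun setT (Hp s). Proof. exact: measurable_maxr. Qed.

Let mU s : measurable_fun setT (U s).
Proof. by do 2 apply: measurableT_comp => //. Qed.

Let Hp0 s w : 0 <= Hp s w. Proof. by rewrite le_max lexx orbT. Qed.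

Let expN01 (x : R) : 0 <= x -> 0 <= expR (- x) <= 1.
Proof. by move=> x0; rewrite expR_ge0/= expR_le1 oppr_le0. Qed.

Let cvg_exp_quotient (s : nat -> R) a : (forall n, 0 < s n) -> s n @[n --> \oo] --> 0 ->
  (s n)^-1 * (1 - expR (- (s n * a))) @[n --> \oo] --> a.
Proof.
move=> s0 cs.
have da := is_derive_expRN a 0.
have := is_derive_quotient da (fun n => lt0r_neq0 (s0 n)) cs.
rewrite !mulr0 oppr0 expR0 mulr1 subrr; apply: cvg_trans.
apply: near_eq_cvg; apply: nearW => n /=.
by rewrite addr0 subr0 [a * _]mulrC.
Qed.

Let levy_exp (i : R) : 0 <= i ->
  levy_integral (fun y => 1 - expR (- (i * y))) =
  alpha^-1 * (i `^ alpha * Gamma (1 - alpha)).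
Proof. by move=> i0; exact: levy_laplace. Qed.

Let G0 := Gamma_gt0 alpha_gt0 alpha_lt1.

(** The derivative at [0] of [1 - exp(- s u^alpha)], rewritten over the jumps. *)
Lemma laplace_small_time (s : nat -> R) (u : R) : (forall n, 0 < s n) ->
  s n @[n --> \oo] --> 0 -> 0 <= u ->
  (s n)^-1 * (1 - \int[P]_w expR (- (u * Hp (s n) w))) @[n --> \oo] -->
  alpha / Gamma (1 - alpha) * levy_integral (fun y => 1 - expR (- (u * y))).
Proof.
move=> s0 cs u0; rewrite levy_exp//.
rewrite (_ : _ / _ * _ = u `^ alpha); last first.
  by field; rewrite !gt_eqF.
apply: cvg_trans (@cvg_exp_quotient s (u `^ alpha) s0 cs).
apply: near_eq_cvg; apply: nearW => n.
by rewrite /= (subordinator_laplace H_stable)// ltW.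
Qed.

(** [s^-1 P(H_s \in dy)] converges to the jump measure
    [alpha / Gamma(1 - alpha) y^(-alpha-1) dy] away from [0]; against functions
    that are [O(y^2)] there is no contribution from [0]. The measures
    [s^-1 (1 - exp(-y)) P(H_s \in dy)] are finite, with computable moments in
    [exp(-y)]. *)
Lemma subordinator_small_time (s : nat -> R) (G : R -> R) C :
  (forall n, 0 < s n) -> s n @[n --> \oo] --> 0 -> continuous G ->
  (forall y : R, 0 <= y -> `|G y| <= C * Num.min 1 (y ^+ 2)) ->
  (s n)^-1 * \int[P]_w G (Num.max (H (s n) w) 0) @[n --> \oo] -->
  alpha / Gamma (1 - alpha) * levy_integral G.
Proof.
move=> s0 cs cG GC.
set kappa := alpha / Gamma (1 - alpha).
have kappa0 : 0 <= kappa by rewrite divr_ge0 ?ltW.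
have C0 : 0 <= C.
  have := GC 1 ler01; rewrite expr1n minxx mulr1; apply: le_trans; exact: normr_ge0.
have G00 : G 0 = 0.
  have := GC 0 (lexx _); rewrite expr0n/= (min_idPr ler01) mulr0.
  by rewrite normr_le0 => /eqP.
have mG : measurable_fun setT G by exact: continuous_measurable_fun.
(* a power rather than an inverse, for measurability *)
pose h (z : R * R) := G (- ln z.1) * (1 - z.1) `^ (-1).
have hE (z : R * R) : unit_square z -> h z = G (- ln z.1) / (1 - z.1).
  by move=> [/andP[_ z1] _]; rewrite /h powR_inv1// subr_ge0.
have hC (z : R * R) : unit_square z -> `|h z| <= 2 * C * - ln z.1 /\ `|h z| <= 2 * C.
  move=> /[dup] sz [/andP[z0 z1] _].
  rewrite hE//; move: z0; rewrite le_eqVlt => /predU1P[<-|z0].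
    by rewrite ln0// oppr0 G00 mul0r normr0 mulr0 lexx mulr_ge0.
  have l0 : ln z.1 <= 0 by rewrite -ln1 ler_ln ?posrE.
  set y := - ln z.1; have y0 : 0 <= y by rewrite oppr_ge0.
  have zE : z.1 = expR (- y) by rewrite opprK lnK.
  have := GC y y0; rewrite -/y zE.
  have [h1 h2 h3 h4] := expR_bounds y0.
  move: y0; rewrite le_eqVlt => /predU1P[y0|y0].
    by move=> _; rewrite -y0 G00 mul0r normr0 !mulr0 lexx mulr_ge0.
  have e1 := expR_ge1Dx y; have e2 : expR y * expR (- y) = 1 by rewrite -expRD subrr expR0.
  have e3 := expR_gt0 (- y).
  have d0 : 0 < 1 - expR (- y) by nra.
  have d1 : y <= (1 - expR (- y)) * (1 + y) by nra.
  rewrite normrM normfV (gtr0_norm d0) !ler_pdivrMr//.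
  set a := `|G y|; set e := expR (- y) in d0 d1 *.
  case: (leP 1 (y ^+ 2)) => y1 aC.
    have ? : 1 <= y by rewrite -(ler_sqr) ?nnegrE ?expr1n// ltW.
    have ? : 1 / 2 <= 1 - e by nra.
    have ? : C <= 2 * C * (1 - e) by nra.
    split; first by nra.
    by nra.
  have ? : y < 1.
    by rewrite ltNge; apply/negP => y2; move: y1; rewrite ltNge -(expr1n R 2) ler_sqr ?nnegrE// ?y2// ltW.
  have ? : y <= 2 * (1 - e) by nra.
  have ? : C * y <= C * (2 * (1 - e)) by rewrite ler_wpM2l.
  have h5 : y * (C * y) <= y * (C * (2 * (1 - e))) by rewrite ler_wpM2l// ltW.
  have h6 : y * (C * y) <= 1 * (C * y).
    by apply: ler_wpM2r; [exact: mulr_ge0 C0 (ltW y0)|exact: ltW].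
  have h7 : C * y ^+ 2 = y * (C * y) by ring.
  by rewrite h7 in aC; split; lra.
have mh : measurable_fun setT h.
  apply: measurable_funM.
    apply: measurableT_comp => //; apply: measurableT_comp => //.
    by apply: measurableT_comp => //; exact: measurable_fst.
  apply: (measurableT_comp (measurable_powR _)).
  by apply: measurable_funB => //; exact: measurable_fst.
have bh : square_bounded h.
  by split => //; exists (2 * C) => z /hC[].
have w0 n w : setT w -> 0 <= (s n)^-1 * (1 - U (s n) w).
  move=> _; have /andP[? ?] := expN01 (Hp0 (s n) w).
  by rewrite mulr_ge0 ?invr_ge0 ?subr_ge0// ltW.
have iU n : P.-integrable setT (EFin \o U (s n)).
  by apply: integrable_01 => // w; exact: expN01.
have i1 : P.-integrable setT (EFin \o (fun=> 1 : R)) by exact: finite_measure_integrable_cst.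
have iw n : P.-integrable setT (EFin \o (fun w => (s n)^-1 * (1 - U (s n) w))).
  by apply: integrable_mulr => //; exact: integrable_subr.
have sqU n w : setT w -> unit_square (U (s n) w, (fun=> 1) w).
  by move=> _; split; [exact: expN01|rewrite /= ler01 lexx].
pose V (y : R) := expR (- y).
have pos (x : R) : `]0, +oo[%classic x -> 0 < x by rewrite /= in_itv/= andbT.
have mV : measurable_fun (setT : set R) V.
  by apply: measurableT_comp => //; apply: measurableT_comp.
pose wl y := kappa * ((1 - V y) * y `^ (- alpha - 1)).
have iwl : mu.-integrable `]0, +oo[ (EFin \o wl).
  have [_ i2 _] := laplace_kernel alpha_gt0 alpha_lt1 ler01.
  have := @integrable_mulr _ _ R mu _ (measurable_itv _) kappa
    (fun y => (1 - expR (- (1 * y))) * y `^ (- alpha - 1)) i2.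
  by congr (integrable _ _ _); apply/funext => y; rewrite /wl /V /= mul1r.
have wl0 y : `]0, +oo[%classic y -> 0 <= wl y.
  move=> /pos y0; have /andP[? ?] := expN01 (ltW y0).
  by apply: mulr_ge0 => //; apply: mulr_ge0; [rewrite subr_ge0|exact: powR_ge0].
have sqV y : `]0, +oo[%classic y -> unit_square (V y, (fun=> 1) y).
  by move=> /pos y0; split; [exact/expN01/ltW|rewrite /= ler01 lexx].
have := @moment_method R
  (fun n h => \int[P]_w ((s n)^-1 * (1 - U (s n) w) * h (U (s n) w, 1)))
  (fun h => \int[mu]_(y in `]0, +oo[) (wl y * h (V y, 1))) _ _ _ h.
have -> : \int[mu]_(y in `]0, +oo[) (wl y * h (V y, 1)) = kappa * levy_integral G.
  have iG : mu.-integrable `]0, +oo[ (EFin \o (fun y => G y * y `^ (- alpha - 1))).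
    apply: (integrable_levy (C := C)) => // y y0.
    apply: le_trans (GC y (ltW y0)) _; rewrite ler_wpM2l//.
    case: (leP 1 y) => y1; first by rewrite ge_min lexx.
    by rewrite ge_min expr2 ler_piMl ?orbT ?ltW.
  rewrite /levy_integral -[RHS](@RintegralZl _ _ R mu _ _ kappa (measurable_itv _) iG).
  apply: eq_Rintegral => y; rewrite inE => /[dup] Dy /pos y0.
  rewrite /wl hE /V /= ?expRK ?opprK; last exact: (sqV y Dy).
  have d0 : 1 - expR (- y) != 0.
    by rewrite subr_eq0 eq_sym lt_eqF// -expR0 ltr_expR oppr_lt0.
  by field.
rewrite (_ : (fun n => (s n)^-1 * _) = (fun n =>
    \int[P]_w ((s n)^-1 * (1 - U (s n) w) * h (U (s n) w, 1)))); last first.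
  apply/funext => n; rewrite -RintegralZl//; last first.
    have := (@expectation_bounded R _ _ P (fun w => G (Hp (s n) w)) C).
    move=> [||+ _] //; first exact: measurableT_comp.
    by move=> w; apply: le_trans (GC _ (Hp0 _ _)) _; rewrite ler_piMr// ge_min lexx.
  apply: eq_Rintegral => w _; rewrite hE /U /= ?expRK ?opprK; last exact: (sqU n w).
  rewrite -/(Hp (s n) w).
  have [->|Hw] := eqVneq (Hp (s n) w) 0; first by rewrite G00 mul0r !mulr0.
  have d0 : 1 - expR (- Hp (s n) w) != 0.
    by rewrite subr_eq0 eq_sym lt_eqF// -expR0 ltr_expR oppr_lt0 lt_neqAle eq_sym Hw Hp0.
  by field; rewrite d0 gt_eqF.
apply => //.
- move=> n; exact: (@weighted_mean _ _ _ P setT _ (U (s n)) (fun=> 1)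
    measurableT (iw n) (@w0 n) (mU (s n)) (measurable_cst _) (@sqU n)).
- exact: (@weighted_mean _ _ R mu `]0, +oo[%classic wl V (fun=> 1)
    (measurable_itv _) iwl wl0 mV (measurable_cst _) sqV).
- move=> i j.
  have E n : \int[P]_w ((s n)^-1 * (1 - U (s n) w) * monomial i j (U (s n) w, 1)) =
    (s n)^-1 * (1 - \int[P]_w expR (- (i.+1%:R * Hp (s n) w))) -
    (s n)^-1 * (1 - \int[P]_w expR (- (i%:R * Hp (s n) w))).
    have iX l : P.-integrable setT (EFin \o (fun w => expR (- (l%:R * Hp (s n) w)))).
      apply: integrable_01 => [|w]; last by apply: expN01; rewrite mulr_ge0.
      by do 2 apply: measurableT_comp => //; exact: measurable_funM.
    transitivity ((s n)^-1 * \int[P]_w (expR (- (i%:R * Hp (s n) w)) -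
                                      expR (- (i.+1%:R * Hp (s n) w)))).
      rewrite -RintegralZl//; last exact: integrable_subr.
      apply: eq_Rintegral => w _.
      by rewrite /monomial/= expr1n mulr1 -!mulrN !expRM_natl -/(U (s n) w) exprS; ring.
    by rewrite RintegralB//; ring.
  rewrite (_ : (fun n => _) = (fun n =>
    (s n)^-1 * (1 - \int[P]_w expR (- (i.+1%:R * Hp (s n) w))) -
    (s n)^-1 * (1 - \int[P]_w expR (- (i%:R * Hp (s n) w))))); last first.
    by apply/funext => n; exact: E.
  have -> : \int[mu]_(y in `]0, +oo[) (wl y * monomial i j (V y, 1)) =
    kappa * levy_integral (fun y => 1 - expR (- (i.+1%:R * y))) -
    kappa * levy_integral (fun y => 1 - expR (- (i%:R * y))).
    have iX l : mu.-integrable `]0, +oo[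
        (fun y => ((1 - expR (- (l%:R * y))) * y `^ (- alpha - 1))%:E).
      by have [] := laplace_kernel alpha_gt0 alpha_lt1 (ler0n _ l).
    rewrite -mulrBr /levy_integral -RintegralB//; [|exact: iX..].
    rewrite -RintegralZl//; last first.
      exact: (@integrable_subr _ _ R mu _ (measurable_itv _) _ _ (iX _) (iX _)).
    apply: eq_Rintegral => y _.
    by rewrite /wl /monomial/= expr1n mulr1 -!mulrN !expRM_natl -/(V y) exprS; ring.
  by apply: cvgB; exact: laplace_small_time.
- apply: (@weighted_mean_cutoff _ _ R mu `]0, +oo[%classic wl V (fun=> 1)
    (measurable_itv _) iwl wl0 mV (measurable_cst _) sqV).
  by move=> y _; split; [exact: expR_gt0|exact: ltr01].
- move=> z sz z0 _.
  have cfst (w : R * R) : v.1 @[v --> w] --> w.1 by exact: cvg_fst.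
  have cln : - ln w.1 @[w --> z] --> - ln z.1.
    apply: cvgN; apply: (@cvg_comp _ _ _ (fun w : R * R => w.1) (@ln R) _ (nbhs z.1)).
      exact: cfst.
    exact: continuous_ln.
  have [z1|z1] := eqVneq z.1 1; last first.
    apply: cvg_within_filter; apply: cvgM.
      apply: (@cvg_comp _ _ _ (fun w : R * R => - ln w.1) G _ (nbhs (- ln z.1))) => //.
      exact: cG.
    apply: (@cvg_comp _ _ _ (fun w : R * R => 1 - w.1) (@powR R ^~ (-1)) _ (nbhs (1 - z.1))).
      by apply: cvgB; [exact: cvg_cst|exact: cfst].
    apply: continuous_powR.
    by case: sz => /andP[_ z11] _; rewrite subr_gt0 lt_neqAle z1.
  have -> : h z = 0 by rewrite /h z1 ln1 oppr0 G00 mul0r.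
  apply/norm_cvg0P.
  apply: (@squeeze_cvgr _ _ _ _ (fun=> 0) (fun w => 2 * C * - ln w.1)).
  - rewrite near_withinE; near=> w => sw; rewrite normr_ge0/=.
    by have [] := hC _ sw.
  - exact: cvg_cst.
  - rewrite (_ : 0 = 2 * C * - ln z.1); last by rewrite z1 ln1 oppr0 mulr0.
    by apply: cvg_within_filter; apply: cvgM; [exact: cvg_cst|exact: cln].
Unshelve. all: by end_near. Qed.

End subordinator_symbol.

Section trigonometric.
Context {d} {T : measurableType d} {R : realType} (P : probability T R).
Notation mu := (@lebesgue_measure R).
Variables (alpha : R).
Hypotheses (alpha_gt0 : 0 < alpha) (alpha_lt1 : alpha < 1).

Lemma normr_sin_le1 (x : R) : `|sin x| <= 1.
Proof. by rewrite ler_norml sin_geN1 sin_le1. Qed.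

Lemma normr_cos_le1 (x : R) : `|cos x| <= 1.
Proof. by rewrite ler_norml cos_geN1 cos_le1. Qed.

Lemma is_derive_sinM (xi x : R) :
  is_derive x 1 (fun y => sin (xi * y)) (xi * cos (xi * x)).
Proof.
have d1 : is_derive x 1 (fun y : R => xi * y) xi.
  have := is_deriveZ xi (is_derive_id x 1).
  by move/is_derive_eq; apply; rewrite /GRing.scale/= mulr1.
have := @is_derive1_comp _ sin (fun y => xi * y) _ _ _ (is_derive_sin (xi * x)) d1.
by move/is_derive_eq; apply; rewrite mulrC.
Qed.

Lemma is_derive_cosM (xi x : R) :
  is_derive x 1 (fun y => cos (xi * y)) (- (xi * sin (xi * x))).
Proof.
have d1 : is_derive x 1 (fun y : R => xi * y) xi.
  have := is_deriveZ xi (is_derive_id x 1).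
  by move/is_derive_eq; apply; rewrite /GRing.scale/= mulr1.
have := @is_derive1_comp _ cos (fun y => xi * y) _ _ _ (is_derive_cos (xi * x)) d1.
by move/is_derive_eq; apply; rewrite mulrC mulrN.
Qed.

Lemma continuous_cosM (xi : R) : continuous (fun y : R => cos (xi * y)).
Proof.
move=> y; apply: continuous_comp; last exact: continuous_cos.
by apply: cvgM; [exact: cvg_cst|exact: cvg_id].
Qed.

Lemma continuous_sinM (xi : R) : continuous (fun y : R => sin (xi * y)).
Proof.
move=> y; apply: continuous_comp; last exact: continuous_sin.
by apply: cvgM; [exact: cvg_cst|exact: cvg_id].
Qed.

Definition cos_levy (xi : R) := levy_integral alpha (fun y => 1 - cos (xi * y)).
Definition sin_levy (xi : R) := levy_integral alpha (fun y => sin (xi * y)).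

Lemma min_sqr_bound (A K y a : R) : a <= A -> a <= K * y ^+ 2 -> 0 <= A -> 0 <= K ->
  a <= (A + K) * Num.min 1 (y ^+ 2).
Proof.
move=> aA aK A0 K0; have y2 := sqr_ge0 y.
by case: (leP 1 (y ^+ 2)) => h; nra.
Qed.

(** Second order vanishing at [0], as required by [subordinator_small_time]. *)
Lemma cos_levy_bound (xi y : R) : 0 <= y ->
  `|1 - cos (xi * y)| <= (2 + xi ^+ 2) * Num.min 1 (y ^+ 2).
Proof.
move=> y0; apply: min_sqr_bound => //.
- by rewrite (le_trans (ler_normB _ _))// normr1 -[leRHS]natr1 addrC lerD// normr_cos_le1.
- apply: (taylor2_bound (f := fun y => 1 - cos (xi * y)) (f' := fun y => xi * sin (xi * y))
    (f'' := fun y => xi * (xi * cos (xi * y)))) => //.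
  + move=> x; have := is_deriveB (is_derive_cst (1 : R) x 1) (is_derive_cosM xi x).
    by move/is_derive_eq; apply; rewrite sub0r opprK.
  + move=> x; have := is_deriveZ xi (is_derive_sinM xi x).
    by move/is_derive_eq; apply.
  + by rewrite mulr0 cos0 subrr.
  + by rewrite mulr0 sin0 mulr0.
  + move=> x _; rewrite mulrA -expr2 normrM (ger0_norm (sqr_ge0 _)).
    by rewrite ler_piMr ?sqr_ge0// normr_cos_le1.
- by rewrite sqr_ge0.
Qed.

(** The sine vanishes to first order only; subtracting a multiple of
    [1 - exp(- y)], whose small time limit is known, leaves a quadratic error. *)
Lemma sin_levy_bound (xi y : R) : 0 <= y ->
  `|sin (xi * y) - xi * (1 - expR (- (1 * y)))| <=
  ((1 + `|xi|) + (xi ^+ 2 + `|xi|)) * Num.min 1 (y ^+ 2).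
Proof.
move=> y0; have e01 (x : R) : 0 <= x -> 0 <= expR (- (1 * x)) <= 1.
  by move=> x0; rewrite mul1r expR_ge0/= expR_le1 oppr_le0.
apply: min_sqr_bound => //.
- rewrite (le_trans (ler_normB _ _))// lerD ?normr_sin_le1// normrM ler_piMr//.
  by have /andP[h0 h1] := e01 y y0; rewrite ger0_norm ?subr_ge0// gerBl.
- apply: (taylor2_bound (f := fun y => sin (xi * y) - xi * (1 - expR (- (1 * y))))
    (f' := fun y => xi * cos (xi * y) - xi * (1 * expR (- (1 * y))))
    (f'' := fun y => xi * (- (xi * sin (xi * y))) + xi * expR (- (1 * y)))) => //.
  + move=> x; exact: (is_deriveB (is_derive_sinM xi x)
      (is_deriveZ xi (is_derive_expRN 1 x))).
  + move=> x; have de : is_derive x 1 (fun y => 1 * expR (- (1 * y))) (- expR (- (1 * x))).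
      have := is_deriveB (is_derive_cst (1 : R) x 1) (is_derive_expRN 1 x).
      have -> : (fun=> (1 : R)) - (fun y : R => 1 - expR (- (1 * y))) =
          (fun y => 1 * expR (- (1 * y))).
        by apply/funext => z; rewrite !fctE /=; ring.
      by move/is_derive_eq; apply; ring.
    have := is_deriveB (is_deriveZ xi (is_derive_cosM xi x)) (is_deriveZ xi de).
    by move/is_derive_eq; apply; rewrite /GRing.scale/=; ring.
  + by rewrite !mulr0 sin0 oppr0 expR0 subrr mulr0 subrr.
  + by rewrite !mulr0 cos0 oppr0 expR0; ring.
  + move=> x x0; rewrite (le_trans (ler_normD _ _))// lerD//.
      rewrite mulrN mulrA -expr2 normrN normrM (ger0_norm (sqr_ge0 _)).
      by rewrite ler_piMr ?sqr_ge0// normr_sin_le1.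
    have /andP[h0 h1] := e01 x x0.
    by rewrite normrM ler_piMr// ger0_norm.
- by rewrite addr_ge0 ?sqr_ge0 ?normr_ge0.
Qed.

Lemma integrable_levy_sqr (G : R -> R) C : measurable_fun setT G ->
  (forall y : R, 0 <= y -> `|G y| <= C * Num.min 1 (y ^+ 2)) ->
  mu.-integrable `]0, +oo[ (fun y => (G y * y `^ (- alpha - 1))%:E).
Proof.
move=> mG GC; apply: (integrable_levy alpha_gt0 alpha_lt1 (C := C)) => // y y0.
apply: le_trans (GC y (ltW y0)) _; rewrite ler_wpM2l//.
  have := GC 1 ler01; rewrite expr1n minxx mulr1; apply: le_trans; exact: normr_ge0.
case: (leP 1 y) => y1; first by rewrite ge_min lexx.
by rewrite ge_min expr2 ler_piMl ?orbT ?ltW.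
Qed.

Section one_subordinator.
Variable H : R -> {RV P >-> R}.
Hypothesis H_stable : stable_subordinator alpha H.

Let kappa := alpha / Gamma (1 - alpha).

Let integral_bounded (s : R) (f : R -> R) C : measurable_fun setT f -> (forall x, `|f x| <= C) ->
  P.-integrable setT (EFin \o (fun w => f (Num.max (H s w) 0))).
Proof.
move=> mf fC.
have mm : measurable_fun setT (fun w => f (Num.max (H s w) 0)).
  by apply: (measurableT_comp mf); exact: measurable_maxr.
by have [] := expectation_bounded P mm (fun w => fC (Num.max (H s w) 0)).
Qed.

Let i1 : P.-integrable setT (EFin \o (fun=> 1 : R)).
Proof. exact: finite_measure_integrable_cst. Qed.

Lemma cos_small_time (s : nat -> R) xi : (forall n, 0 < s n) -> s n @[n --> \oo] --> 0 ->
  (s n)^-1 * (1 - \int[P]_w cos (xi * Num.max (H (s n) w) 0)) @[n --> \oo] -->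
  kappa * cos_levy xi.
Proof.
move=> s0 cs.
have mc : measurable_fun setT (fun x : R => cos (xi * x)).
  by apply: continuous_measurable_fun; exact: continuous_cosM.
have cG : continuous (fun y : R => 1 - cos (xi * y)).
  by move=> y; apply: cvgB; [exact: cvg_cst|exact: continuous_cosM].
apply: cvg_trans (subordinator_small_time alpha_gt0 alpha_lt1 H_stable s0 cs cG
  (@cos_levy_bound xi)).
apply: near_eq_cvg; apply: nearW => n /=; congr (_ * _).
rewrite RintegralB//; first by rewrite Rintegral_probability_cst.
by apply: (@integral_bounded (s n) (fun x => cos (xi * x)) 1) => // x; exact: normr_cos_le1.
Qed.

(** The quadratic remainder of [sin_levy_bound] is covered by
    [subordinator_small_time], and the subtracted part by [laplace_small_time]. *)
Lemma sin_small_time (s : nat -> R) xi : (forall n, 0 < s n) -> s n @[n --> \oo] --> 0 ->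
  (s n)^-1 * (\int[P]_w sin (xi * Num.max (H (s n) w) 0)) @[n --> \oo] -->
  kappa * sin_levy xi.
Proof.
move=> s0 cs.
have ms : measurable_fun setT (fun x : R => sin (xi * x)).
  by apply: continuous_measurable_fun; exact: continuous_sinM.
have me : measurable_fun setT (fun x : R => expR (- (1 * x))).
  by apply: continuous_measurable_fun; exact: continuous_expRN.
have cG : continuous (fun y : R => sin (xi * y) - xi * (1 - expR (- (1 * y)))).
  move=> y; apply: cvgB; first exact: continuous_sinM.
  apply: cvgM; first exact: cvg_cst.
  by apply: cvgB; [exact: cvg_cst|exact: continuous_expRN].
have lG := subordinator_small_time alpha_gt0 alpha_lt1 H_stable s0 cs cG
  (@sin_levy_bound xi).
have lE := laplace_small_time alpha_gt0 alpha_lt1 H_stable s0 cs ler01.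
have -> : kappa * sin_levy xi =
    kappa * levy_integral alpha (fun y => sin (xi * y) - xi * (1 - expR (- (1 * y)))) +
    xi * (kappa * levy_integral alpha (fun y => 1 - expR (- (1 * y)))).
  have [_ i2 _] := laplace_kernel alpha_gt0 alpha_lt1 ler01.
  have i3 := @integrable_mulr _ _ R mu _ (measurable_itv _) xi _ i2.
  have mG : measurable_fun setT (fun y : R => sin (xi * y) - xi * (1 - expR (- (1 * y)))).
    exact: continuous_measurable_fun.
  have i4 := integrable_levy_sqr mG (@sin_levy_bound xi).
  rewrite mulrCA -mulrDr; congr (_ * _); rewrite /levy_integral /sin_levy.
  rewrite -RintegralZl// -RintegralD//.
  by apply: eq_Rintegral => y _; ring.
have lsum : (s n)^-1 * (\int[P]_w (sin (xi * Num.max (H (s n) w) 0) -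
      xi * (1 - expR (- (1 * Num.max (H (s n) w) 0))))) +
    xi * ((s n)^-1 * (1 - \int[P]_w expR (- (1 * Num.max (H (s n) w) 0))))
    @[n --> \oo] -->
    kappa * levy_integral alpha (fun y => sin (xi * y) - xi * (1 - expR (- (1 * y)))) +
    xi * (kappa * levy_integral alpha (fun y => 1 - expR (- (1 * y)))).
  by apply: cvgD => //; apply: cvgM => //; exact: cvg_cst.
apply: cvg_trans lsum; apply: near_eq_cvg; apply: nearW => n /=.
have ieH : P.-integrable setT (EFin \o (fun w => expR (- (1 * Num.max (H (s n) w) 0)))).
  apply: integrable_01 => [|w]; last first.
    by rewrite expR_ge0/= expR_le1 oppr_le0 mul1r le_max lexx orbT.
  by apply: (measurableT_comp me); exact: measurable_maxr.
have isH : P.-integrable setT (EFin \o (fun w => sin (xi * Num.max (H (s n) w) 0))).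
  by apply: (@integral_bounded (s n) (fun x => sin (xi * x)) 1) => // x; exact: normr_sin_le1.
have i1e : P.-integrable setT
    (EFin \o (fun w => 1 - expR (- (1 * Num.max (H (s n) w) 0)))).
  exact: integrable_subr.
rewrite RintegralB//; last exact: integrable_mulr.
rewrite RintegralZl// RintegralB// Rintegral_probability_cst; ring.
Qed.

(** The speed [c] vanishes when the process has no jumps of one sign, and [H] then
    stays at its starting point. *)
Lemma trig_small_time (c xi : R) (t : nat -> R) : 0 <= c ->
  (forall n, 0 < t n) -> t n @[n --> \oo] --> 0 ->
  ((t n)^-1 * (1 - \int[P]_w cos (xi * Num.max (H (c * t n) w) 0)) @[n --> \oo] -->
    c * (kappa * cos_levy xi)) /\
  ((t n)^-1 * (\int[P]_w sin (xi * Num.max (H (c * t n) w) 0)) @[n --> \oo] -->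
    c * (kappa * sin_levy xi)).
Proof.
rewrite le_eqVlt => /predU1P[<- t0 ct|c0 t0 ct].
  have H0 : {ae P, forall w, H 0 w = 0} := levy_start (stable_levy H_stable).
  have mm (f : R -> R) : measurable_fun setT f ->
      measurable_fun setT (fun w => f (xi * Num.max (H 0 w) 0)).
    by move=> mf; apply: (measurableT_comp mf); apply: measurable_funM => //; exact: measurable_maxr.
  have Ecos : \int[P]_w cos (xi * Num.max (H 0 w) 0) = 1.
    rewrite -[RHS](Rintegral_probability_cst P); apply: ae_eq_Rintegral => //.
      apply: mm; apply: continuous_measurable_fun; exact: continuous_cos.
    by apply: filterS H0 => w ->; rewrite maxxx mulr0 cos0.
  have Esin : \int[P]_w sin (xi * Num.max (H 0 w) 0) = 0.
    rewrite -[RHS](Rintegral_probability_cst P); apply: ae_eq_Rintegral => //.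
      apply: mm; apply: continuous_measurable_fun; exact: continuous_sin.
    by apply: filterS H0 => w ->; rewrite maxxx mulr0 sin0.
  rewrite !mul0r; split; apply: cvg_near_cst; apply: nearW => n.
    by rewrite mul0r Ecos subrr mulr0.
  by rewrite mul0r Esin mulr0.
have ct0 n : 0 < c * t n by rewrite mulr_gt0.
have cct : c * t n @[n --> \oo] --> 0.
  by rewrite -(mulr0 c); apply: cvgM => //; exact: cvg_cst.
have scale n (a : R) : (t n)^-1 * a = c * ((c * t n)^-1 * a).
  by field; rewrite !gt_eqF.
split.
- rewrite (_ : (fun n => _) = (fun n => c * ((c * t n)^-1 *
      (1 - \int[P]_w cos (xi * Num.max (H (c * t n) w) 0))))).
    by apply: cvgM; [exact: cvg_cst|exact: cos_small_time].
  by apply/funext => n; exact: scale.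
- rewrite (_ : (fun n => _) = (fun n => c * ((c * t n)^-1 *
      (\int[P]_w sin (xi * Num.max (H (c * t n) w) 0))))).
    by apply: cvgM; [exact: cvg_cst|exact: sin_small_time].
  by apply/funext => n; exact: scale.
Qed.

End one_subordinator.
End trigonometric.

Section symbol.
Context {d} {T : measurableType d} {R : realType} (P : probability T R).
Variables (alpha : R) (H1 H2 : R -> {RV P >-> R}).
Hypotheses (alpha_gt0 : 0 < alpha) (alpha_lt1 : alpha < 1).
Hypothesis H1_stable : stable_subordinator alpha H1.
Hypothesis H2_stable : stable_subordinator alpha H2.
Hypothesis H12_indep : mutually_independent P
  (fun b : bool => process_sigma (if b then H1 else H2)).
Variables (c1 c2 : R) (Y : R -> {RV P >-> R}).
Hypotheses (c10 : 0 <= c1) (c20 : 0 <= c2).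
Hypothesis YE : forall t w, Y t w = H1 (c1 * t) w - H2 (c2 * t) w.

Let kappa := alpha / Gamma (1 - alpha).
Let C1 xi t := \int[P]_w cos (xi * Num.max (H1 (c1 * t) w) 0).
Let S1 xi t := \int[P]_w sin (xi * Num.max (H1 (c1 * t) w) 0).
Let C2 xi t := \int[P]_w cos (xi * Num.max (H2 (c2 * t) w) 0).
Let S2 xi t := \int[P]_w sin (xi * Num.max (H2 (c2 * t) w) 0).

Let measurable_trig (f : R -> R) xi : measurable_fun setT f ->
  measurable_fun setT (fun x : R => f (xi * Num.max x 0)).
Proof.
move=> mf; apply: (measurableT_comp mf); apply: measurable_funM => //.
exact: measurable_maxr.
Qed.

Let mcos : measurable_fun setT (@cos R).
Proof. by apply: continuous_measurable_fun; exact: continuous_cos. Qed.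
Let msin : measurable_fun setT (@sin R).
Proof. by apply: continuous_measurable_fun; exact: continuous_sin. Qed.

Let char_parts t xi : 0 <= t ->
  \int[P]_w cos (xi * Y t w) = C1 xi t * C2 xi t + S1 xi t * S2 xi t /\
  \int[P]_w sin (xi * Y t w) = S1 xi t * C2 xi t - C1 xi t * S2 xi t.
Proof.
move=> t0; have t1 : 0 <= c1 * t by exact: mulr_ge0.
have t2 : 0 <= c2 * t by exact: mulr_ge0.
pose f (g : R -> R) (x : R) := g (xi * Num.max x 0).
have mf g (H : {RV P >-> R}) : measurable_fun setT g ->
    measurable_fun setT (fun w => f g (H w)).
  by move=> mg; apply: (measurableT_comp (measurable_trig xi mg)).
have prod (g k : R -> R) : measurable_fun setT g -> measurable_fun setT k ->
    (forall x, `|g x| <= 1) -> (forall x, `|k x| <= 1) ->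
    P.-integrable setT (EFin \o (fun w => f g (H1 (c1 * t) w) * f k (H2 (c2 * t) w))) /\
    \int[P]_w (f g (H1 (c1 * t) w) * f k (H2 (c2 * t) w)) =
    (\int[P]_w f g (H1 (c1 * t) w)) * (\int[P]_w f k (H2 (c2 * t) w)).
  move=> mg mk g1 k1; split.
    have mgk : measurable_fun setT (fun w => f g (H1 (c1 * t) w) * f k (H2 (c2 * t) w)).
      by apply: measurable_funM; exact: mf.
    have [] // := @expectation_bounded R _ _ P _ 1 mgk.
    move=> w; rewrite normrM -[leRHS]mulr1.
    by apply: ler_pM => //; [exact: g1|exact: k1].
  apply: (integral_independent H12_indep (f := f g) (g := f k)) => //.
  - exact: (measurable_trig xi mg).
  - exact: (measurable_trig xi mk).
  - by move=> x; exact: g1.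
  - by move=> x; exact: k1.
have [icc Ecc] := prod cos cos mcos mcos (@normr_cos_le1 R) (@normr_cos_le1 R).
have [iss Ess] := prod sin sin msin msin (@normr_sin_le1 R) (@normr_sin_le1 R).
have [isc Esc] := prod sin cos msin mcos (@normr_sin_le1 R) (@normr_cos_le1 R).
have [ics Ecs] := prod cos sin mcos msin (@normr_cos_le1 R) (@normr_sin_le1 R).
have YEae : {ae P, forall w, xi * Y t w =
    xi * Num.max (H1 (c1 * t) w) 0 - xi * Num.max (H2 (c2 * t) w) 0}.
  have h1 := subordinator_ge0 H1_stable t1.
  have h2 := subordinator_ge0 H2_stable t2.
  apply: filterS2 h1 h2 => w h1 h2.
  by rewrite YE (max_idPl h1) (max_idPl h2) mulrBr.
have mY (g : R -> R) : measurable_fun setT g ->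
    measurable_fun setT (fun w => g (xi * Y t w)).
  by move=> mg; apply: (measurableT_comp mg); exact: measurable_funM.
split.
- rewrite -[C1 _ _ * _]Ecc -[S1 _ _ * _]Ess -RintegralD//.
  apply: ae_eq_Rintegral; first exact: mY.
    by apply: measurable_funD; apply: measurable_funM; exact: mf.
  by apply: filterS YEae => w ->; rewrite cosB.
- rewrite -[S1 _ _ * _]Esc -[C1 _ _ * _]Ecs -RintegralB//.
  apply: ae_eq_Rintegral; first exact: mY.
    by apply: measurable_funB; apply: measurable_funM; exact: mf.
  by apply: filterS YEae => w ->; rewrite sinB.
Qed.

(** By independence the characteristic function of [Y] is the product of those of
    [H1] and [- H2]. Both factors tend to [1], so only the first order terms of
    each survive in the quotient. *)
Theorem difference_symbol : fourier_symbol Y (fun xi =>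
  ((c1 + c2) * (kappa * cos_levy alpha xi)) +i*
  (- ((c1 - c2) * (kappa * sin_levy alpha xi)))).
Proof.
move=> xi q; set cl := kappa * cos_levy alpha xi; set sl := kappa * sin_levy alpha xi.
have Y0 : {ae P, forall w, Y 0 w = 0}.
  have h1 := levy_start (stable_levy H1_stable).
  have h2 := levy_start (stable_levy H2_stable).
  by apply: filterS2 h1 h2 => w h1 h2; rewrite YE !mulr0 h1 h2 subrr.
have mY (g : R -> R) : measurable_fun setT g ->
    measurable_fun setT (fun w => g (xi * Y 0 w)).
  by move=> mg; apply: (measurableT_comp mg); exact: measurable_funM.
have c0 : \int[P]_w cos (xi * Y 0 w) = 1.
  rewrite -[RHS](Rintegral_probability_cst P); apply: ae_eq_Rintegral => //; first exact: mY.
  by apply: filterS Y0 => w ->; rewrite mulr0 cos0.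
have s0 : \int[P]_w sin (xi * Y 0 w) = 0.
  rewrite -[RHS](Rintegral_probability_cst P); apply: ae_eq_Rintegral => //; first exact: mY.
  by apply: filterS Y0 => w ->; rewrite mulr0 sin0.
have qRe t : complex.Re (q t) = t^-1 * (\int[P]_w cos (xi * Y t w) - 1).
  by rewrite /q /char_fun /Cintegral /= c0 s0 mul0r subr0.
have qIm t : complex.Im (q t) = t^-1 * (\int[P]_w sin (xi * Y t w)).
  by rewrite /q /char_fun /Cintegral /= c0 s0 mul0r addr0 subr0.
have seqlim (t : nat -> R) : (forall n, 0 < t n) -> t n @[n --> \oo] --> 0 ->
    [/\ (t n)^-1 * (1 - C1 xi (t n)) @[n --> \oo] --> c1 * cl,
        (t n)^-1 * S1 xi (t n) @[n --> \oo] --> c1 * sl,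
        (t n)^-1 * (1 - C2 xi (t n)) @[n --> \oo] --> c2 * cl,
        (t n)^-1 * S2 xi (t n) @[n --> \oo] --> c2 * sl &
        C2 xi (t n) @[n --> \oo] --> (1 : R) /\ S2 xi (t n) @[n --> \oo] --> (0 : R)].
  move=> t0 ct.
  have [l1 l2] := trig_small_time alpha_gt0 alpha_lt1 H1_stable xi c10 t0 ct.
  have [l3 l4] := trig_small_time alpha_gt0 alpha_lt1 H2_stable xi c20 t0 ct.
  split => //; split.
    have := cvgM ct l3; rewrite mul0r => l5.
    have l6 : 1 - t n * ((t n)^-1 * (1 - C2 xi (t n))) @[n --> \oo] --> (1 - 0 : R).
      exact: (cvgB (cvg_cst (1 : R)) (l5 _)).
    rewrite subr0 in l6; apply: cvg_trans l6; apply: near_eq_cvg; apply: nearW => n.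
    rewrite /= mulrA divff; last exact: lt0r_neq0.
    by rewrite mul1r subKr.
  have l5 : t n * ((t n)^-1 * S2 xi (t n)) @[n --> \oo] --> (0 : R).
    by rewrite -(mul0r (c2 * sl)); exact: cvgM ct l4.
  apply: cvg_trans l5.
  apply: near_eq_cvg; apply: nearW => n.
  by rewrite /= -[RHS]mul1r -(divff (lt0r_neq0 (t0 n))) mulrA.
split; apply/cvg_at_rightP => t [t0 ct]; have [l1 l2 l3 l4 [l5 l6]] := seqlim t t0 ct.
- rewrite (_ : (fun n => _) = (fun n =>
    - (((t n)^-1 * (1 - C1 xi (t n))) * C2 xi (t n) +
       (t n)^-1 * (1 - C2 xi (t n)) - (t n)^-1 * S1 xi (t n) * S2 xi (t n)))); last first.
    apply/funext => n; rewrite qRe.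
    by have [-> _] := char_parts xi (ltW (t0 n)); ring.
  rewrite (_ : complex.Re _ = - (c1 * cl * 1 + c2 * cl - c1 * sl * 0)); last first.
    by rewrite /=; ring.
  apply: cvgN; apply: cvgB; last exact: cvgM.
  by apply: cvgD => //; exact: cvgM.
- rewrite (_ : (fun n => _) = (fun n =>
    ((t n)^-1 * S1 xi (t n)) * C2 xi (t n) +
    ((t n)^-1 * (1 - C1 xi (t n))) * S2 xi (t n) - (t n)^-1 * S2 xi (t n))); last first.
    apply/funext => n; rewrite qIm.
    by have [_ ->] := char_parts xi (ltW (t0 n)); ring.
  rewrite (_ : complex.Im _ = c1 * sl * 1 + c1 * cl * 0 - c2 * sl); last first.
    by rewrite /=; ring.
  apply: cvgB => //; apply: cvgD; exact: cvgM.
Qed.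

End symbol.

(** * Fubini's theorem and integrals over the line *)

Section fubini.
Context {d1 d2} {T1 : measurableType d1} {T2 : measurableType d2} {R : realType}.
Variables (m1 : {sigma_finite_measure set T1 -> \bar R}).
Variables (m2 : {sigma_finite_measure set T2 -> \bar R}).
Variables (D1 : set T1) (D2 : set T2) (h : T1 -> T2 -> R) (a : T1 -> R) (b : T2 -> R).
Hypotheses (mD1 : measurable D1) (mD2 : measurable D2).
Hypothesis mh : measurable_fun setT (fun z => h z.1 z.2).
Hypotheses (ia : m1.-integrable D1 (EFin \o a)) (ib : m2.-integrable D2 (EFin \o b)).
Hypothesis hab : forall x y, D1 x -> D2 y -> `|h x y| <= a x * b y.

Let H (z : T1 * T2) := (h z.1 z.2 * \1_D1 z.1 * \1_D2 z.2)%:E.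

Let mH : measurable_fun setT H.
Proof.
apply/measurable_EFinP; apply: measurable_funM.
  apply: measurable_funM => //.
  by apply: (measurableT_comp _ measurable_fst); exact: measurable_indic.
by apply: (measurableT_comp _ measurable_snd); exact: measurable_indic.
Qed.

Lemma integrable_section1 x : D1 x -> m2.-integrable D2 (EFin \o h x).
Proof.
move=> Dx; apply: (integrable_dominated (g := fun y => a x * b y)) => //.
- apply: measurable_funTS; exact: (measurableT_comp mh (pair1_measurable x)).
- exact: integrable_mulr.
- by move=> y; exact: hab.
Qed.

Lemma integrable_section2 y : D2 y -> m1.-integrable D1 (EFin \o h ^~ y).
Proof.
move=> Dy; apply: (integrable_dominated (g := fun x => b y * a x)) => //.
- apply: measurable_funTS; exact: (measurableT_comp mh (pair2_measurable y)).
- exact: integrable_mulr.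
- by move=> x Dx; rewrite mulrC; exact: hab.
Qed.

Let HE1 : fubini_F m2 H = (EFin \o (fun x => \int[m2]_(y in D2) h x y)) \_ D1.
Proof.
apply/funext => x; rewrite /fubini_F patchE; case: ifPn => [|/negP xD].
  move=> xD; have Dx : D1 x by exact: set_mem.
  rewrite /= /Rintegral fineK ?(integrable_fin_num mD2 (integrable_section1 Dx))//.
  rewrite [RHS]integral_mkcond; apply: eq_integral => y _.
  rewrite /H/= [\1_D1 x]indicE xD mulr1 indicE patchE.
  by case: ifPn => _; rewrite ?mulr1 ?mulr0.
rewrite -[RHS](integral0 m2 setT); apply: eq_integral => y _.
by rewrite /H/= [\1_D1 x]indicE (negbTE (introN idP xD)) mulr0 mul0r.
Qed.

Let HE2 : fubini_G m1 H = (EFin \o (fun y => \int[m1]_(x in D1) h x y)) \_ D2.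
Proof.
apply/funext => y; rewrite /fubini_G patchE; case: ifPn => [|/negP yD].
  move=> yD; have Dy : D2 y by exact: set_mem.
  rewrite /= /Rintegral fineK ?(integrable_fin_num mD1 (integrable_section2 Dy))//.
  rewrite [RHS]integral_mkcond; apply: eq_integral => x _.
  rewrite /H/= [\1_D2 y]indicE yD mulr1 indicE patchE.
  by case: ifPn => _; rewrite ?mulr1 ?mulr0.
rewrite -[RHS](integral0 m1 setT); apply: eq_integral => x _.
by rewrite /H/= [\1_D2 y]indicE (negbTE (introN idP yD)) mulr0.
Qed.

Let iH : (m1 \x m2)%E.-integrable setT H.
Proof.
apply/integrable12ltyP => //.
have mA : measurable_fun setT ((fun x => `|(a x)%:E|)%E \_ D1).
  by apply/(measurable_restrictT _ mD1); apply: measurableT_comp => //; case/integrableP: ia.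
have mB : measurable_fun setT ((fun y => `|(b y)%:E|)%E \_ D2).
  by apply/(measurable_restrictT _ mD2); apply: measurableT_comp => //; case/integrableP: ib.
apply: (@le_lt_trans _ _ (\int[m1]_x (((fun x => `|(a x)%:E|) \_ D1) x *
    \int[m2]_y ((fun y => `|(b y)%:E|) \_ D2) y))%E).
  apply: ge0_le_integral => //.
  - by move=> x Tx; exact: integral_ge0.
  - apply: (measurable_fun_fubini_tonelli_F (abse \o H)) => //.
    by apply: measurableT_comp.
    by move=> z; exact: abse_ge0.
  - apply: emeasurable_funM => //; exact: measurable_cst.
  move=> x Tx; rewrite -ge0_integralZl//; last 2 first.
  - by move=> y Ty; rewrite patchE; case: ifPn.
  - by rewrite patchE; case: ifPn.
  apply: ge0_le_integral => //.
  - apply: measurableT_comp => //; exact: (measurableT_comp mH (pair1_measurable x)).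
  - by apply: emeasurable_funM => //; exact: measurable_cst.
  move=> y Ty; rewrite /H/= !patchE !indicE.
  case: ifPn => [/set_mem Dx|_]; last by rewrite mulr0 mul0r normr0 mul0e.
  case: ifPn => [/set_mem Dy|_]; last by rewrite mulr0 normr0 mule0.
  by rewrite !mulr1 -EFinM lee_fin -normrM (le_trans (hab Dx Dy))// ler_norm.
rewrite ge0_integralZr//; last 2 first.
- by move=> x Tx; rewrite patchE; case: ifPn.
- by apply: integral_ge0 => y _; rewrite patchE; case: ifPn.
rewrite -!integral_mkcond; apply: lte_mul_pinfty.
- exact: integral_ge0.
- by rewrite ge0_fin_numE ?integral_ge0//; case/integrableP: ia.
- by case/integrableP: ib.
Qed.

(** Domination by a product of integrable functions makes every section
    integrable, not just almost every one, so real-valued integrals can be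
    nested. *)
Lemma Rintegral_fubini :
  m1.-integrable D1 (fun x => (\int[m2]_(y in D2) h x y)%:E) /\
  \int[m1]_(x in D1) \int[m2]_(y in D2) h x y =
  \int[m2]_(y in D2) \int[m1]_(x in D1) h x y.
Proof.
have i1 := integrable_fubini_F iH; rewrite HE1 in i1.
split; first exact/integrable_mkcond.
rewrite /Rintegral; congr fine.
rewrite integral_mkcond [RHS]integral_mkcond.
have := integral12_prod_meas1 iH; rewrite HE1 => ->.
by have := integral21_prod_meas1 iH; rewrite HE2 => ->.
Qed.

End fubini.

Section line_integrals.
Context {R : realType}.
Notation mu := (@lebesgue_measure R).

Let cvgn1 : (n.+1%:R : R) @[n --> \oo] --> +oo.
Proof. by have := @cvgr_idn R; rewrite -(cvg_shiftS (fun n => n%:R : R)). Qed.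

Let nearS (x : R) : \forall n \near \oo, - n.+1%:R <= x <= n.+1%:R.
Proof.
exists (Num.truncn `|x|) => // n /= xn; rewrite -ler_norml.
by apply: ltW; apply: lt_le_trans (truncnS_gt _) _; rewrite ler_nat ltnS.
Qed.

Lemma FTC_line (F f : R -> R) (l l' : R) :
  (forall x : R, is_derive x 1 F (f x)) -> continuous f ->
  mu.-integrable setT (EFin \o f) ->
  F x @[x --> -oo] --> l -> F x @[x --> +oo] --> l' ->
  \int[mu]_x f x = l' - l.
Proof.
move=> dF cf intf cl cl'.
apply: (@FTC_exhaustion _ _ (fun n => - n.+1%:R) (fun n => n.+1%:R) F f) => //.
- by move=> n; rewrite gtrN.
- by move=> x _; exact: cf.
- by apply: (cvg_comp _ _ _ cl); apply/cvgNrNy; exact: cvgn1.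
- exact: (cvg_comp _ _ cvgn1 cl').
Qed.

Lemma FTC_halfline (F f : R -> R) (l' : R) :
  (forall x : R, is_derive x 1 F (f x)) -> continuous f ->
  mu.-integrable `[0, +oo[ (EFin \o f) ->
  F x @[x --> +oo] --> l' ->
  \int[mu]_(x in `]0, +oo[) f x = l' - F 0.
Proof.
move=> dF cf intf cl'; rewrite Rintegral_itv_obnd_cbnd; last first.
  by apply: integrableS intf => //; apply: subset_itvr; rewrite bnd_simp.
apply: (@FTC_exhaustion _ _ (fun n => 0) (fun n => n.+1%:R) F f) => //.
- by move=> n x /andP[x0 _]; rewrite /= in_itv/= x0.
- move=> x /=; rewrite in_itv/= andbT => x0; have := nearS x.
  by apply: filterS => n /andP[_ ->]; rewrite x0.
- by move=> x _; exact: cf.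
- exact: cvg_cst.
- exact: (cvg_comp _ _ cvgn1 cl').
Qed.

(** Both the kernel of the inversion formula and the majorant of a Schwartz
    function and of its derivatives. *)
Definition cauchy_kernel (x : R) := (1 + x ^+ 2)^-1.

Lemma cauchy_kernel_gt0 x : 0 < cauchy_kernel x.
Proof. by rewrite invr_gt0 ltr_pwDl// sqr_ge0. Qed.

Let cauchy_ge0 x : 0 <= cauchy_kernel x.
Proof. exact/ltW/cauchy_kernel_gt0. Qed.

Lemma continuous_cauchy_kernel : continuous cauchy_kernel.
Proof.
move=> x; apply: cvgV; first by rewrite gt_eqF// ltr_pwDl// sqr_ge0.
by apply: cvgD; [exact: cvg_cst|apply: exprn_continuous].
Qed.

Let is_derive_atan (x : R) : is_derive x 1 (@atan R) (cauchy_kernel x).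
Proof. by rewrite /cauchy_kernel -derive1_atan derive1E; exact/derivableP/derivable_atan. Qed.

Let cvgNy_atan : (@atan R) x @[x --> -oo] --> - (pi / 2).
Proof.
apply/cvgNy_compNP; rewrite (_ : _ \o _ = (fun x => - atan x)).
  by apply: cvgN; exact: cvgy_atan.
by apply/funext => x /=; rewrite atanN.
Qed.

Lemma integrable_cauchy_kernel : mu.-integrable setT (EFin \o cauchy_kernel).
Proof.
apply: (@integrable_exhaustion _ setT (fun n => - n.+1%:R) (fun n => n.+1%:R)
  (@atan R) _ _ _ _ _ _ _ pi) => //.
- by move=> n; rewrite gtrN.
- by move=> x _; exact: continuous_cauchy_kernel.
- move=> n; rewrite atanN opprK [leRHS](splitr pi).
  by rewrite lerD// ltW// atan_ltpi2.
Qed.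

Lemma integral_cauchy_kernel : \int[mu]_x cauchy_kernel x = pi.
Proof.
rewrite (FTC_line is_derive_atan continuous_cauchy_kernel integrable_cauchy_kernel
  cvgNy_atan (@cvgy_atan R)).
by rewrite opprK -splitr.
Qed.

Lemma integrable_cauchy_dominated (f : R -> R) (K : R) : measurable_fun setT f ->
  (forall x, `|f x| <= K * cauchy_kernel x) -> mu.-integrable setT (EFin \o f).
Proof.
move=> mf fK; apply: (@integrable_dominated _ _ R mu _ _ (fun x => K * cauchy_kernel x)) => //.
exact: (@integrable_mulr _ _ R mu _ measurableT K cauchy_kernel integrable_cauchy_kernel).
Qed.

Lemma integral_cauchy_dominated (f : R -> R) (K : R) : measurable_fun setT f ->
  (forall x, `|f x| <= K * cauchy_kernel x) -> `|\int[mu]_x f x| <= K * pi.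
Proof.
move=> mf fK; have iff := integrable_cauchy_dominated mf fK.
rewrite (le_trans (le_normr_Rintegral measurableT iff))//.
rewrite -integral_cauchy_kernel -RintegralZl//; last exact: integrable_cauchy_kernel.
apply: le_Rintegral => //.
- exact: (integrable_abse iff).
- exact: (@integrable_mulr _ _ R mu _ measurableT K cauchy_kernel integrable_cauchy_kernel).
Qed.

Lemma cvg_cauchy_dominated (f : R -> R) (K : R) :
  (forall x, `|f x| <= K * cauchy_kernel x) ->
  f x @[x --> -oo] --> (0 : R) /\ f x @[x --> +oo] --> (0 : R).
Proof.
move=> fK; have cy : K * cauchy_kernel x @[x --> +oo] --> (0 : R).
  rewrite -(mulr0 K); apply: cvgM; first exact: cvg_cst.
  apply: (@squeeze_cvgr _ _ _ _ (cst 0) (fun x => x^-1) cauchy_kernel).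
  - near=> x; rewrite cauchy_ge0/=; have x1 : 1 < x by near: x; exact: nbhs_pinfty_gt.
    have x0 : 0 < x by exact: lt_trans x1.
    by rewrite lef_pV2 ?posrE ?ltr_pwDl ?sqr_ge0//; nra.
  - exact: cvg_cst.
  - by apply/gtr0_cvgV0; [near=> x; near: x; exact: nbhs_pinfty_gt|exact: cvg_id].
have sq (F : set_system R) : Filter F -> K * cauchy_kernel x @[x --> F] --> (0 : R) ->
    f x @[x --> F] --> (0 : R).
  move=> FF cK; apply: norm_cvg0.
  apply: (@squeeze_cvgr _ _ _ _ (cst 0) _ _ _ _ _ cK) => //.
    by apply: nearW => x; rewrite normr_ge0 fK.
  exact: cvg_cst.
split; last exact: sq.
apply: sq; apply/cvgNy_compNP; rewrite (_ : _ \o _ = (fun x => K * cauchy_kernel x)) //.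
by apply/funext => x /=; rewrite /cauchy_kernel sqrrN.
Unshelve. all: by end_near. Qed.

Lemma Rintegral_fold (h : R -> R) : mu.-integrable setT (EFin \o h) ->
  \int[mu]_x h x = \int[mu]_(x in `]0, +oo[) (h x + h (- x)).
Proof.
move=> ih; have i0 (D : set R) : measurable D -> mu.-integrable D (EFin \o h).
  by move=> mD; exact: integrableS ih.
have ihN : mu.-integrable setT (EFin \o (fun x => h (- x))).
  have := @integrable_affine _ (-1) 0 _ h ih; rewrite oppr_eq0 oner_neq0 => /(_ isT).
  by congr (integrable _ _ _); apply/funext => x /=; rewrite addr0 mulN1r.
have iN (D : set R) : measurable D -> mu.-integrable D (EFin \o (fun x => h (- x))).
  by move=> mD; exact: integrableS ihN.
have EU : setT = `]0, +oo[%classic `|` `]-oo, 0]%classic :> set R.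
  apply/seteqP; split => x //= _; rewrite !in_itv/= andbT.
  by case: (ltP 0 x) => ?; [left|right].
rewrite RintegralD//; [|exact: i0|exact: iN].
rewrite [in LHS]EU Rintegral_setU//; last 2 first.
- by rewrite -EU.
- by apply/disj_setPLR => x /=; rewrite !in_itv/= andbT => x0; apply/negP; rewrite -ltNge.
congr (_ + _); rewrite [RHS]Rintegral_itv_obnd_cbnd; last exact: iN.
rewrite Rintegral_mkcond [RHS]Rintegral_mkcond.
have iA : mu.-integrable setT (EFin \o (h \_ `]-oo, 0])).
  by rewrite -restrict_EFin; apply/(@integrable_mkcond _ _ R mu `]-oo, 0]%classic); last exact: (i0 _ (measurable_itv _)).
rewrite (@Rintegral_affine _ (-1) 0 _ _ iA) ?oppr_eq0 ?oner_neq0// normrN1 mul1r.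
apply: eq_Rintegral => x _; rewrite !patchE addr0 mulN1r.
by congr (if _ then _ else _); rewrite !mem_setE !in_itv/= andbT oppr_le0.
Qed.

Lemma damped_exp (eps : R) : 0 < eps ->
  mu.-integrable `[0, +oo[ (fun x => (expR (- (eps * x)))%:E).
Proof.
move=> e0.
have de (x : R) : is_derive x 1 (fun x => eps^-1 * (1 - expR (- (eps * x)))) (expR (- (eps * x))).
  have := is_deriveZ eps^-1 (is_derive_expRN eps x).
  by move/is_derive_eq; apply; rewrite /GRing.scale/= mulKf// gt_eqF.
apply: (@integrable_exhaustion _ `[0, +oo[%classic (fun n => 0) (fun n => n.+1%:R)
  (fun x => eps^-1 * (1 - expR (- (eps * x)))) _ _ _ _ _ _ _ eps^-1) => //.
- by move=> n x /andP[x0 _]; rewrite /= in_itv/= x0.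
- move=> x /=; rewrite in_itv/= andbT => x0; have := nearS x.
  by apply: filterS => n /andP[_ ->]; rewrite x0.
- by move=> x _; exact: continuous_expRN.
- move=> n; rewrite mulr0 oppr0 expR0 subrr mulr0 subr0 ler_piMr ?invr_ge0 ?(ltW e0)//.
Qed.

Let cvgy_expR (eps : R) : 0 < eps -> expR (- (eps * x)) @[x --> +oo] --> (0 : R).
Proof.
move=> e0; apply: (cvg_comp (fun x => eps * x) (fun x => expR (- x)) _ (@cvgr_expR R)).
exact: (gt0_cvgMry e0 cvg_id).
Qed.

(** The real part of the integral of [exp(- (eps - i z) x)]. *)
Lemma damped_cos (eps z : R) : 0 < eps ->
  \int[mu]_(x in `]0, +oo[) (expR (- (eps * x)) * cos (x * z)) =
  eps / (eps ^+ 2 + z ^+ 2).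
Proof.
move=> e0; set n := eps ^+ 2 + z ^+ 2.
have n0 : n != 0 by rewrite gt_eqF// ltr_pwDl ?sqr_ge0 ?exprn_gt0.
pose F x := n^-1 * (expR (- (eps * x)) * (z * sin (x * z) - eps * cos (x * z))).
have cz : (fun x : R => cos (x * z)) = (fun x => cos (z * x)).
  by apply/funext => x; rewrite mulrC.
have sz : (fun x : R => sin (x * z)) = (fun x => sin (z * x)).
  by apply/funext => x; rewrite mulrC.
have mcos : continuous (fun x : R => cos (x * z)) by rewrite cz; exact: continuous_cosM.
have cf : continuous (fun x => expR (- (eps * x)) * cos (x * z)).
  by move=> x; apply: cvgM; [exact: continuous_expRN|exact: mcos].
have dF (x : R) : is_derive x 1 F (expR (- (eps * x)) * cos (x * z)).
  have de : is_derive x 1 (fun x => expR (- (eps * x))) (- (eps * expR (- (eps * x)))).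
    have := is_deriveB (is_derive_cst (1 : R) x 1) (is_derive_expRN eps x).
    have -> : (fun=> (1 : R)) - (fun y : R => 1 - expR (- (eps * y))) =
        (fun y => expR (- (eps * y))).
      by apply/funext => y; rewrite !fctE /=; ring.
    by move/is_derive_eq; apply; rewrite sub0r.
  have := is_deriveZ n^-1 (is_deriveM de (is_deriveB
    (is_deriveZ z (is_derive_sinM z x)) (is_deriveZ eps (is_derive_cosM z x)))).
  rewrite (_ : n^-1 \*: _ = F); last first.
    by apply/funext => y; rewrite /F (mulrC y z).
  move/is_derive_eq; apply.
  by rewrite /GRing.scale/= !fctE (mulrC x z) /n; change ((z \*: (fun y : R => sin (z * y))) x) with (z * sin (z * x)); change ((eps \*: (fun y : R => cos (z * y))) x) with (eps * cos (z * x)); field.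
have iF : mu.-integrable `[0, +oo[ (fun x => (expR (- (eps * x)) * cos (x * z))%:E).
  apply: (@integrable_dominated _ _ R mu _ _ _ _ _ (damped_exp e0)) => //.
    by apply: measurable_funTS; apply: continuous_measurable_fun; exact: cf.
  by move=> x _; rewrite normrM ger0_norm ?expR_ge0// ler_piMr ?expR_ge0// normr_cos_le1.
have cF : F x @[x --> +oo] --> (0 : R).
  apply: norm_cvg0.
  apply: (@squeeze_cvgr _ _ _ _ (cst 0)
    (fun x => (`|n^-1| * (`|z| + eps)) * expR (- (eps * x)))).
  - apply: nearW => x; rewrite normr_ge0/= normrM -mulrA ler_wpM2l//.
    rewrite normrM ger0_norm ?expR_ge0// mulrC ler_wpM2r ?expR_ge0//.
    rewrite (le_trans (ler_normB _ _))// lerD// normrM ?(gtr0_norm e0).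
      by rewrite ler_piMr// normr_sin_le1.
    by rewrite ler_piMr ?(ltW e0)// normr_cos_le1.
  - exact: cvg_cst.
  - rewrite -[X in _ --> X](mulr0 (`|n^-1| * (`|z| + eps))).
    by apply: cvgM; [exact: cvg_cst|exact: cvgy_expR].
rewrite (FTC_halfline dF cf iF cF) /F mulr0 oppr0 expR0 !mul0r sin0 cos0.
by field.
Qed.

End line_integrals.

(** * Cosine and sine transforms of a smooth decaying function *)

Section trig_transforms.
Context {R : realType}.
Notation mu := (@lebesgue_measure R).

Definition cosT (f : R -> R) (xi : R) := \int[mu]_x (cos (xi * x) * f x).
Definition sinT (f : R -> R) (xi : R) := \int[mu]_x (sin (xi * x) * f x).

(** The cosine transform of the translate [f (x + .)]. *)
Definition cosTs (f : R -> R) (x xi : R) :=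
  cos (xi * x) * cosT f xi + sin (xi * x) * sinT f xi.

Section dominated.
Variables (f : R -> R) (K : R).
Hypothesis cf : continuous f.
Hypothesis fK : forall x, `|f x| <= K * cauchy_kernel x.

Let mf : measurable_fun setT f.
Proof. exact: continuous_measurable_fun. Qed.

(** All integrands below are a bounded oscillation times [f]. *)
Lemma trig_dominated (g : R -> R) : measurable_fun setT g -> (forall x, `|g x| <= 1) ->
  measurable_fun setT (fun x => g x * f x) /\
  (forall x, `|g x * f x| <= K * cauchy_kernel x).
Proof.
move=> mg g1; split; first exact: measurable_funM.
by move=> x; rewrite normrM (le_trans _ (fK x))// ler_piMl.
Qed.

Let mcos xi : measurable_fun setT (fun x : R => cos (xi * x)).
Proof. by apply: continuous_measurable_fun; exact: continuous_cosM. Qed.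
Let msin xi : measurable_fun setT (fun x : R => sin (xi * x)).
Proof. by apply: continuous_measurable_fun; exact: continuous_sinM. Qed.

Lemma integrable_cosT xi : mu.-integrable setT (EFin \o (fun x => cos (xi * x) * f x)).
Proof.
have [m b] := trig_dominated (mcos xi) (fun x => normr_cos_le1 _).
exact: integrable_cauchy_dominated b.
Qed.

Lemma integrable_sinT xi : mu.-integrable setT (EFin \o (fun x => sin (xi * x) * f x)).
Proof.
have [m b] := trig_dominated (msin xi) (fun x => normr_sin_le1 _).
exact: integrable_cauchy_dominated b.
Qed.

Lemma cosT_bound xi : `|cosT f xi| <= K * pi.
Proof.
have [m b] := trig_dominated (mcos xi) (fun x => normr_cos_le1 _).
exact: integral_cauchy_dominated.
Qed.

Lemma sinT_bound xi : `|sinT f xi| <= K * pi.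
Proof.
have [m b] := trig_dominated (msin xi) (fun x => normr_sin_le1 _).
exact: integral_cauchy_dominated.
Qed.

Let continuous_param (g : R -> R) : continuous g -> (forall x, `|g x| <= 1) ->
  (forall xi, mu.-integrable setT (EFin \o (fun x => g (xi * x) * f x))) ->
  continuous (fun xi : R => \int[mu]_x (g (xi * x) * f x)).
Proof.
move=> cg g1 ig xi.
have iK : mu.-integrable setT (EFin \o (fun x => K * cauchy_kernel x)).
  exact: (@integrable_mulr _ _ R mu _ measurableT K cauchy_kernel integrable_cauchy_kernel).
apply: (@continuity_under_integral R _ _ mu (fun xi x => g (xi * x) * f x) setT measurableT
  (xi - 1) (xi + 1) _ _ (fun x => K * cauchy_kernel x) iK).
- by move=> x _; exact: ig.
- apply: aeW => x _ y _; apply: cvgM; last exact: cvg_cst.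
  apply: continuous_comp; last exact: cg.
  by apply: cvgM; [exact: cvg_id|exact: cvg_cst].
- move=> y _; apply: aeW => x _.
  by rewrite normrM (le_trans _ (fK x))// ler_piMl.
- by rewrite inE /= in_itv/= gtrDl ltrDl oppr_lt0 ltr01.
Qed.

Lemma continuous_cosT : continuous (cosT f).
Proof.
apply: continuous_param; [exact: continuous_cos|exact: normr_cos_le1|].
exact: integrable_cosT.
Qed.

Lemma continuous_sinT : continuous (sinT f).
Proof.
apply: continuous_param; [exact: continuous_sin|exact: normr_sin_le1|].
exact: integrable_sinT.
Qed.

Lemma sinTN xi : sinT f (- xi) = - sinT f xi.
Proof.
rewrite -[RHS]mulN1r /sinT -RintegralZl//; last exact: integrable_sinT.
by apply: eq_Rintegral => x _; rewrite mulNr sinN mulN1r mulNr.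
Qed.

End dominated.

Lemma cosTN f xi : cosT f (- xi) = cosT f xi.
Proof. by apply: eq_Rintegral => x _; rewrite mulNr cosN. Qed.

Section derivative.
Variables (f f' : R -> R) (K : R).
Hypothesis df : forall x : R, is_derive x 1 f (f' x).
Hypothesis cf' : continuous f'.
Hypothesis fK : forall x, `|f x| <= K * cauchy_kernel x.
Hypothesis f'K : forall x, `|f' x| <= K * cauchy_kernel x.

Let cf : continuous f.
Proof.
move=> x; apply: differentiable_continuous; apply/derivable1_diffP.
by have /@ex_derive := df x.
Qed.

Let parts (g g' : R -> R) (xi : R) : (forall x : R, is_derive x 1 g (xi * g' x)) ->
  continuous g -> continuous g' -> (forall x, `|g x| <= 1) -> (forall x, `|g' x| <= 1) ->
  xi * \int[mu]_x (g' x * f x) = - \int[mu]_x (g x * f' x).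
Proof.
move=> dg cg cg' g1 g'1.
have mg := continuous_measurable_fun cg; have mg' := continuous_measurable_fun cg'.
have [m1 b1] := trig_dominated cf fK mg' g'1.
have [m2 b2] := trig_dominated cf' f'K mg g1.
have [m3 b3] := trig_dominated cf fK mg g1.
have i1 := integrable_cauchy_dominated m1 b1.
have i2 := integrable_cauchy_dominated m2 b2.
have i1' : mu.-integrable setT (EFin \o (fun x => xi * (g' x * f x))).
  exact: (@integrable_mulr _ _ R mu _ measurableT xi _ i1).
have [l1 l2] := cvg_cauchy_dominated b3.
have dgf (x : R) : is_derive x 1 (fun x => g x * f x) (xi * (g' x * f x) + g x * f' x).
  have := is_deriveM (dg x) (df x); rewrite (_ : g * f = (fun x => g x * f x))//.
  by move/is_derive_eq; apply; rewrite /GRing.scale/=; ring.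
have ch : continuous (fun x => xi * (g' x * f x) + g x * f' x).
  move=> x; apply: cvgD; last by apply: cvgM; [exact: cg|exact: cf'].
  by apply: cvgM; [exact: cvg_cst|apply: cvgM; [exact: cg'|exact: cf]].
have ih : mu.-integrable setT (EFin \o (fun x => xi * (g' x * f x) + g x * f' x)).
  exact: (@integrable_addr _ _ R mu _ measurableT _ _ i1' i2).
have := FTC_line dgf ch ih l1 l2.
by rewrite RintegralD// RintegralZl// subrr => /eqP; rewrite addr_eq0 => /eqP.
Qed.

(** Integration by parts without boundary terms, [f] vanishing at infinity. *)
Lemma cosT_parts xi : xi * cosT f xi = - sinT f' xi.
Proof.
apply: (parts (g := fun x => sin (xi * x)) (g' := fun x => cos (xi * x))).
- by move=> x; exact: is_derive_sinM.
- exact: continuous_sinM.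
- exact: continuous_cosM.
- by move=> x; exact: normr_sin_le1.
- by move=> x; exact: normr_cos_le1.
Qed.

Lemma sinT_parts xi : xi * sinT f xi = cosT f' xi.
Proof.
have := @parts (fun x => cos (xi * x)) (fun x => sin (xi * x)) (- xi).
rewrite mulNr => /(_ _ _ _ _ _)/oppr_inj; apply.
- by move=> x; rewrite mulNr; exact: is_derive_cosM.
- exact: continuous_cosM.
- exact: continuous_sinM.
- by move=> x; exact: normr_cos_le1.
- by move=> x; exact: normr_sin_le1.
Qed.

End derivative.

Section smooth.
Variables (F : nat -> R -> R) (K : R).
Hypothesis dF : forall n (x : R), is_derive x 1 (F n) (F n.+1 x).
Hypothesis FK : forall n x, (n <= 4)%N -> `|F n x| <= K * cauchy_kernel x.

Lemma smooth_continuous n : continuous (F n).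
Proof.
move=> x; apply: differentiable_continuous; apply/derivable1_diffP.
by have /@ex_derive := dF n x.
Qed.

(** Four integrations by parts. *)
Lemma trig_decay xi :
  (1 + xi ^+ 4) * `|cosT (F 0%N) xi| <= 2 * (K * pi) /\
  (1 + xi ^+ 4) * `|sinT (F 0%N) xi| <= 2 * (K * pi).
Proof.
have c n : (n <= 3)%N -> xi * cosT (F n) xi = - sinT (F n.+1) xi.
  move=> n3; apply: (@cosT_parts (F n) (F n.+1) K) => //; first exact: smooth_continuous.
  - by move=> x; apply: FK; exact: leqW.
  - by move=> x; exact: FK.
have s n : (n <= 3)%N -> xi * sinT (F n) xi = cosT (F n.+1) xi.
  move=> n3; apply: (@sinT_parts (F n) (F n.+1) K) => //; first exact: smooth_continuous.
  - by move=> x; apply: FK; exact: leqW.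
  - by move=> x; exact: FK.
have c4 : xi ^+ 4 * cosT (F 0%N) xi = cosT (F 4%N) xi.
  transitivity (xi * (xi * (xi * (xi * cosT (F 0%N) xi)))); first by ring.
  by rewrite (c 0%N)// (mulrN xi) (s 1%N)// !(mulrN xi) (c 2%N)// (mulrN xi) opprK (s 3%N).
have s4 : xi ^+ 4 * sinT (F 0%N) xi = sinT (F 4%N) xi.
  transitivity (xi * (xi * (xi * (xi * sinT (F 0%N) xi)))); first by ring.
  by rewrite (s 0%N)// (c 1%N)// !(mulrN xi) (s 2%N)// (c 3%N)// opprK.
have x4 : 0 <= xi ^+ 4 by rewrite exprn_even_ge0.
have b0 := cosT_bound (smooth_continuous (n := 0%N)) (fun x => @FK 0%N x isT) xi.
have b4 := cosT_bound (smooth_continuous (n := 4%N)) (fun x => @FK 4%N x isT) xi.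
have t0 := sinT_bound (smooth_continuous (n := 0%N)) (fun x => @FK 0%N x isT) xi.
have t4 := sinT_bound (smooth_continuous (n := 4%N)) (fun x => @FK 4%N x isT) xi.
split; rewrite mulrDl mul1r -{1}(ger0_norm x4) -normrM ?c4 ?s4 -natr1 mulrDl mul1r.
  by rewrite lerD.
by rewrite lerD.
Qed.

End smooth.
End trig_transforms.

Section inversion.
Context {R : realType}.
Notation mu := (@lebesgue_measure R).

(** The Poisson kernel of the half-plane, up to the factor [pi]. *)
Definition poisson_kernel (eps z : R) := eps / (eps ^+ 2 + z ^+ 2).

(** The sine transform of the translate [f (x + .)]. *)
Definition sinTs (f : R -> R) (x xi : R) :=
  cos (xi * x) * sinT f xi - sin (xi * x) * cosT f xi.

Variables (F : nat -> R -> R) (K : R).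
Hypothesis dF : forall n (x : R), is_derive x 1 (F n) (F n.+1 x).
Hypothesis FK : forall n x, (n <= 4)%N -> `|F n x| <= K * cauchy_kernel x.

Let f := F 0%N.
Let M := 8 * (K * pi).

Let cf : continuous f.
Proof. exact: (smooth_continuous dF). Qed.

Let fK x : `|f x| <= K * cauchy_kernel x.
Proof. exact: FK. Qed.

Let K0 : 0 <= K.
Proof.
have := le_trans (normr_ge0 _) (fK 0).
by rewrite pmulr_lge0// cauchy_kernel_gt0.
Qed.

Let combination (a b c s xi : R) : `|c| <= 1 -> `|s| <= 1 ->
  (1 + xi ^+ 4) * `|a| <= 2 * (K * pi) -> (1 + xi ^+ 4) * `|b| <= 2 * (K * pi) ->
  (1 + xi ^+ 2) * `|c * a + s * b| <= M * cauchy_kernel xi.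
Proof.
move=> c1 s1 a1 b1; rewrite ler_pdivlMr; last by rewrite ltr_pwDl// sqr_ge0.
have ab : `|c * a + s * b| <= `|a| + `|b|.
  by rewrite (le_trans (ler_normD _ _))// lerD// normrM ler_piMl.
have := normr_ge0 a; have := normr_ge0 b; have := normr_ge0 (c * a + s * b).
have : 0 <= (1 - xi ^+ 2) ^+ 2 by exact: sqr_ge0.
have : 0 <= (1 + xi ^+ 2) ^+ 2 by exact: sqr_ge0.
set n := `|c * a + s * b| in ab *; set A := `|a| in ab a1 *; set B := `|b| in ab b1 *.
move=> h1 h2 n0 B0 A0.
have -> : (1 + xi ^+ 2) * n * (1 + xi ^+ 2) = (1 + xi ^+ 2) ^+ 2 * n by ring.
apply: (@le_trans _ _ (2 * (1 + xi ^+ 4) * n)).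
  rewrite ler_wpM2r// -subr_ge0; apply: le_trans h2 _.
  by rewrite le_eqVlt; apply/orP; left; apply/eqP; ring.
apply: (@le_trans _ _ (2 * (1 + xi ^+ 4) * (A + B))).
  by rewrite ler_wpM2l// mulr_ge0// addr_ge0// exprn_even_ge0.
by rewrite /M; lra.
Qed.

(** The weight [1 + xi^2] will absorb the growth of the symbol. *)
Lemma cosTs_bound x xi : (1 + xi ^+ 2) * `|cosTs f x xi| <= M * cauchy_kernel xi.
Proof.
have [a b] := trig_decay dF FK xi.
by apply: combination => //; [exact: normr_cos_le1|exact: normr_sin_le1].
Qed.

Lemma sinTs_bound x xi : (1 + xi ^+ 2) * `|sinTs f x xi| <= M * cauchy_kernel xi.
Proof.
have [a b] := trig_decay dF FK xi; rewrite /sinTs -mulNr.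
by apply: combination => //; rewrite ?normrN; [exact: normr_cos_le1|exact: normr_sin_le1].
Qed.

Let le_1sqr (xi a : R) : `|a| <= (1 + xi ^+ 2) * `|a|.
Proof. by rewrite ler_peMl// lerDl sqr_ge0. Qed.

Lemma cosTs_dominated x xi : `|cosTs f x xi| <= M * cauchy_kernel xi.
Proof. exact: le_trans (le_1sqr _ _) (cosTs_bound x xi). Qed.

Let continuous_cosx (x : R) : continuous (fun xi : R => cos (xi * x)).
Proof.
rewrite (_ : (fun xi => _) = (fun xi => cos (x * xi))); first exact: continuous_cosM.
by apply/funext => xi; rewrite mulrC.
Qed.

Let continuous_sinx (x : R) : continuous (fun xi : R => sin (xi * x)).
Proof.
rewrite (_ : (fun xi => _) = (fun xi => sin (x * xi))); first exact: continuous_sinM.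
by apply/funext => xi; rewrite mulrC.
Qed.

Lemma continuous_cosTs x : continuous (cosTs f x).
Proof.
move=> xi; apply: cvgD; apply: cvgM.
- exact: continuous_cosx.
- exact: (continuous_cosT cf fK).
- exact: continuous_sinx.
- exact: (continuous_sinT cf fK).
Qed.

Lemma continuous_sinTs x : continuous (sinTs f x).
Proof.
move=> xi; apply: cvgB; apply: cvgM.
- exact: continuous_cosx.
- exact: (continuous_sinT cf fK).
- exact: continuous_sinx.
- exact: (continuous_cosT cf fK).
Qed.

Lemma cosTsE x xi : cosTs f x xi = \int[mu]_u (cos (xi * (u - x)) * f u).
Proof.
have ic := integrable_cosT cf fK xi; have is_ := integrable_sinT cf fK xi.
have ic' := @integrable_mulr _ _ R mu _ measurableT (cos (xi * x)) _ ic.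
have is' := @integrable_mulr _ _ R mu _ measurableT (sin (xi * x)) _ is_.
rewrite /cosTs /cosT /sinT -!RintegralZl// -RintegralD//.
by apply: eq_Rintegral => u _; rewrite mulrBr cosB; ring.
Qed.

(** The Abel kernel [exp(-eps xi)] makes the double integral absolutely
    convergent; integrating it first turns [f] into its Poisson integral. *)
Lemma damped_cosTs (eps x : R) : 0 < eps ->
  \int[mu]_(xi in `]0, +oo[) (expR (- (eps * xi)) * cosTs f x xi) =
  \int[mu]_u (f u * poisson_kernel eps (u - x)).
Proof.
move=> e0.
pose h (xi u : R) := expR (- (eps * xi)) * (cos (xi * (u - x)) * f u).
have ie : mu.-integrable `]0, +oo[ (EFin \o (fun xi => expR (- (eps * xi)))).
  by apply: integrableS (damped_exp e0) => //; apply: subset_itvr; rewrite bnd_simp.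
have iK : mu.-integrable setT (EFin \o (fun x => K * cauchy_kernel x)).
  exact: (@integrable_mulr _ _ R mu _ measurableT K cauchy_kernel integrable_cauchy_kernel).
have mh : measurable_fun setT (fun z : measurableTypeR R * measurableTypeR R => h z.1 z.2).
  have m1 : measurable_fun setT (fun xi : measurableTypeR R => expR (- (eps * xi))).
    by apply: continuous_measurable_fun; exact: continuous_expRN.
  have m2 : measurable_fun setT (cos : measurableTypeR R -> R).
    by apply: continuous_measurable_fun; exact: continuous_cos.
  have m3 : measurable_fun setT (f : measurableTypeR R -> R).
    exact: continuous_measurable_fun.
  apply: measurable_funM; first exact: (measurableT_comp m1 measurable_fst).
  apply: measurable_funM; last exact: (measurableT_comp m3 measurable_snd).
  apply: (measurableT_comp m2); apply: measurable_funM; first exact: measurable_fst.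
  by apply: measurable_funB => //; exact: measurable_snd.
have hK xi u : `|h xi u| <= expR (- (eps * xi)) * (K * cauchy_kernel u).
  rewrite normrM ger0_norm ?expR_ge0// ler_wpM2l ?expR_ge0//.
  by rewrite normrM (le_trans _ (fK u))// ler_piMl// normr_cos_le1.
have iu xi : mu.-integrable setT (EFin \o (fun u => cos (xi * (u - x)) * f u)).
  have mg : measurable_fun setT (fun u : R => cos (xi * (u - x))).
    apply: measurableT_comp.
      by apply: continuous_measurable_fun; exact: continuous_cos.
    by apply: measurable_funM => //; exact: measurable_funB.
  have [m b] := trig_dominated cf fK mg (fun u => normr_cos_le1 _).
  exact: integrable_cauchy_dominated b.
have ix z : mu.-integrable `]0, +oo[ (EFin \o (fun xi => expR (- (eps * xi)) * cos (xi * z))).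
  apply: (@integrable_dominated _ _ R mu _ _ _ _ _ ie) => //.
    apply: measurable_funTS; apply: continuous_measurable_fun => xi.
    by apply: cvgM; [exact: continuous_expRN|exact: continuous_cosx].
  by move=> xi _; rewrite normrM ger0_norm ?expR_ge0// ler_piMr ?expR_ge0// normr_cos_le1.
transitivity (\int[mu]_(xi in `]0, +oo[) \int[mu]_u h xi u).
  apply: eq_Rintegral => xi _; rewrite cosTsE.
  by rewrite -[LHS](@RintegralZl _ _ R mu _ _ _ measurableT (iu xi)).
have [_ ->] := @Rintegral_fubini _ _ _ _ R mu mu `]0, +oo[%classic setT h _ _
  (measurable_itv _) measurableT mh ie iK (fun xi u _ _ => hK xi u).
apply: eq_Rintegral => u _; rewrite /poisson_kernel -(damped_cos _ e0).
rewrite -[RHS](@RintegralZl _ _ R mu _ _ _ (measurable_itv _) (ix (u - x))).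
by apply: eq_Rintegral => xi _; rewrite /h; ring.
Qed.

Let poisson_pos (eps z : R) : 0 < eps -> 0 < eps ^+ 2 + z ^+ 2.
Proof. by move=> e0; rewrite ltr_pwDl ?exprn_gt0// sqr_ge0. Qed.

(** The substitution [u = eps s + x], after which [eps] is only left in the argument
    of [f]. *)
Lemma poisson_rescale (eps x : R) : 0 < eps ->
  \int[mu]_u (f u * poisson_kernel eps (u - x)) =
  \int[mu]_s (f (eps * s + x) * cauchy_kernel s).
Proof.
move=> e0.
have iP : mu.-integrable setT (EFin \o (fun u : R => f u * poisson_kernel eps (u - x))).
  apply: (@integrable_cauchy_dominated _ _ (eps^-1 * K)).
    apply: measurable_funM; first exact: continuous_measurable_fun.
    apply: measurable_funM => //; apply: continuous_measurable_fun => u.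
    apply: cvgV; first by rewrite gt_eqF// poisson_pos.
    apply: cvgD; first exact: cvg_cst.
    apply: (@continuous_comp _ _ _ (fun u : R => u - x) (fun v : R => v ^+ 2)).
      by apply: cvgB; [exact: cvg_id|exact: cvg_cst].
    exact: exprn_continuous.
  move=> u; have n0 := poisson_pos (u - x) e0.
  rewrite normrM mulrC -mulrA; apply: ler_pM => //.
  rewrite /poisson_kernel ger0_norm ?divr_ge0 ?(ltW e0) ?(ltW n0)//.
  rewrite ler_pdivrMr// mulrC ler_pdivlMr//.
  by rewrite -expr2 lerDl sqr_ge0.
have en0 : eps != 0 by rewrite gt_eqF.
rewrite (@Rintegral_affine _ eps x en0 _ iP) gtr0_norm//.
rewrite -[LHS](@RintegralZl _ _ R mu _ _ eps measurableT (@integrable_affine _ eps x en0 _ iP)).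
apply: eq_Rintegral => s _; rewrite addrK /cauchy_kernel /poisson_kernel.
have s0 : 1 + s ^+ 2 != 0 by rewrite gt_eqF// ltr_pwDl// sqr_ge0.
have e1 : eps ^+ 2 + (eps * s) ^+ 2 != 0 by rewrite gt_eqF// poisson_pos.
by field; rewrite s0 e1.
Qed.

(** Abel summation: both sides of [damped_cosTs] converge as [eps] tends to [0],
    by domination. *)
Theorem cosine_inversion x : \int[mu]_(xi in `]0, +oo[) cosTs f x xi = pi * f x.
Proof.
pose eps n : R := n.+1%:R^-1.
have eps0 n : 0 < eps n by rewrite invr_gt0.
have ceps : eps n @[n --> \oo] --> (0 : R) by exact: cvg_harmonic.
have mC : measurable_fun setT (cosTs f x).
  by apply: continuous_measurable_fun; exact: continuous_cosTs.
have iMk : mu.-integrable `]0, +oo[ (EFin \o (fun xi => M * cauchy_kernel xi)).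
  apply: integrableS (@integrable_mulr _ _ R mu _ measurableT M cauchy_kernel
    integrable_cauchy_kernel) => //.
have l1 : \int[mu]_(xi in `]0, +oo[) (expR (- (eps n * xi)) * cosTs f x xi)
    @[n --> \oo] --> \int[mu]_(xi in `]0, +oo[) cosTs f x xi.
  apply: (@cvg_Rintegral_dominated _ _ R mu `]0, +oo[%classic _ _
    (fun xi => M * cauchy_kernel xi)) => //.
  - move=> n; apply: measurable_funTS; apply: measurable_funM => //.
    by apply: continuous_measurable_fun; exact: continuous_expRN.
  - exact: measurable_funTS.
  - move=> xi _; rewrite -[X in _ --> X]mul1r; apply: cvgM; last exact: cvg_cst.
    rewrite -(@expR0 R) -oppr0 -(mul0r xi); apply: continuous_cvg.
      exact: continuous_expR.
    by apply: cvgN; apply: cvgM => //; exact: cvg_cst.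
  - move=> n xi /=; rewrite in_itv/= andbT => xi0.
    rewrite (le_trans _ (cosTs_dominated x xi))// normrM ler_piMl//.
    by rewrite ger0_norm ?expR_ge0// expR_le1 oppr_le0 mulr_ge0// ltW.
have l2 : \int[mu]_s (f (eps n * s + x) * cauchy_kernel s) @[n --> \oo] -->
    \int[mu]_s (f x * cauchy_kernel s).
  have mk : measurable_fun setT (@cauchy_kernel R).
    by apply: continuous_measurable_fun; exact: continuous_cauchy_kernel.
  have iK : mu.-integrable setT (EFin \o (fun x => K * cauchy_kernel x)).
    exact: (@integrable_mulr _ _ R mu _ measurableT K cauchy_kernel integrable_cauchy_kernel).
  apply: (@cvg_Rintegral_dominated _ _ R mu setT _ _ (fun xi => K * cauchy_kernel xi)) => //.
  - move=> n; apply: measurable_funM => //.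
    apply: measurableT_comp; first exact: continuous_measurable_fun.
    by apply: measurable_funD => //; exact: measurable_funM.
  - exact: measurable_funM.
  - move=> s _; apply: cvgM; last exact: cvg_cst.
    rewrite -[X in f X]add0r -(mul0r s); apply: continuous_cvg; first exact: cf.
    by apply: cvgD; [apply: cvgM => //; exact: cvg_cst|exact: cvg_cst].
  - move=> n s _; have k0 := cauchy_kernel_gt0 s.
    rewrite normrM (gtr0_norm k0) ler_wpM2r ?(ltW k0)//.
    rewrite (le_trans (fK _))// ler_piMr//.
    by rewrite invf_le1 ?lerDl ?sqr_ge0// ltr_pwDl ?sqr_ge0.
rewrite (_ : (fun n => \int[mu]_(xi in _) _) =
    (fun n => \int[mu]_s (f (eps n * s + x) * cauchy_kernel s))) in l1; last first.
  by apply/funext => n; rewrite damped_cosTs// poisson_rescale.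
transitivity (\int[mu]_s (f x * cauchy_kernel s)).
  exact: cvg_unique l1 l2.
transitivity (f x * \int[mu]_s cauchy_kernel s).
  by apply: RintegralZl => //; exact: integrable_cauchy_kernel.
by rewrite integral_cauchy_kernel mulrC.
Qed.

End inversion.

(** * The Fourier multiplier as an integral over the jumps *)

Section multiplier.
Context {R : realType}.
Notation mu := (@lebesgue_measure R).
Variable alpha : R.
Hypotheses (alpha_gt0 : 0 < alpha) (alpha_lt1 : alpha < 1).

Let min_sqr (y : R) : 0 <= y -> 0 <= Num.min 1 (y ^+ 2) /\ Num.min 1 (y ^+ 2) <= Num.min 1 y.
Proof.
move=> y0; split; first by rewrite le_min ler01 sqr_ge0.
case: (leP 1 y) => y1; first by rewrite ge_min lexx.
by rewrite ge_min expr2 ler_piMl ?orbT// ltW.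
Qed.

(** Separating [xi] from [y]: the bound is a product, as Fubini's theorem
    requires. *)
Lemma cos_jump_bound (xi y : R) : 0 <= y ->
  `|1 - cos (xi * y)| <= 4 * (1 + xi ^+ 2) * Num.min 1 y.
Proof.
move=> y0; apply: le_trans (cos_levy_bound xi y0) _.
have [h1 h2] := min_sqr y0.
by apply: ler_pM => //; have := sqr_ge0 xi; lra.
Qed.

Lemma sin_jump_bound (xi y : R) : 0 <= y ->
  `|sin (xi * y)| <= 4 * (1 + xi ^+ 2) * Num.min 1 y.
Proof.
move=> y0; have [h1 h2] := min_sqr y0.
have /expR_bounds[e1 e2 e3 _] : 0 <= 1 * y by rewrite mul1r.
have e4 : 1 - expR (- (1 * y)) <= Num.min 1 y by rewrite le_min e2/= -[X in _ <= X]mul1r.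
rewrite -[sin _](subrK (xi * (1 - expR (- (1 * y))))).
apply: le_trans (ler_normD _ _) _.
have := sin_levy_bound xi y0; set L := `|_|; move=> hL.
rewrite normrM (ger0_norm e1).
have s0 := sqr_ge0 xi; have n0 := normr_ge0 xi.
have ns : `|xi| <= (1 + xi ^+ 2) / 2.
  by have := sqr_ge0 (`|xi| - 1); rewrite sqrrB1 real_normK ?num_real//; lra.
set m := Num.min 1 y in e4 h2 *; set m2 := Num.min _ _ in hL h1 h2.
have : `|xi| * (1 - expR (- (1 * y))) <= `|xi| * m by rewrite ler_wpM2l.
have : (1 + `|xi| + (xi ^+ 2 + `|xi|)) * m2 <= (1 + `|xi| + (xi ^+ 2 + `|xi|)) * m.
  by rewrite ler_wpM2l//; lra.
have m0 : 0 <= m by exact: le_trans h2.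
have : `|xi| * m <= (1 + xi ^+ 2) / 2 * m by rewrite ler_wpM2r.
by nra.
Qed.

Let integrable_jump (G : R -> R) C : measurable_fun setT G ->
  (forall y : R, 0 <= y -> `|G y| <= C * Num.min 1 y) ->
  mu.-integrable `]0, +oo[ (EFin \o (fun y => G y * y `^ (- alpha - 1))).
Proof.
move=> mG GC; apply: (integrable_levy alpha_gt0 alpha_lt1 (C := C)) => // y y0.
by apply: GC; exact: ltW.
Qed.

Lemma integrable_cos_levy xi :
  mu.-integrable `]0, +oo[ (EFin \o (fun y => (1 - cos (xi * y)) * y `^ (- alpha - 1))).
Proof.
apply: integrable_jump (fun y => @cos_jump_bound xi y).
apply: measurable_funB => //; apply: continuous_measurable_fun; exact: continuous_cosM.
Qed.

Lemma integrable_sin_levy xi :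
  mu.-integrable `]0, +oo[ (EFin \o (fun y => sin (xi * y) * y `^ (- alpha - 1))).
Proof.
apply: integrable_jump (fun y => @sin_jump_bound xi y).
apply: continuous_measurable_fun; exact: continuous_sinM.
Qed.

Lemma cos_levyN xi : cos_levy alpha (- xi) = cos_levy alpha xi.
Proof. by apply: eq_Rintegral => y _; rewrite mulNr cosN. Qed.

Lemma sin_levyN xi : sin_levy alpha (- xi) = - sin_levy alpha xi.
Proof.
rewrite -[RHS]mulN1r /sin_levy /levy_integral -RintegralZl//; last exact: integrable_sin_levy.
by apply: eq_Rintegral => y _; rewrite mulNr sinN mulN1r mulNr.
Qed.

(** The increment is bounded both by the supremum of [g] and by the mean value
    theorem. *)
Lemma increment_bound (g g' : R -> R) (C a b : R) :
  (forall x : R, is_derive x 1 g (g' x)) -> (forall x, `|g x| <= C) ->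
  (forall x, `|g' x| <= C) -> `|g a - g b| <= 2 * C * Num.min 1 `|a - b|.
Proof.
move=> dg gC g'C.
wlog ab : a b / a <= b.
  by have [ab|/ltW ba] := leP a b => [|h]; [exact|rewrite distrC (distrC a); exact: h].
have C0 : 0 <= C by exact: le_trans (normr_ge0 _) (gC 0).
have h1 : `|g a - g b| <= 2 * C.
  by rewrite (le_trans (ler_normB _ _))// -natr1 mulrDl mul1r lerD.
have [->|anb] := eqVneq a b; first by rewrite !subrr normr0 (min_idPr ler01) mulr0.
have {anb}ab' : a < b by rewrite lt_neqAle anb.
have cg : {within `[a, b], continuous g}.
  apply: continuous_subspaceT => x; apply: differentiable_continuous.
  by apply/derivable1_diffP; have /@ex_derive := dg x.
have [c _ E] := MVT ab' (fun x _ => dg x) cg.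
have h2 : `|g a - g b| <= 2 * C * `|a - b|.
  rewrite distrC E normrM (distrC b) ler_wpM2r// (le_trans (g'C c))//.
  by rewrite ler_peMl// ler1n.
by case: (leP 1 `|a - b|) => _; rewrite ?mulr1.
Qed.

Section exchange.
Variables (A B : R -> R) (C : R) (D : set R).
Hypotheses (cA : continuous A) (cB : continuous B).
Hypothesis AC : forall xi, (1 + xi ^+ 2) * `|A xi| <= C * cauchy_kernel xi.
Hypothesis BC : forall xi, (1 + xi ^+ 2) * `|B xi| <= C * cauchy_kernel xi.
Hypothesis mD : measurable D.

(** [A] and [B] are the transforms of [f], which decay fast enough to compensate
    the growth of the two jump integrals in [xi]. *)
Lemma multiplier_fubini :
  mu.-integrable D (EFin \o (fun xi => cos_levy alpha xi * A xi + sin_levy alpha xi * B xi)) /\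
  \int[mu]_(xi in D) (cos_levy alpha xi * A xi + sin_levy alpha xi * B xi) =
  \int[mu]_(y in `]0, +oo[) \int[mu]_(xi in D)
    (((1 - cos (xi * y)) * A xi + sin (xi * y) * B xi) * y `^ (- alpha - 1)).
Proof.
pose h xi y := ((1 - cos (xi * y)) * A xi + sin (xi * y) * B xi) * y `^ (- alpha - 1).
have E xi : cos_levy alpha xi * A xi + sin_levy alpha xi * B xi =
    \int[mu]_(y in `]0, +oo[) h xi y.
  have i1 := integrable_cos_levy xi; have i2 := integrable_sin_levy xi.
  have i1' := @integrable_mulr _ _ R mu _ (measurable_itv _) (A xi) _ i1.
  have i2' := @integrable_mulr _ _ R mu _ (measurable_itv _) (B xi) _ i2.
  rewrite /cos_levy /sin_levy /levy_integral.
  rewrite mulrC (mulrC _ (B xi)) -!RintegralZl// -RintegralD//.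
  by apply: eq_Rintegral => y _; rewrite /h; ring.
have iC : mu.-integrable D (EFin \o (fun xi => (8 * C) * cauchy_kernel xi)).
  apply: integrableS (@integrable_mulr _ _ R mu _ measurableT (8 * C) cauchy_kernel
    integrable_cauchy_kernel) => //.
have mh : measurable_fun setT (fun z : measurableTypeR R * measurableTypeR R => h z.1 z.2).
  have m1 : measurable_fun setT (A : measurableTypeR R -> R) by exact: continuous_measurable_fun.
  have m2 : measurable_fun setT (B : measurableTypeR R -> R) by exact: continuous_measurable_fun.
  have m3 : measurable_fun setT (cos : measurableTypeR R -> R).
    by apply: continuous_measurable_fun; exact: continuous_cos.
  have m4 : measurable_fun setT (sin : measurableTypeR R -> R).
    by apply: continuous_measurable_fun; exact: continuous_sin.
  have m5 : measurable_fun setT ((@powR R ^~ (- alpha - 1)) : measurableTypeR R -> R).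
    exact: measurable_powR.
  have m6 : measurable_fun setT
      (fun z : measurableTypeR R * measurableTypeR R => z.1 * z.2 : R).
    by apply: measurable_funM; [exact: measurable_fst|exact: measurable_snd].
  apply: measurable_funM; last exact: (measurableT_comp m5 measurable_snd).
  apply: measurable_funD; apply: measurable_funM.
  - by apply: measurable_funB => //; exact: (measurableT_comp m3 m6).
  - exact: (measurableT_comp m1 measurable_fst).
  - exact: (measurableT_comp m4 m6).
  - exact: (measurableT_comp m2 measurable_fst).
have hC (xi y : R) : D xi -> `]0, +oo[%classic y ->
    `|h xi y| <= (8 * C) * cauchy_kernel xi * jump_weight alpha y.
  move=> _ /=; rewrite in_itv/= andbT => y0.
  rewrite /h normrM (ger0_norm (powR_ge0 _ _)) /jump_weight mulrA ler_wpM2r ?powR_ge0//.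
  have c := cos_jump_bound xi (ltW y0); have s := sin_jump_bound xi (ltW y0).
  have m0 : 0 <= Num.min 1 y by rewrite le_min ler01 ltW.
  apply: (@le_trans _ _ (4 * (1 + xi ^+ 2) * Num.min 1 y * (`|A xi| + `|B xi|))).
    by rewrite (le_trans (ler_normD _ _))// !normrM mulrDr lerD// ler_wpM2r.
  rewrite (_ : 4 * (1 + xi ^+ 2) * Num.min 1 y * (`|A xi| + `|B xi|) =
    (4 * ((1 + xi ^+ 2) * `|A xi| + (1 + xi ^+ 2) * `|B xi|)) * Num.min 1 y); last by ring.
  by rewrite ler_wpM2r//; have := AC xi; have := BC xi; lra.
have [i1 Fub] := @Rintegral_fubini _ _ _ _ R mu mu D `]0, +oo[%classic h _ _
  mD (measurable_itv _) mh iC (integrable_jump_weight alpha_gt0 alpha_lt1) hC.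
split.
  have E' : (fun xi : R => (\int[mu]_(y in `]0, +oo[) h xi y)%:E) =
      EFin \o (fun xi => cos_levy alpha xi * A xi + sin_levy alpha xi * B xi).
    by apply/funext => xi; rewrite /= E.
  rewrite -E'.
  exact: i1.
by rewrite -[RHS]Fub; apply: eq_Rintegral => xi _; exact: E.
Qed.

End exchange.

Section smooth.
Variables (p q : R).
Hypotheses (p0 : 0 <= p) (q0 : 0 <= q) (pq1 : p + q = 1).
Variables (F : nat -> R -> R) (K : R).
Hypothesis dF : forall n (x : R), is_derive x 1 (F n) (F n.+1 x).
Hypothesis FK : forall n x, (n <= 4)%N -> `|F n x| <= K * cauchy_kernel x.

Let f := F 0%N.
Let M := 8 * (K * pi).
Let r := p - q.

Let r1 : `|r| <= 1.
Proof.
move: p0 q0 pq1 => p0' q0' e; rewrite ler_norml /r.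
by apply/andP; split; lra.
Qed.

Let scaled_bound (a : R -> R) (s : R) : `|s| <= 1 ->
  (forall xi, (1 + xi ^+ 2) * `|a xi| <= M * cauchy_kernel xi) ->
  forall xi, (1 + xi ^+ 2) * `|s * a xi| <= M * cauchy_kernel xi.
Proof.
move=> s1 aM xi; apply: le_trans (aM xi); rewrite ler_wpM2l ?addr_ge0 ?sqr_ge0//.
by rewrite normrM ler_piMl.
Qed.

Let cosTs_sub x y xi :
  cosTs f (x - y) xi = cos (xi * y) * cosTs f x xi - sin (xi * y) * sinTs f x xi.
Proof. by rewrite /cosTs /sinTs mulrBr cosB sinB; ring. Qed.

Let cosTs_add x y xi :
  cosTs f (x + y) xi = cos (xi * y) * cosTs f x xi + sin (xi * y) * sinTs f x xi.
Proof. by rewrite /cosTs /sinTs mulrDr cosD sinD; ring. Qed.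

Let cosTsN x xi : cosTs f x (- xi) = cosTs f x xi.
Proof.
rewrite /cosTs cosTN (sinTN (smooth_continuous dF (n := 0%N)) (fun x => @FK 0%N x isT)).
by rewrite mulNr cosN sinN; ring.
Qed.

Let sinTsN x xi : sinTs f x (- xi) = - sinTs f x xi.
Proof.
rewrite /sinTs cosTN (sinTN (smooth_continuous dF (n := 0%N)) (fun x => @FK 0%N x isT)).
by rewrite mulNr cosN sinN; ring.
Qed.

(** Up to the factor [lambda alpha], this is the real part of the symbol times
    [exp(- i xi x)] times the Fourier transform of a real function [f];
    [multiplier_odd] below is the imaginary part. *)
Definition multiplier_even x xi :=
  cos_levy alpha xi * cosTs f x xi + sin_levy alpha xi * (r * sinTs f x xi).

Definition multiplier_odd x xi :=
  cos_levy alpha xi * sinTs f x xi + sin_levy alpha xi * (- r * cosTs f x xi).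

Let continuous_scale (s : R) (a : R -> R) : continuous a -> continuous (fun xi => s * a xi).
Proof. by move=> ca xi; apply: cvgM; [exact: cvg_cst|exact: ca]. Qed.

Let fubini_even x (D : set R) := @multiplier_fubini (cosTs f x) (fun xi => r * sinTs f x xi) M D
  (@continuous_cosTs _ _ _ dF FK x) (@continuous_scale r _ (@continuous_sinTs _ _ _ dF FK x))
  (cosTs_bound dF FK x) (scaled_bound r1 (sinTs_bound dF FK x)).

Let fubini_odd x (D : set R) := @multiplier_fubini (sinTs f x) (fun xi => - r * cosTs f x xi) M D
  (@continuous_sinTs _ _ _ dF FK x) (@continuous_scale (- r) _ (@continuous_cosTs _ _ _ dF FK x))
  (sinTs_bound dF FK x)
  (scaled_bound (eq_rect_r (fun s => is_true (s <= 1)) r1 (normrN r)) (cosTs_bound dF FK x)).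

Lemma integrable_multiplier_even x : mu.-integrable setT (EFin \o multiplier_even x).
Proof. by have [] := fubini_even x measurableT. Qed.

Lemma integrable_multiplier_odd x : mu.-integrable setT (EFin \o multiplier_odd x).
Proof. by have [] := fubini_odd x measurableT. Qed.

Lemma integral_multiplier_odd x : \int[mu]_xi multiplier_odd x xi = 0.
Proof.
rewrite Rintegral_fold; last exact: integrable_multiplier_odd.
rewrite (_ : (fun xi => _) = cst 0); last first.
  apply/funext => xi; rewrite /multiplier_odd cos_levyN sin_levyN cosTsN sinTsN.
  by rewrite /cst; ring.
by rewrite /Rintegral integral0.
Qed.

Let cf : continuous f.
Proof. exact: (smooth_continuous dF). Qed.

Lemma integrable_increments x :
  mu.-integrable `]0, +oo[ (EFin \o (fun y => (f x - f (x - y)) * y `^ (- alpha - 1))) /\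
  mu.-integrable `]0, +oo[ (EFin \o (fun y => (f x - f (x + y)) * y `^ (- alpha - 1))).
Proof.
have w1 (z : R) : cauchy_kernel z <= 1.
  by rewrite invf_le1 ?lerDl ?sqr_ge0// ltr_pwDl ?sqr_ge0.
have K0 : 0 <= K.
  have := le_trans (normr_ge0 _) (@FK 0%N 0 isT).
  by rewrite pmulr_lge0// cauchy_kernel_gt0.
have FK' n z : (n <= 4)%N -> `|F n z| <= K.
  by move=> n4; rewrite (le_trans (@FK n z n4))// ler_piMr.
have b := increment_bound _ _ (dF 0%N) (fun z => FK' 0%N z isT) (fun z => FK' 1%N z isT).
have mf (g : R -> R) : continuous g -> measurable_fun setT (fun y => f x - f (g y)).
  move=> cg; apply: measurable_funB => //; apply: continuous_measurable_fun => y.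
  by apply: continuous_comp; [exact: cg|exact: cf].
split; apply: (integrable_jump (C := 2 * K)).
- by apply: mf => y; apply: cvgB; [exact: cvg_cst|exact: cvg_id].
- move=> y y0; apply: le_trans (b _ _) _.
  by rewrite opprB addrC subrK (ger0_norm y0).
- by apply: mf => y; apply: cvgD; [exact: cvg_cst|exact: cvg_id].
- move=> y y0; apply: le_trans (b _ _) _.
  by rewrite distrC addrC addKr (ger0_norm y0).
Qed.

(** By the addition formulas the integrand over [xi], for a fixed jump [y], is the
    transform of [f] at [x] minus [p] times that at [x - y] and [q] times that at
    [x + y]; each integrates to [pi] times a value of [f]. *)
Theorem integral_multiplier_even x : \int[mu]_xi multiplier_even x xi =
  2 * pi * (p * levy_integral alpha (fun y => f x - f (x - y)) +
            q * levy_integral alpha (fun y => f x - f (x + y))).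
Proof.
rewrite Rintegral_fold; last exact: integrable_multiplier_even.
transitivity (2 * \int[mu]_(xi in `]0, +oo[) multiplier_even x xi).
  have iE : mu.-integrable `]0, +oo[ (EFin \o multiplier_even x).
    exact: integrableS (integrable_multiplier_even x).
  rewrite -[RHS](@RintegralZl _ _ R mu _ _ 2 (measurable_itv _) iE).
  apply: eq_Rintegral => xi _.
  by rewrite /multiplier_even cos_levyN sin_levyN cosTsN sinTsN; ring.
rewrite -mulrA; congr (_ * _).
have [_ ->] := fubini_even x (measurable_itv `]0, +oo[).
have iC z : mu.-integrable `]0, +oo[ (EFin \o cosTs f z).
  have mC : measurable_fun setT (cosTs f z).
    by apply: continuous_measurable_fun; exact: (continuous_cosTs dF FK).
  apply: integrableS (integrable_cauchy_dominated mC (cosTs_dominated dF FK z)) => //.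
have iCs s z : mu.-integrable `]0, +oo[ (EFin \o (fun xi => s * cosTs f z xi)).
  exact: (@integrable_mulr _ _ R mu _ (measurable_itv _) s _ (iC z)).
have iG y : mu.-integrable `]0, +oo[
    (EFin \o (fun xi => cosTs f x xi - p * cosTs f (x - y) xi - q * cosTs f (x + y) xi)).
  have i1 := @integrable_subr _ _ R mu _ (measurable_itv `]0, +oo[) _ _ (iC x) (iCs p (x - y)).
  exact: (@integrable_subr _ _ R mu _ (measurable_itv `]0, +oo[) _ _ i1 (iCs q (x + y))).
have inner y : \int[mu]_(xi in `]0, +oo[) (((1 - cos (xi * y)) * cosTs f x xi +
      sin (xi * y) * (r * sinTs f x xi)) * y `^ (- alpha - 1)) =
    pi * ((f x - p * f (x - y) - q * f (x + y)) * y `^ (- alpha - 1)).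
  transitivity (\int[mu]_(xi in `]0, +oo[) ((cosTs f x xi - p * cosTs f (x - y) xi -
      q * cosTs f (x + y) xi) * y `^ (- alpha - 1))).
    apply: eq_Rintegral => xi _; rewrite cosTs_sub cosTs_add /r.
    by rewrite (_ : q = 1 - p); [ring|rewrite -pq1; ring].
  rewrite RintegralZr// mulrA; congr (_ * _).
  rewrite RintegralB//; last first.
    exact: (@integrable_subr _ _ R mu _ (measurable_itv `]0, +oo[) _ _ (iC x) (iCs p (x - y))).
  rewrite RintegralB// !RintegralZl// !(cosine_inversion dF FK).
  by rewrite /f; ring.
transitivity (\int[mu]_(y in `]0, +oo[)
    (pi * ((f x - p * f (x - y) - q * f (x + y)) * y `^ (- alpha - 1)))).
  by apply: eq_Rintegral => y _; exact: inner.
have [iS iA] := integrable_increments x.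
have iS' := @integrable_mulr _ _ R mu _ (measurable_itv `]0, +oo[) (pi * p) _ iS.
have iA' := @integrable_mulr _ _ R mu _ (measurable_itv `]0, +oo[) (pi * q) _ iA.
rewrite mulrDr !mulrA /levy_integral -!RintegralZl// -RintegralD//.
apply: eq_Rintegral => y _.
by rewrite (_ : q = 1 - p); [ring|rewrite -pq1; ring].
Qed.

End smooth.
End multiplier.

(** * Weyl derivatives as integrals over the jumps *)

Section weyl_real.
Context {R : realType}.
Notation mu := (@lebesgue_measure R).
Variable alpha : R.
Hypotheses (alpha_gt0 : 0 < alpha) (alpha_lt1 : alpha < 1).
Variables (F : nat -> R -> R) (K : R).
Hypothesis dF : forall n (x : R), is_derive x 1 (F n) (F n.+1 x).
Hypothesis FK : forall n x, (n <= 4)%N -> `|F n x| <= K * cauchy_kernel x.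
Variable s : R.
Hypothesis s2 : s ^+ 2 = 1.

Let cF n : continuous (F n).
Proof. exact: (smooth_continuous dF). Qed.

Let cauchy_pos (z : R) : 0 < 1 + z ^+ 2.
Proof. by rewrite ltr_pwDl// sqr_ge0. Qed.

Let K0 : 0 <= K.
Proof.
have := le_trans (normr_ge0 _) (@FK 0%N 0 isT).
by rewrite pmulr_lge0// cauchy_kernel_gt0.
Qed.

(** Peetre's inequality; it makes dominations locally uniform in [z]. *)
Lemma cauchy_kernel_shift (z y : R) :
  cauchy_kernel (z + s * y) <= 2 * (1 + z ^+ 2) * cauchy_kernel y.
Proof.
rewrite /cauchy_kernel ler_pdivlMr// mulrC ler_pdivrMr//.
set w := z + s * y; have -> : y ^+ 2 = (w - z) ^+ 2.
  by rewrite /w [z + _]addrC addrK exprMn s2 mul1r.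
have := sqr_ge0 (w + z); have := sqr_ge0 (w * z).
by rewrite exprMn; lra.
Qed.

Lemma cauchy_kernel_min (y : R) : 0 <= y -> y * cauchy_kernel y <= Num.min 1 y.
Proof.
move=> y0; rewrite /cauchy_kernel le_min; apply/andP; split.
  by rewrite ler_pdivrMr// mul1r; have := sqr_ge0 (y - 1); rewrite sqrrB1; lra.
by rewrite ler_pdivrMr// ler_peMr// lerDl sqr_ge0.
Qed.

Let weight_bound n (z y : R) : (n <= 4)%N -> 0 < y ->
  `|F n (z + s * y)| * y <= K * (2 * (1 + z ^+ 2)) * Num.min 1 y.
Proof.
move=> n4 y0; apply: (@le_trans _ _ (K * (2 * (1 + z ^+ 2)) * (y * cauchy_kernel y))).
  rewrite [leRHS](_ : _ = K * (2 * (1 + z ^+ 2) * cauchy_kernel y) * y); last by ring.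
  rewrite ler_wpM2r ?(ltW y0)// (le_trans (FK _ n4))// ler_wpM2l//.
  exact: cauchy_kernel_shift.
by rewrite ler_wpM2l ?mulr_ge0 ?(ltW (cauchy_pos z))// cauchy_kernel_min// ltW.
Qed.

Let integrand_bound n (z y : R) : (n <= 4)%N -> 0 < y ->
  `|F n (z + s * y) * y `^ (- alpha)| <= K * (2 * (1 + z ^+ 2)) * jump_weight alpha y.
Proof.
move=> n4 y0; rewrite normrM (ger0_norm (powR_ge0 _ _)) -(powRN1 alpha y0).
by rewrite /jump_weight (mulrA `|_|) (mulrA (K * _)) ler_wpM2r ?powR_ge0// weight_bound.
Qed.

Let continuous_shift n z : continuous (fun y : R => F n (z + s * y)).
Proof.
move=> y; apply: continuous_comp; last exact: cF.
by apply: cvgD; [exact: cvg_cst|apply: cvgM; [exact: cvg_cst|exact: cvg_id]].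
Qed.

Lemma integrable_weyl n z : (n <= 4)%N ->
  mu.-integrable `]0, +oo[ (EFin \o (fun y => F n (z + s * y) * y `^ (- alpha))).
Proof.
move=> n4; have iJ := integrable_jump_weight alpha_gt0 alpha_lt1.
have iJ' := @integrable_mulr _ _ R mu _ (measurable_itv _) (K * (2 * (1 + z ^+ 2))) _ iJ.
apply: (@integrable_dominated _ _ R mu _ _ _ _ _ iJ') => //.
  apply: measurable_funTS; apply: measurable_funM; last exact: measurable_powR.
  by apply: continuous_measurable_fun; exact: continuous_shift.
by move=> y /=; rewrite in_itv/= andbT => y0; exact: integrand_bound.
Qed.

Let dshift n (y z : R) : is_derive z 1 (fun z => F n (z + s * y)) (F n.+1 (z + s * y)).
Proof.
have d1 : is_derive z 1 (fun z : R => z + s * y) 1.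
  have := is_deriveD (is_derive_id z 1) (is_derive_cst (s * y) z 1).
  by move/is_derive_eq; apply; rewrite addr0.
have := @is_derive1_comp _ (F n) (fun z => z + s * y) _ _ _ (dF n (z + s * y)) d1.
by move/is_derive_eq; apply; rewrite mulr1.
Qed.

(** The derivative passes under the integral sign because the bounds for [F 1] are
    uniform for [z] in a bounded neighbourhood of [x]. *)
Lemma weyl_under_integral x :
  derive1 (fun z => \int[mu]_(y in `]0, +oo[) (F 0%N (z + s * y) * y `^ (- alpha))) x =
  \int[mu]_(y in `]0, +oo[) (F 1%N (x + s * y) * y `^ (- alpha)).
Proof.
pose h (z y : R) := F 0%N (z + s * y) * y `^ (- alpha).
have dh (z y : R) : is_derive z 1 (h ^~ y) (F 1%N (z + s * y) * y `^ (- alpha)).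
  have := is_deriveM (dshift 0%N y z) (is_derive_cst (y `^ (- alpha)) z 1).
  by move/is_derive_eq; apply; rewrite /GRing.scale/= mulr0 add0r mulrC.
have ph z y : partial1of2 h z y = F 1%N (z + s * y) * y `^ (- alpha).
  by rewrite partial1of2E; exact: derive_val.
pose C := K * (2 * (1 + (`|x| + 1) ^+ 2)).
have iJ := integrable_jump_weight alpha_gt0 alpha_lt1.
have iG : mu.-integrable `]0, +oo[ (EFin \o (fun y => `|C * jump_weight alpha y|)).
  exact: (integrable_abse (@integrable_mulr _ _ R mu _ (measurable_itv _) C _ iJ)).
rewrite (@differentiation_under_integral R _ _ mu h `]0, +oo[%classic (measurable_itv _)
  x (x - 1) (x + 1) _ _ _ (fun y => `|C * jump_weight alpha y|) _ iG).
- by apply: eq_Rintegral => y _; exact: ph.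
- by rewrite /= in_itv/= gtrDl ltrDl oppr_lt0 ltr01.
- by move=> z _; exact: (@integrable_weyl 0%N z isT).
- by move=> z y _ _; have /@ex_derive := dh z y.
- by [].
- move=> z y /=; rewrite !in_itv/= andbT => /andP[z1 z2] y0; rewrite ph.
  apply: le_trans (integrand_bound z (isT : (1 <= 4)%N) y0) _.
  apply: le_trans (ler_norm _); rewrite ler_wpM2r ?jump_weight_ge0//.
  rewrite /C !ler_wpM2l// lerD2l -(real_normK (num_real z)) ler_sqr ?nnegrE ?addr_ge0//.
  rewrite -[z](subrK x) addrC (le_trans (ler_normD _ _))// lerD2l.
  by rewrite ler_norml; apply/andP; split; lra.
Qed.

Let continuous_scale (a : R) (g : R -> R) : continuous g -> continuous (fun y => a * g y).
Proof. by move=> cg y; apply: cvgM; [exact: cvg_cst|exact: cg]. Qed.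

(** For both signs [s] the function [f x - f (x + s y)] vanishes at [y = 0] and is
    bounded, as the integration by parts requires. *)
Lemma weyl_parts x :
  - s * \int[mu]_(y in `]0, +oo[) (F 1%N (x + s * y) * y `^ (- alpha)) =
  alpha * levy_integral alpha (fun y => F 0%N x - F 0%N (x + s * y)).
Proof.
have s1 : `|s| = 1.
  by apply/eqP; rewrite -(@eqrXn2 _ 2%N) ?normr_ge0 ?expr1n// real_normK ?num_real// s2.
have w1 (z : R) : cauchy_kernel z <= 1.
  by rewrite invf_le1 ?lerDl ?sqr_ge0// ltr_pwDl ?sqr_ge0.
have FK' n z : (n <= 4)%N -> `|F n z| <= K.
  by move=> n4; rewrite (le_trans (@FK n z n4))// ler_piMr.
have b := increment_bound _ _ (dF 0%N) (fun z => FK' 0%N z isT) (fun z => FK' 1%N z isT).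
have dg (y : R) : is_derive y 1 (fun y => F 0%N x - F 0%N (x + s * y)) (- s * F 1%N (x + s * y)).
  have d1 : is_derive y 1 (fun y : R => x + s * y) s.
    have := is_deriveD (is_derive_cst x y 1) (is_deriveZ s (is_derive_id y 1)).
    by move/is_derive_eq; apply; rewrite /GRing.scale/= mulr1 add0r.
  have := is_deriveB (is_derive_cst (F 0%N x) y 1)
    (@is_derive1_comp _ (F 0%N) (fun y => x + s * y) _ _ _ (dF 0%N (x + s * y)) d1).
  by move/is_derive_eq; apply; rewrite sub0r mulrC mulNr.
pose C := 2 * K + K * (2 * (1 + x ^+ 2)).
have C1 : 2 * K <= C by rewrite lerDl !mulr_ge0// ltW.
have C2 : K * (2 * (1 + x ^+ 2)) <= C by rewrite lerDr mulr_ge0.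
have m0 (y : R) : 0 < y -> 0 <= Num.min 1 y by move=> y0; rewrite le_min ler01 ltW.
have gC (y : R) : 0 < y -> `|F 0%N x - F 0%N (x + s * y)| <= C * Num.min 1 y.
  move=> y0; rewrite (le_trans (b _ _))// opprD addrA subrr sub0r normrN normrM s1 mul1r.
  by rewrite (gtr0_norm y0) ler_wpM2r// m0.
have g'C (y : R) : 0 < y -> `|- s * F 1%N (x + s * y)| * y <= C * Num.min 1 y.
  move=> y0; rewrite normrM normrN s1 mul1r.
  by rewrite (le_trans (weight_bound x (isT : (1 <= 4)%N) y0))// ler_wpM2r// m0.
have [_ _ E] := @integration_by_parts_powR _ _ alpha_gt0 alpha_lt1 _ _ C (fun y _ => dg y)
  (fun y _ => @continuous_scale (- s) _ (@continuous_shift 1%N x) y) gC g'C.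
rewrite /levy_integral -E -RintegralZl//; last exact: (@integrable_weyl 1%N x isT).
by apply: eq_Rintegral => y _; rewrite mulrA.
Qed.

End weyl_real.

(** * The generator on Schwartz functions *)

Section generator.
Context {R : realType}.
Notation mu := (@lebesgue_measure R).
Variable alpha : R.
Hypotheses (alpha_gt0 : 0 < alpha) (alpha_lt1 : alpha < 1).

Lemma schwartz_is_derive (f : R -> R) : real_schwartz f ->
  forall n (x : R), is_derive x 1 (derive1n n f) (derive1n n.+1 f x).
Proof.
by move=> [df _] n x; rewrite derive1nS derive1E; exact: derivableP.
Qed.

(** One constant for all the orders met in four integrations by parts. *)
Lemma schwartz_dominated (f : R -> R) : real_schwartz f ->
  exists K, forall n x, (n <= 4)%N -> `|derive1n n f x| <= K * cauchy_kernel x.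
Proof.
move=> [_ fC].
have H n : exists C, forall x, `|derive1n n f x| <= C * cauchy_kernel x.
  have [A HA] := fC 0%N n; have [B HB] := fC 2%N n.
  exists (A + B) => x; have := HA x; have := HB x.
  rewrite expr0 mul1r real_normK ?num_real// => h2 h0.
  rewrite /cauchy_kernel ler_pdivlMr; last by rewrite ltr_pwDl// sqr_ge0.
  by rewrite mulrDr mulr1 lerD// mulrC.
have [C HC] := choice H.
exists (\sum_(i < 5) `|C i|) => n x n4.
apply: le_trans (HC n x) _; rewrite ler_wpM2r ?(ltW (cauchy_kernel_gt0 x))//.
rewrite (bigD1 (Ordinal (n4 : (n < 5)%N)))//=.
by rewrite (le_trans (ler_norm _))// lerDl sumr_ge0.
Qed.

Let weyl_real (f : R -> R) (s x : R) : real_schwartz f -> s ^+ 2 = 1 ->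
  - s * derive1 (fun z => \int[mu]_(y in `]0, +oo[) (f (z + s * y) * y `^ (- alpha))) x =
  alpha * levy_integral alpha (fun y => f x - f (x + s * y)).
Proof.
move=> fS s2; have dF := schwartz_is_derive fS; have [K FK] := schwartz_dominated fS.
rewrite -(weyl_parts alpha_gt0 alpha_lt1 dF FK s2).
by rewrite -(weyl_under_integral alpha_gt0 alpha_lt1 dF FK s2).
Qed.

Let jump_part (f : R -> R[i]) (x s : R) :=
  levy_integral alpha (fun y => complex.Re (f x) - complex.Re (f (x + s * y))) +i*
  levy_integral alpha (fun y => complex.Im (f x) - complex.Im (f (x + s * y))).

Let Cderive_weyl (f : R -> R[i]) (s x : R) : schwartz f -> s ^+ 2 = 1 ->
  (- s)%:C * Cderive1 (fun z => Cintegral mu `]0, +oo[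
    (fun y => f (z + s * y) * (y `^ (- alpha))%:C)) x = alpha%:C * jump_part f x s.
Proof.
move=> [fr fi] s2; rewrite /Cderive1 /jump_part.
rewrite (_ : @complex.Re R \o _ = (fun z => \int[mu]_(y in `]0, +oo[)
    ((@complex.Re R \o f) (z + s * y) * y `^ (- alpha)))); last first.
  apply/funext => z; apply: eq_Rintegral => y _ /=.
  by case: (f _) => a b /=; rewrite mulr0 subr0.
rewrite (_ : @complex.Im R \o _ = (fun z => \int[mu]_(y in `]0, +oo[)
    ((@complex.Im R \o f) (z + s * y) * y `^ (- alpha)))); last first.
  apply/funext => z; apply: eq_Rintegral => y _ /=.
  by case: (f _) => a b /=; rewrite mulr0 add0r.
have Er := weyl_real x fr s2; have Ei := weyl_real x fi s2.
apply/eqP; rewrite eq_complex /=; apply/andP; split; apply/eqP.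
  by rewrite !mul0r !subr0.
by rewrite !mul0r !addr0.
Qed.

Lemma weylE (f : R -> R[i]) x : schwartz f ->
  weyl alpha f x = (alpha / Gamma (1 - alpha))%:C *
    ((levy_integral alpha (fun y => complex.Re (f x) - complex.Re (f (x - y)))) +i*
     (levy_integral alpha (fun y => complex.Im (f x) - complex.Im (f (x - y))))).
Proof.
move=> fS; have s2 : (-1 : R) ^+ 2 = 1 by rewrite sqrrN expr1n.
have := Cderive_weyl x fS s2; rewrite opprK mul1r /weyl /jump_part.
rewrite (_ : (fun z => _) = (fun z => Cintegral mu `]0, +oo[
    (fun y => f (z - y) * (y `^ (- alpha))%:C))); last first.
  by apply/funext => z; congr Cintegral; apply/funext => y; rewrite mulN1r.
rewrite (_ : (fun y => _ - complex.Re _) =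
  (fun y => complex.Re (f x) - complex.Re (f (x - y)))); last first.
  by apply/funext => y; rewrite mulN1r.
rewrite (_ : (fun y => _ - complex.Im _) =
  (fun y => complex.Im (f x) - complex.Im (f (x - y)))); last first.
  by apply/funext => y; rewrite mulN1r.
by move=> ->; rewrite mulrA -rmorphM /= [_^-1 * _]mulrC.
Qed.

Lemma weyl_negE (f : R -> R[i]) x : schwartz f ->
  weyl_neg alpha f x = (alpha / Gamma (1 - alpha))%:C *
    ((levy_integral alpha (fun y => complex.Re (f x) - complex.Re (f (x + y)))) +i*
     (levy_integral alpha (fun y => complex.Im (f x) - complex.Im (f (x + y))))).
Proof.
move=> fS; have s2 : (1 : R) ^+ 2 = 1 by rewrite expr1n.
have := Cderive_weyl x fS s2; rewrite /weyl_neg /jump_part.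
rewrite (_ : (fun z => _) = (fun z => Cintegral mu `]0, +oo[
    (fun y => f (z + y) * (y `^ (- alpha))%:C))); last first.
  by apply/funext => z; congr Cintegral; apply/funext => y; rewrite mul1r.
rewrite (_ : (fun y => _ - complex.Re _) =
  (fun y => complex.Re (f x) - complex.Re (f (x + y)))); last first.
  by apply/funext => y; rewrite mul1r.
rewrite (_ : (fun y => _ - complex.Im _) =
  (fun y => complex.Im (f x) - complex.Im (f (x + y)))); last first.
  by apply/funext => y; rewrite mul1r.
have -> : (- (Gamma (1 - alpha))^-1)%:C = ((Gamma (1 - alpha))^-1)%:C * (-1)%:C.
  by rewrite -rmorphM /= mulrN1.
rewrite -mulrA => ->.
by rewrite mulrA -rmorphM /= [_^-1 * _]mulrC.
Qed.

(** The Fourier transform of the real and of the imaginary part of [f] are both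
    complex, so each component mixes two real transforms. *)
Lemma fourierE (f : R -> R[i]) xi : schwartz f ->
  fourier f xi = (cosT (@complex.Re R \o f) xi - sinT (@complex.Im R \o f) xi) +i*
                 (cosT (@complex.Im R \o f) xi + sinT (@complex.Re R \o f) xi).
Proof.
move=> [fr fi]; have [K1 FK1] := schwartz_dominated fr; have [K2 FK2] := schwartz_dominated fi.
have c1 := smooth_continuous (schwartz_is_derive fr) (n := 0%N).
have c2 := smooth_continuous (schwartz_is_derive fi) (n := 0%N).
have d1 := fun x => FK1 0%N x isT; have d2 := fun x => FK2 0%N x isT.
rewrite /fourier /Cintegral /cosT /sinT; congr (_ +i* _).
- rewrite -RintegralB//; last 2 first.
  + exact: integrable_cosT c1 d1 xi.
  + exact: integrable_sinT c2 d2 xi.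
  by apply: eq_Rintegral => x _ /=; case: (f x) => a b.
- rewrite -RintegralD//; last 2 first.
  + exact: integrable_cosT c2 d2 xi.
  + exact: integrable_sinT c1 d1 xi.
  by apply: eq_Rintegral => x _ /=; case: (f x) => a b.
Qed.

Variables (c p q : R).
Hypotheses (p0 : 0 <= p) (q0 : 0 <= q) (pq1 : p + q = 1).

(** In each component the even part of one real transform meets the odd part of the
    other, and the odd part integrates to zero. *)
Theorem multiplier_inversion (f : R -> R[i]) x : schwartz f ->
  Cintegral mu setT (fun xi => cis (- (xi * x)) *
    ((c * cos_levy alpha xi) +i* (- (c * ((p - q) * sin_levy alpha xi)))) * fourier f xi) =
  (2 * pi * c)%:C *
    (p%:C * ((levy_integral alpha (fun y => complex.Re (f x) - complex.Re (f (x - y)))) +i*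
             (levy_integral alpha (fun y => complex.Im (f x) - complex.Im (f (x - y))))) +
     q%:C * ((levy_integral alpha (fun y => complex.Re (f x) - complex.Re (f (x + y)))) +i*
             (levy_integral alpha (fun y => complex.Im (f x) - complex.Im (f (x + y)))))).
Proof.
move=> fS; have [fr fi] := fS.
have dr := schwartz_is_derive fr; have di := schwartz_is_derive fi.
have [K1 FK1] := schwartz_dominated fr; have [K2 FK2] := schwartz_dominated fi.
pose Fr n := derive1n n (@complex.Re R \o f); pose Fi n := derive1n n (@complex.Im R \o f).
have ie1 := integrable_multiplier_even alpha_gt0 alpha_lt1 p0 q0 pq1 dr FK1 x.
have ie2 := integrable_multiplier_even alpha_gt0 alpha_lt1 p0 q0 pq1 di FK2 x.
have io1 := integrable_multiplier_odd alpha_gt0 alpha_lt1 p0 q0 pq1 dr FK1 x.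
have io2 := integrable_multiplier_odd alpha_gt0 alpha_lt1 p0 q0 pq1 di FK2 x.
have E1 : \int[mu]_xi multiplier_even alpha p q Fr x xi = _ :=
  integral_multiplier_even alpha_gt0 alpha_lt1 p0 q0 pq1 dr FK1 x.
have E2 : \int[mu]_xi multiplier_even alpha p q Fi x xi = _ :=
  integral_multiplier_even alpha_gt0 alpha_lt1 p0 q0 pq1 di FK2 x.
have O1 : \int[mu]_xi multiplier_odd alpha p q Fr x xi = _ :=
  integral_multiplier_odd alpha_gt0 alpha_lt1 p0 q0 pq1 dr FK1 x.
have O2 : \int[mu]_xi multiplier_odd alpha p q Fi x xi = _ :=
  integral_multiplier_odd alpha_gt0 alpha_lt1 p0 q0 pq1 di FK2 x.
have ip xi : cis (- (xi * x)) *
    ((c * cos_levy alpha xi) +i* (- (c * ((p - q) * sin_levy alpha xi)))) * fourier f xi =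
    (c * (multiplier_even alpha p q Fr x xi - multiplier_odd alpha p q Fi x xi)) +i*
    (c * (multiplier_even alpha p q Fi x xi + multiplier_odd alpha p q Fr x xi)).
  rewrite fourierE// /cis cosN sinN /multiplier_even /multiplier_odd /cosTs /sinTs.
  by rewrite /Fr /Fi /=; congr (_ +i* _); rewrite /=; ring.
rewrite [LHS](_ : _ =
  (\int[mu]_xi (c * (multiplier_even alpha p q Fr x xi - multiplier_odd alpha p q Fi x xi))) +i*
  (\int[mu]_xi (c * (multiplier_even alpha p q Fi x xi + multiplier_odd alpha p q Fr x xi)))); last first.
  by rewrite /Cintegral; congr (_ +i* _); apply: eq_Rintegral => xi _; rewrite ip.
have i1 := @integrable_subr _ _ R mu _ measurableT _ _ ie1 io2.
have i2 := @integrable_addr _ _ R mu _ measurableT _ _ ie2 io1.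
rewrite !RintegralZl// (RintegralB measurableT ie1 io2) (RintegralD measurableT ie2 io1) E1 E2 O1 O2 subr0 addr0.
by apply/eqP; rewrite eq_complex /=; apply/andP; split; apply/eqP; ring.
Qed.

End generator.

Theorem theorem1 (R : realType) (lambda alpha p q : R)
  (lambda_gt0 : 0 < lambda) (alpha_gt0 : 0 < alpha) (alpha_lt1 : alpha < 1)
  (p_ge0 : 0 <= p) (q_ge0 : 0 <= q) (pq1 : p + q = 1)
  (d : measure_display) (T : measurableType d) (P : probability T R)
  (N : R -> {RV P >-> nat}) (X eps : nat -> {RV P >-> R})
  (N_poisson : poisson_process lambda N)
  (X_exp : forall j (B : set R), measurable B ->
     distribution P (X j) B = exponential_prob alpha B)
  (eps_pos : forall j, P [set w | eps j w = 1] = p%:E)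
  (eps_neg : forall j, P [set w | eps j w = -1] = q%:E)
  (indep : mutually_independent P (driving_sigma N X eps))
  (d' : measure_display) (T' : measurableType d') (P' : probability T' R)
  (H1 H2 : R -> {RV P' >-> R})
  (H1_stable : stable_subordinator alpha H1)
  (H2_stable : stable_subordinator alpha H2)
  (H12_indep : mutually_independent P'
     (fun b : bool => process_sigma (if b then H1 else H2))) :
  let tstar t := lambda * Gamma (1 - alpha) * t in
  let Hlim t : {RV P' >-> R} := H1 (p * tstar t) \- H2 (q * tstar t) in
  (forall t, 0 < t ->
     cvg_in_distribution (0 : R)^'+
       (fun gamma => random_sumRV N X eps gamma (t / gamma `^ alpha))
       (Hlim t)) /\
  has_generator Hlim (fun f x =>
    - (lambda * Gamma (1 - alpha))%:C *
      (p%:C * weyl alpha f x + q%:C * weyl_neg alpha f x)).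
Proof.
move=> tstar Hlim.
have G0 := Gamma_gt0 alpha_gt0 alpha_lt1.
set G := Gamma (1 - alpha) in G0 tstar Hlim *.
have HlimE t w : Hlim t w = H1 (p * (lambda * G) * t) w - H2 (q * (lambda * G) * t) w.
  by rewrite /Hlim /tstar /= !mulrA.
have c10 : 0 <= p * (lambda * G) by rewrite !mulr_ge0// ltW.
have c20 : 0 <= q * (lambda * G) by rewrite !mulr_ge0// ltW.
split.
  move=> t t0.
  exact: (random_sum_cvg lambda_gt0 alpha_gt0 alpha_lt1 p_ge0 q_ge0 pq1 N_poisson
    X_exp eps_pos eps_neg indep H1_stable H2_stable H12_indep).
split.
  exact: (difference_levy (stable_levy H1_stable) (stable_levy H2_stable) H12_indep
    c10 c20 HlimE).
eexists.
  exact: (difference_symbol alpha_gt0 alpha_lt1 H1_stable H2_stable H12_indep c10 c20 HlimE).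
move=> f fS x.
have cE : (p * (lambda * G) + q * (lambda * G)) * (alpha / G) = lambda * alpha.
  by rewrite -mulrDl pq1 mul1r; field; rewrite gt_eqF.
have sE : (p * (lambda * G) - q * (lambda * G)) * (alpha / G) = lambda * alpha * (p - q).
  by field; rewrite gt_eqF.
have PhiE xi : ((p * (lambda * G) + q * (lambda * G)) * (alpha / G * cos_levy alpha xi)) +i*
    (- ((p * (lambda * G) - q * (lambda * G)) * (alpha / G * sin_levy alpha xi))) =
    (lambda * alpha * cos_levy alpha xi) +i*
    (- (lambda * alpha * ((p - q) * sin_levy alpha xi))).
  congr (_ +i* - _); first by rewrite mulrA cE.
  by rewrite mulrA sE mulrA.
rewrite (_ : (fun xi => _) = (fun xi => cis (- (xi * x)) *
    ((lambda * alpha * cos_levy alpha xi) +i*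
     (- (lambda * alpha * ((p - q) * sin_levy alpha xi)))) * fourier f xi)); last first.
  by apply/funext => xi; rewrite PhiE.
rewrite (multiplier_inversion alpha_gt0 alpha_lt1 (lambda * alpha) p_ge0 q_ge0 pq1)//.
rewrite weylE// weyl_negE// -/G; set V := (_ +i* _); set W := (_ +i* _).
have e1 : (lambda * G)%:C * (alpha / G)%:C = (lambda * alpha)%:C.
  by rewrite -rmorphM /=; congr (_%:C); field; rewrite gt_eqF.
have e2 : ((2 * pi)^-1)%:C * (2 * pi * (lambda * alpha))%:C = (lambda * alpha)%:C.
  by rewrite -rmorphM /= mulKf// gt_eqF// mulr_gt0// pi_gt0.
rewrite !mulNr; congr (- _); rewrite [RHS]mulrA e2 -e1; ring.
Qed.
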